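(* Let $(X,\mu)$ be a standard probability space and let $\mathcal{S}\leq \mathcal{R}$ be ergodic, discrete, measure-preserving equivalence relations on $(X,\mu)$. If the inclusion $\mathcal{S}\leq \mathcal{R}$ is coamenable, then $\mathcal{R}$ is strongly ergodic if and only if $\mathcal{S}$ is strongly ergodic.
   Context: An equivalence relation over a standard probability space $(X,\mu)$ is a Borel subset $\mathcal{R}\subseteq X\times X$ that is an equivalence relation on $X$; $[x]_{\mathcal{R}}$ denotes the class of $x$. It is discrete if $[x]_{\mathcal{R}}$ is countable for almost every $x$. For discrete $\mathcal{R}$ set $\mu_{\mathcal{R}}(E)=\int_X |\{y:(x,y)\in E\}|\,d\mu(x)$ for Borel $E\subseteq\mathcal{R}$ (and its completion); $\mathcal{R}$ is measure-preserving if $(x,y)\mapsto(y,x)$ preserves $\mu_{\mathcal{R}}$. $\mathcal{S}\leq\mathcal{R}$ means $\mathcal{S}\subseteq\mathcal{R}$, both relations over the same $(X,\mu)$. The full group $[\mathcal{R}]$ is the group of bimeasurable bijections $\gamma:X\to X$ with $\gamma(x)\in[x]_{\mathcal{R}}$ for almost every $x$, modulo almost everywhere equality. $\mathcal{R}$ is ergodic if every measurable $E\subseteq X$ with $\mu(\gamma E\Delta E)=0$ for all $\gamma\in[\mathcal{R}]$ satisfies $\mu(E)\in\{0,1\}$. $\mathcal{R}$ is strongly ergodic if whenever $(E_n)_n$ is a sequence of measurable subsets of $X$ with $\mu(\gamma E_n\Delta E_n)\to 0$ for all $\gamma\in[\mathcal{R}]$, then $\mu(E_n)(1-\mu(E_n))\to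 0$. Coamenability: for $\mathcal{S}\leq\mathcal{R}$ and $x\in X$ let $[x]_{\mathcal{R}}/\mathcal{S}$ be the set of $\mathcal{S}$-classes contained in $[x]_{\mathcal{R}}$. A family $\xi=(\xi_x)_{x\in X}$ with $\xi_x\in\ell^2([x]_{\mathcal{R}}/\mathcal{S})$ is measurable if $x\mapsto \xi_x([\gamma(x)]_{\mathcal{S}})$ is measurable for all $\gamma\in[\mathcal{R}]$. The inclusion $\mathcal{S}\leq\mathcal{R}$ is coamenable if there is a sequence of measurable families $\xi^{(n)}$ with $\|\xi^{(n)}_x\|_2=1$ for almost every $x$ and $\lim_{n}\|\xi^{(n)}_x-\xi^{(n)}_y\|_2=0$ for almost every $(x,y)\in\mathcal{R}$ (here $[x]_{\mathcal{R}}=[y]_{\mathcal{R}}$, so the difference makes sense). This is equivalent to the inclusion of von Neumann algebras $L(\mathcal{S})\subseteq L(\mathcal{R})$ being relatively amenable (coamenable) in the sense of Popa. *)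

(* Defs.v *)
From mathcomp Require Import all_boot all_order all_algebra.
From mathcomp Require Import all_classical all_reals all_analysis.
From mathcomp Require Import complex.

Set Implicit Arguments.
Unset Strict Implicit.
Unset Printing Implicit Defensive.

Import Order.TTheory GRing.Theory Num.Theory.
Import numFieldNormedType.Exports.

Local Open Scope classical_set_scope.
Local Open Scope ring_scope.
Local Open Scope ereal_scope.

(* A measurable space is standard Borel when it is isomorphic to a Polish
   space [Y] with its Borel sigma-algebra; a complete pseudometric space that
   is Hausdorff is a complete metric space (up to truncating the distance,
   which may be infinite). *)
Definition standard_borel (K : realType) (d : measure_display)
    (X : measurableType d) : Prop :=
  exists (Y : completePseudoMetricType K) (f : X -> Y),
    [/\ hausdorff_space Y,
        exists2 D : set Y, countable D & dense D,
        bijective f &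
        forall A : set X, measurable A <-> <<s @open Y >> (f @` A)].

Section relations.
Context {K : realType} {d : measure_display} {X : measurableType d}.
Variable mu : probability X K.
Implicit Types (R S E : set (X * X)) (g : X -> X).

(* Measurability in [X * X] is with respect to the product sigma-algebra,
   which is the Borel one when [X] is standard Borel. *)
Definition equivalence_rel_on R : Prop :=
  [/\ measurable R,
      forall x, R (x, x),
      forall x y, R (x, y) -> R (y, x) &
      forall x y z, R (x, y) -> R (y, z) -> R (x, z)].

Definition rel_class R (x : X) : set X := [set y | R (x, y)].

Definition discrete_rel R : Prop :=
  {ae mu, forall x, countable (rel_class R x)}.

(* [mu_R(E)] for [E] contained in [R]; the formula does not involve [R]. *)
Definition rel_measure E : \bar K := \int[mu]_x counting (xsection E x).

Definition measure_preserving_rel R : Prop :=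
  forall E, measurable E -> E `<=` R ->
    rel_measure [set xy | E (xy.2, xy.1)] = rel_measure E.

Definition dmp_equivalence_rel R : Prop :=
  [/\ equivalence_rel_on R, discrete_rel R & measure_preserving_rel R].

(* Representatives of the elements of the full group [[R]]. The notions below
   only depend on these up to almost everywhere equality, so the quotient is
   not formed. *)
Definition full_group R : set (X -> X) :=
  [set g : X -> X | [/\ bijective g,
               measurable_fun setT g,
               forall A, measurable A -> measurable (g @` A) &
               {ae mu, forall x, rel_class R x (g x)}]].

Definition ergodic R : Prop :=
  forall A : set X, measurable A ->
    (forall g, full_group R g -> mu ((g @` A) `+` A) = 0) ->
    mu A = 0 \/ mu A = 1.

Definition strongly_ergodic R : Prop :=
  forall A : nat -> set X, (forall n, measurable (A n)) ->
    (forall g, full_group R g ->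
       (fun n => mu ((g @` A n) `+` A n)) @ \oo --> 0) ->
    (fun n => mu (A n) * (1 - mu (A n))) @ \oo --> 0.

(* The set [[x]_R / S] of [S]-classes contained in [[x]_R]. *)
Definition class_quotient R S (x : X) : set (set X) :=
  [set c | (exists y, c = rel_class S y) /\ c `<=` rel_class R x].

Definition l2norm (T : choiceType) (I : set T) (v : T -> K[i]) : \bar K :=
  sqrte (\esum_(c in I) ((ComplexField.Normc.normc (v c) ^+ 2)%R)%:E).

Definition ae_measurable (f : X -> K) : Prop :=
  exists2 h : X -> K, measurable_fun setT h & {ae mu, forall x, f x = h x}.

(* [xi x c] is the coordinate of [xi_x] at the [S]-class [c]; it is only
   meaningful for [c] in [[x]_R / S]. For [g] in the full group, [[g x]_S]
   lies in [[x]_R / S] for almost every [x] only, hence measurability modulo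
   null sets. *)
Definition measurable_l2_family R S (xi : X -> set X -> K[i]) : Prop :=
  (forall x, l2norm (class_quotient R S x) (xi x) < +oo) /\
  forall g, full_group R g ->
    ae_measurable (fun x => complex.Re (xi x (rel_class S (g x)))) /\
    ae_measurable (fun x => complex.Im (xi x (rel_class S (g x)))).

Definition coamenable R S : Prop :=
  exists xi : nat -> X -> set X -> K[i],
    [/\ forall n, measurable_l2_family R S (xi n),
        forall n, {ae mu, forall x,
          l2norm (class_quotient R S x) (xi n x) = 1} &
        rel_measure.-negligible
          [set xy | R xy /\
            ~ ((fun n => l2norm (class_quotient R S xy.1)
                  (fun c => (xi n xy.1 c - xi n xy.2 c)%R)) @ \oo --> 0)]].

End relations.

(* Main.v *)
Require Import Defs.
From HB Require Import structures.
From mathcomp Require Import all_boot all_order all_algebra.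
From mathcomp Require Import all_classical all_reals all_analysis.
From mathcomp Require Import measurable_realfun complex ring lra zify.

(** From [S] to [R] the passage is immediate: the full group of [S] is
    contained in that of [R], so every sequence that is almost invariant under
    [R] is almost invariant under [S].

    For the converse, let [S] be ergodic but not strongly ergodic. An almost
    [S]-invariant sequence [Z n] is asymptotically independent of each fixed
    measurable set ([mixing]): along an ultrafilter,
    [B |-> lim mu (Z n `&` B)] is an [S]-invariant measure below [mu], and
    ergodicity makes its density constant. Intersecting the sets of a
    nontrivial almost invariant sequence with later ones therefore gives
    almost invariant sequences whose measures are bounded below and as small
    as desired ([exists_small_almost_invariant]).

    Coamenability supplies, for each [x], a probability measure on the
    [S]-classes contained in the [R]-class of [x], the square modulus of the
    unit vector at [x], which nearly does not change when [x] moves inside its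
    [R]-class. Keeping finitely many classes and rounding to multiples of
    [1 / m] turns it into integer weights of total at most [m]
    ([folner_exists]). Let [Z n] have measure about [eps], with [eps * m]
    between [1 / 8] and [1 / 4], and let [marked n x] be the total weight, as
    given by [x], of the classes whose representatives lie in [Z n]. Since
    [Z n] is almost [S]-invariant, it nearly is a union of classes, so
    [marked n] hardly changes when [x] moves inside its [R]-class
    ([marked_discrepancy]), while its mean is close to [eps] times the mean
    total weight.

    The mean says little about a single set such as [marked n > 0], which
    could be concentrated on a small set. The remedy is to take the level sets
    [l < marked n_l] for [l < m] at successive indices [n_l], each chosen so
    late that mixing controls its intersection with the union of the previous
    ones, and to let [C] be their union ([nearly_invariant_union]). The
    measures of the level sets add up to the mean of the count, and the
    measures of their symmetric differences with their translates add up to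
    the mean change of the count. Hence [C] has measure between [1 / 40] and
    [1 / 2], and it is nearly invariant under any finite number of generators
    of [R]. Letting the precision improve yields an almost [R]-invariant
    sequence that is not trivial, so [R] is not strongly ergodic.

    All this uses countably many measurable involutions whose orbits are
    almost all the classes of [R] ([feldman_moore]). They come from the fact
    that a measurable subset of [X * X] with countable sections is covered,
    over almost every point, by countably many graphs of measurable functions
    ([lusin_novikov]). Its proof represents measurable sets by trees of closed
    sets and chooses branches measurably outside a null set. *)

Set Implicit Arguments.
Unset Strict Implicit.
Unset Printing Implicit Defensive.

Import Order.TTheory GRing.Theory Num.Theory.
Import numFieldNormedType.Exports.

Local Open Scope classical_set_scope.
Local Open Scope ring_scope.

(** * Closed sets of a standard Borel space *)

(** What is retained of a Polish topology: [F] stands for the closed sets,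
    [C n] for a countable cover by closed sets whose diameters tend to [0]
    with [n], and [sb_complete] is the intersection theorem of Cantor. In this
    form [X] needs no topology of its own beside its sigma-algebra. *)
Record souslin_base (d : measure_display) (X : measurableType d)
    (F : set (set X)) (C : nat -> nat -> set X) : Prop := SouslinBase {
  sb_gen : @measurable d X = <<s F >>;
  sb_T : F setT;
  sb_I : forall A B, F A -> F B -> F (A `&` B);
  sb_C : forall n i, F (C n i);
  sb_compl : forall A, F A ->
    exists B : nat -> set X, (forall k, F (B k)) /\ ~` A = \bigcup_k B k;
  sb_cover : forall n x, exists i, C n i x;
  sb_sep : forall x y, x <> y -> exists n, forall i, ~ (C n i x /\ C n i y);
  sb_complete : forall V : nat -> set X, (forall n, F (V n)) ->
    (forall n, V n.+1 `<=` V n) ->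
    (forall n, exists i, V n.+1 `<=` C n i) ->
    (forall n, V n !=set0) -> exists x, forall n, V n x }.

Section base.
Context (K : realType).

Lemma closure_ball_sub (Y : pseudoMetricType K) (a b : Y) (r : K) : 0 < r ->
  closure (ball a r) b -> ball a (r + r) b.
Proof.
move=> r0 /(_ (ball b r)) [|z [az bz]]; first exact: nbhsx_ballx.
exact: ball_triangle az (ball_sym bz).
Qed.

Lemma exists_small_inv (e : K) : 0 < e -> exists n, n.+1%:R^-1 < e.
Proof.
move=> e0; have [n _ nP] : \forall n \near \oo, n.+1%:R^-1 < e.
  by apply: near_infty_natSinv_lt (PosNum e0).
by exists n; apply: nP => /=.
Qed.

(** [F] consists of the preimages of closed sets, and [C n i] is the preimage
    of the closure of the ball of radius [1 / (n + 1)] around the [i]-th point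
    of a dense sequence. Every open set is a countable union of such closures,
    because the space is separable. *)
Lemma standard_borel_souslin_base (d : measure_display) (X : measurableType d)
    (x0 : X) :
  standard_borel K X -> exists F C, @souslin_base d X F C.
Proof.
move=> [Y [f [hY [D cD dD] bf mE]]].
have [g fK gK] := bf.
have imf (B : set Y) : f @` (f @^-1` B) = B.
  by apply/seteqP; split=> [_ [x Bx <-]//|y By]; exists (g y); rewrite /= gK.
have pif (B : set X) : f @^-1` (f @` B) = B.
  by apply/seteqP; split=> [x [x' Bx' /(can_inj fK) <-]//|x Bx]; exists x.
have [y0 Dy0] : D !=set0.
  have [|y [_ Dy]] := dD setT _ openT; last by exists y.
  by exists (f x0).
have /pfcard_geP[D0|[e]] := cD; first by move: Dy0; rewrite D0.
have eD : forall i, D (e i) by move=> i; apply: funS.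
have De y : D y -> exists i, e i = y.
  by move=> Dy; have [i _ <-] := @surj _ _ _ _ e y Dy; exists i.
have r0 n : 0 < n.+1%:R^-1 :> K by rewrite invr_gt0 ltr0n.
pose F := [set A : set X | closed (f @` A)].
pose C n i := f @^-1` closure (ball (e i) (n.+1%:R^-1 : K)).
have FC n i : F (C n i) by rewrite /F /= /C imf; exact: closed_closure.
have dnear (y : Y) (r : K) : 0 < r -> exists i, ball y r (e i).
  move=> r_gt0; have /dD : (ball y r)° !=set0.
    by exists y; exact: nbhsx_ballx.
  move=> /(_ (open_interior _)) [z [yz /De[i iz]]].
  by exists i; rewrite iz; exact: interior_subset yz.
have small (y : Y) (O : set Y) : open O -> O y ->
    exists n i, closure (ball (e i) (n.+1%:R^-1 : K)) y /\
      closure (ball (e i) (n.+1%:R^-1 : K)) `<=` O.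
  move=> oO Oy; have /nbhs_ballP[r /= r_gt0 rO] : nbhs y O by exact: open_nbhs_nbhs.
  have [n nr] := @exists_small_inv (r / 3) ltac:(lra).
  have [i yi] := dnear y n.+1%:R^-1 (r0 n).
  exists n, i; split; first by apply: subset_closure; exact: ball_sym.
  move=> z /(closure_ball_sub (r0 n)) iz; apply: rO.
  have := ball_triangle yi iz; apply: le_ball; move: nr; set q := n.+1%:R^-1; lra.
exists F, C; split=> //.
- apply/seteqP; split=> A.
  + move=> /mE fA; rewrite -(pif A); move: fA.
    have -> : <<s F >> (f @^-1` (f @` A)) =
              [set B | <<s F >> (f @^-1` B)] (f @` A) by [].
    move: (f @` A); apply: smallest_sub.
      split=> /=.
      * by rewrite preimage_set0; have [] := smallest_sigma_algebra setT F.
      * move=> B; rewrite setTD preimage_setC -setTD.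
        by have [_ + _] := smallest_sigma_algebra setT F; apply.
      * move=> B FB; rewrite preimage_bigcup.
        by have [_ _ +] := smallest_sigma_algebra setT F; apply.
    move=> O oO /=.
    have -> : f @^-1` O = setT `\` (f @^-1` (~` O)).
      by rewrite setTD preimage_setC setCK.
    have [_ + _] := smallest_sigma_algebra setT F; apply.
    by apply: sub_sigma_algebra; rewrite /F /= imf; exact: open_closedC.
  + move: A; apply: smallest_sub; first exact: sigma_algebra_measurable.
    move=> A FA; apply/mE.
    rewrite -(setCK (f @` A)) -setTD.
    have [_ + _] := smallest_sigma_algebra setT (@open Y); apply.
    by apply: sub_sigma_algebra; exact: closed_openC.
- by rewrite /F/= (_ : f @` setT = setT) ?closedT// -subTset => y _; exists (g y).
- move=> A B FA FB; rewrite /F /= (_ : f @` (A `&` B) = f @` A `&` f @` B).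
    exact: closedI.
  apply/seteqP; split=> [y [x [Ax Bx] <-]|y [[x Ax <-] [x' Bx' fx]]].
    by split; exists x.
  by exists x => //; split=> //; rewrite -(can_inj fK fx).
- move=> A FA; have oA : open (~` (f @` A)) by exact: closed_openC.
  pose B k := if (unpickle k : option (nat * nat)) is Some (n, i) then
     if `[< C n i `<=` ~` A >] then C n i else set0 else set0.
  have F0 : F set0 by rewrite /F /= image_set0; exact: closed0.
  exists B; split.
    rewrite /B => k; case: unpickle => [[n i]|//]; by case: ifP.
  apply/seteqP; split=> [x Ax|x [k _]].
    have fx : (~` (f @` A)) (f x) by move=> [x' Ax' /(can_inj fK) xx']; rewrite xx' in Ax'.
    have [n [i [cx cs]]] := small (f x) _ oA fx.
    exists (pickle (n, i)) => //; rewrite /B pickleK ifT//.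
    by apply/asboolP => z /cs zA Az; apply: zA; exists z.
  rewrite /B; case: unpickle => [[n i]|//].
  by case: ifPn => // /asboolP; apply.
- move=> n x; have [i xi] := dnear (f x) n.+1%:R^-1 (r0 n).
  by exists i; apply: subset_closure; exact: ball_sym.
- move=> x y xy.
  have fxy : f x != f y by apply/eqP => /(can_inj fK).
  move: hY; rewrite (@ball_hausdorff K) => /(_ _ _ fxy)[[r1 r2] /= /eqP r12].
  (* Two points of [C n i] are at distance less than [4 / (n + 1)]: each is
     within [2 / (n + 1)] of the center. *)
  have [n nr] : exists n, n.+1%:R^-1 < r1%:num / 4.
    by apply: exists_small_inv; rewrite divr_gt0.
  exists n => i [/(closure_ball_sub (r0 n)) cx /(closure_ball_sub (r0 n)) cy].
  have : (ball (f x) r1%:num `&` ball (f y) r2%:num) (f y).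
    split; last exact: ballxx.
    have := ball_triangle (ball_sym cx) cy; apply: le_ball.
    by move: nr; set q := n.+1%:R^-1; set r := r1%:num => nr; lra.
  by rewrite r12.
- move=> V FV Vd Vs V0.
  have Vmono m n : (n <= m)%N -> V m `<=` V n.
    elim: m => [|m IH]; first by rewrite leqn0 => /eqP ->.
    rewrite leq_eqVlt => /predU1P[-> //|]; rewrite ltnS => /IH Vmn.
    exact: subset_trans (Vd m) Vmn.
  have [u uV] := choice V0.
  have cF : cauchy ((f \o u) @ \oo).
    apply: cauchy_exP => eps eps0.
    have [n nr] := @exists_small_inv (eps / 2) ltac:(lra).
    have [i Vi] := Vs n.
    exists (e i); exists n.+1 => // m /= nm.
    have /Vi : V n.+1 (u m) by exact: Vmono (uV m).
    move=> /(closure_ball_sub (r0 n)); apply: le_ball; move: nr; set q := n.+1%:R^-1; lra.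
  have cu : cvg ((f \o u) @ \oo) by apply: cauchy_cvg cF.
  pose z := lim ((f \o u) @ \oo); have uz : (f \o u) @ \oo --> z by exact: cu.
  exists (g z) => n.
  have : (f @` V n) z.
    apply: (@closed_cvg _ _ \oo _ (f \o u) (f @` V n)) uz => //; first exact: FV.
    by exists n => // m /= nm; exists (u m) => //; exact: Vmono (uV m).
  by move=> [x Vx <-]; rewrite fK.
Qed.

End base.

(** * Souslin representation of measurable relations *)

Section souslin.
Context (d : measure_display) (X : measurableType d).
Context (F : set (set X)) (C : nat -> nat -> set X).
Hypothesis sb : souslin_base F C.

(** Continuity, for the product topology on sequences and the discrete
    topology on values. *)
Definition locconst T (A : nat -> (nat -> nat) -> T) :=
  forall i a, exists N, forall b,
    (forall j, (j < N)%N -> b j = a j) -> A i b = A i a.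

(** The Souslin operation, with the sequences [a] as indices. The two
    variables play different roles: points are going to be selected in the
    second one, where the sets have to be closed, as a function of the first
    one, where measurability is enough. *)
Definition souslin (E : set (X * X)) :=
  exists A D : nat -> (nat -> nat) -> set X,
  [/\ forall i a, measurable (A i a), forall i a, F (D i a),
      locconst A, locconst D &
      forall x y, E (x, y) <-> exists a, forall i, A i a x /\ D i a y].

Lemma souslin_rect (P D : set X) : measurable P -> F D ->
  souslin (P `*` D).
Proof.
move=> mP FD; exists (fun _ _ => P), (fun _ _ => D); split => //.
- by move=> i a; exists 0%N.
- by move=> i a; exists 0%N.
- move=> x y; split=> [[Px Dy]|[a /(_ 0%N)]//].
  by exists (fun=> 0%N).
Qed.

Lemma locconst_union T (A : nat -> nat -> (nat -> nat) -> T) :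
  (forall k, locconst (A k)) ->
  locconst (fun i a => A (a 0%N) i (fun j => a j.+1)).
Proof.
move=> lA i a; have [N NP] := lA (a 0%N) i (fun j => a j.+1).
by exists N.+1 => b ba; rewrite ba//; apply: NP => j jN; exact: ba.
Qed.

(** The first entry of a sequence chooses one of the sets; the others form a
    sequence for that set. *)
Lemma souslin_bigcup (E : nat -> set (X * X)) : (forall k, souslin (E k)) ->
  souslin (\bigcup_k E k).
Proof.
move=> /choice[A /choice[D AD]].
exists (fun i a => A (a 0%N) i (fun j => a j.+1)).
exists (fun i a => D (a 0%N) i (fun j => a j.+1)); split.
- by move=> i a; have [+ _ _ _ _] := AD (a 0%N); apply.
- by move=> i a; have [_ + _ _ _] := AD (a 0%N); apply.
- by apply: locconst_union => k; have [_ _ + _ _] := AD k; apply.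
- by apply: locconst_union => k; have [_ _ _ + _] := AD k; apply.
- move=> x y; split.
  + move=> [k _]; have [_ _ _ _ ->] := AD k => -[a aP].
    by exists (fun j => if j is j'.+1 then a j' else k).
  + move=> [a aP]; exists (a 0%N) => //.
    by have [_ _ _ _ ->] := AD (a 0%N); exists (fun j => a j.+1).
Qed.

Lemma locconst_inter T (t : T) (A : nat -> nat -> (nat -> nat) -> T) :
  (forall k, locconst (A k)) ->
  locconst (fun i a => if (unpickle i : option (nat * nat)) is Some (k, l)
     then A k l (fun j => a (pickle (k, j))) else t).
Proof.
move=> lA i a; case: unpickle => [[k l]|]; last by exists 0%N.
have [N NP] := lA k l (fun j => a (pickle (k, j))).
exists (\max_(j < N) (pickle (k, nat_of_ord j)).+1)%N => b ba.
apply: NP => j jN; apply: ba.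
exact: (@leq_bigmax _ (fun j : 'I_N => (pickle (k, nat_of_ord j)).+1)
   (Ordinal jN)).
Qed.

(** A sequence encodes one sequence for each [k], by means of a pairing of the
    indices; the condition of index [pickle (k, l)] is the [l]-th one for the
    [k]-th set. *)
Lemma souslin_bigcap (E : nat -> set (X * X)) : (forall k, souslin (E k)) ->
  souslin (\bigcap_k E k).
Proof.
move=> /choice[A /choice[D AD]].
exists (fun i a => if (unpickle i : option (nat * nat)) is Some (k, l)
     then A k l (fun j => a (pickle (k, j))) else setT).
exists (fun i a => if (unpickle i : option (nat * nat)) is Some (k, l)
     then D k l (fun j => a (pickle (k, j))) else setT); split.
- move=> i a; case: unpickle => [[k l]|//].
  by have [+ _ _ _ _] := AD k; apply.
- move=> i a; case: unpickle => [[k l]|]; last exact: sb_T sb.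
  by have [_ + _ _ _] := AD k; apply.
- by apply: locconst_inter => k; have [_ _ + _ _] := AD k; apply.
- by apply: locconst_inter => k; have [_ _ _ + _] := AD k; apply.
- move=> x y; split.
  + move=> Exy.
    have /choice[a aP] : forall k, exists a, forall i, A k i a x /\ D k i a y.
      by move=> k; have [_ _ _ _ <-] := AD k; apply: Exy.
    exists (fun q => if (unpickle q : option (nat * nat)) is Some (k, j)
                     then a k j else 0%N) => i.
    case: unpickle => [[k l]|//].
    rewrite (_ : (fun j => _) = a k)//.
    by apply/funext => j; rewrite pickleK.
  + move=> [a aP] k _; have [_ _ _ _ ->] := AD k.
    exists (fun j => a (pickle (k, j))) => i.
    by have := aP (pickle (k, i)); rewrite pickleK.
Qed.

(** The complement of a closed set is a countable union of closed sets. *)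
Lemma souslin_rectC (P D : set X) : measurable P -> F D ->
  souslin (~` (P `*` D)).
Proof.
move=> mP FD; have [B [FB DB]] := sb_compl sb FD.
rewrite (_ : ~` _ = \bigcup_k
   (if k is k'.+1 then setT `*` B k' else ~` P `*` setT)).
  apply: souslin_bigcup => -[|k]; apply: souslin_rect => //.
  - exact: measurableC.
  - exact: sb_T sb.
apply/seteqP; split=> [[x y] /= /not_andP[nP|nD]|[x y] [[|k] _] /=].
- by exists 0%N.
- have : (~` D) y by []; rewrite DB => -[k _ Bk].
  by exists k.+1.
- by move=> [nP _] [].
- move=> [_ Bk] [_ Dy]; suff : (~` D) y by apply.
  by rewrite DB; exists k.
Qed.

(** The sets that are Souslin together with their complements form a
    sigma-algebra, and it contains the rectangles: for a fixed measurable
    first factor, the second factor may be closed, hence may be any set in the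
    sigma-algebra generated by the closed sets. *)
Lemma measurable_souslin (E : set (X * X)) : measurable E -> souslin E.
Proof.
suff : @measurable _ (X * X)%type `<=` [set E | souslin E /\ souslin (~` E)].
  by move=> + mE => /(_ _ mE)[].
have sig : sigma_algebra setT [set E | souslin E /\ souslin (~` E)].
  split=> /=.
  - have F0 : F set0.
      have [B [FB TB]] := sb_compl sb (sb_T sb).
      suff <- : B 0%N = set0 by [].
      apply/seteqP; split=> // x Bx.
      have : (\bigcup_k B k) x by exists 0%N.
      by rewrite -TB setCT.
    have <- : [set: X] `*` set0 = set0 :> set (X * X) by rewrite setX0.
    by split; [exact: souslin_rect|exact: souslin_rectC].
  - by move=> A [sA sCA]; rewrite setTD setCK.
  - move=> A sA; split; first by apply: souslin_bigcup => k; have [] := sA k.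
    by rewrite setC_bigcup; apply: souslin_bigcap => k; have [] := sA k.
rewrite measurable_prod_measurableType; apply: smallest_sub => //.
move=> _ [P mP [Q mQ <-]].
move: Q mQ; suff : @measurable _ X `<=`
    [set Q | souslin (P `*` Q) /\ souslin (~` (P `*` Q))] by exact.
rewrite (sb_gen sb); apply: smallest_sub; last first.
  by move=> Q FQ; split; [exact: souslin_rect|exact: souslin_rectC].
split=> /=.
- by rewrite setX0; have [] := sig.
- move=> Q sQ.
  have -> : P `*` (setT `\` Q) =
      \bigcap_k (if k is 0%N then P `*` setT else ~` (P `*` Q)).
    apply/seteqP; split=> [[x y] [/= Px [_ nQ]] [|k] _ /=|[x y] xy].
    + by [].
    + by move=> [].
    + have [/= Px _] := xy 0%N I; split=> //; split=> // Qy.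
      by apply: (xy 1%N I).
  split.
    apply: souslin_bigcap => -[|k]; last by case: sQ.
    by apply: souslin_rect => //; exact: sb_T sb.
  rewrite setC_bigcap; apply: souslin_bigcup => -[|k].
    by apply: souslin_rectC => //; exact: sb_T sb.
  by rewrite setCK; case: sQ.
- move=> Q sQ; rewrite setX_bigcupr.
  by have [_ _ +] := sig; apply.
Qed.

End souslin.

(** * Souslin trees *)

Section tree.
Context (d : measure_display) (X : measurableType d).
Context (F : set (set X)) (C : nat -> nat -> set X).
Hypothesis sb : souslin_base F C.

(** Finite approximations of a Souslin representation. Along a branch the sets
    [V] shrink to one point, by [st_small]; condition [st_V0] allows
    completeness to provide that point as soon as some [x] lies in all the
    sets [T] of the branch. *)
Record souslin_tree (T V : seq nat -> set X) : Prop := SouslinTree {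
  st_meas : forall s, measurable (T s);
  st_closed : forall s, F (V s);
  st_T : forall s k, T (rcons s k) `<=` T s;
  st_V : forall s k, V (rcons s k) `<=` V s;
  st_small : forall s k, exists i, V (rcons s k) `<=` C (size s) i;
  st_V0 : forall s x, T s x -> V s !=set0 }.

Definition branch (T : seq nat -> set X) (s : seq nat) (x : X) (a : nat -> nat) :=
  mkseq a (size s) = s /\ forall n, T (mkseq a n) x.

Lemma base_bigcap (m : nat) (B : nat -> set X) : (forall i, F (B i)) ->
  F [set y | forall i, (i < m)%N -> B i y].
Proof.
move=> FB; elim: m => [|m IH].
  have -> : [set y : X | forall i, (i < 0)%N -> B i y] = setT by exact/seteqP.
  exact: sb_T sb.
rewrite (_ : mkset _ = [set y | forall i, (i < m)%N -> B i y] `&` B m).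
  exact: sb_I sb _ _ IH (FB m).
apply/seteqP; split=> [y yB|y [yB Bm] i].
  split=> [i im|]; apply: yB => //; exact: ltnW.
by rewrite ltnS leq_eqVlt => /predU1P[->|/yB].
Qed.

Lemma base_measurable (A : set X) : F A -> measurable A.
Proof. by rewrite (sb_gen sb); exact: sub_sigma_algebra. Qed.

Let p1 n := if (unpickle n : option (nat * nat)) is Some p then p.1 else 0%N.
Let p2 n := if (unpickle n : option (nat * nat)) is Some p then p.2 else 0%N.

(** An entry of a node encodes an entry of the Souslin sequence, together with
    the index of a small closed set that has to contain [y]. The [i]-th
    condition is imposed at [s] only if the entries of [s] decide what the
    condition says, which is [act s i]; by local constancy this happens at
    some node of each branch. *)
Lemma souslin_tree_of (E : set (X * X)) : measurable E ->
  exists T V, souslin_tree T V /\ forall x y,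
    E (x, y) <-> exists a, forall n, T (mkseq a n) x /\ V (mkseq a n) y.
Proof.
move=> /(measurable_souslin sb)[A [D [mA FD lA lD ED]]].
pose ext s j := p1 (nth 0%N s j).
pose act s i := forall b, (forall j, (j < size s)%N -> b j = ext s j) ->
   A i b = A i (ext s) /\ D i b = D i (ext s).
pose V s := [set y | forall i, (i < size s)%N ->
   (act s i -> D i (ext s) y) /\ C i (p2 (nth 0%N s i)) y].
pose T s := [set x | V s !=set0 /\
   forall i, (i < size s)%N -> act s i -> A i (ext s) x].
have extr s k j : (j < size s)%N -> ext (rcons s k) j = ext s j.
  by move=> js; rewrite /ext nth_rcons js.
have actr s k i : act s i -> [/\ act (rcons s k) i,
    A i (ext (rcons s k)) = A i (ext s) & D i (ext (rcons s k)) = D i (ext s)].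
  move=> si; have [<- <-] := si _ (extr s k).
  split=> // b bs.
  have [|-> ->] := si b; last by have [-> ->] := si _ (extr s k).
  by move=> j js; rewrite bs; [exact: extr|rewrite size_rcons; exact: ltnW].
have VS s k : V (rcons s k) `<=` V s.
  move=> y Vy i is_; have [] := Vy i; first by rewrite size_rcons; exact: ltnW.
  rewrite nth_rcons is_ => Dy Cy; split=> // si.
  by have [? _ <-] := actr _ k _ si; exact: Dy.
have actg a : (forall j, exists N, forall n, (N <= n)%N ->
     [/\ (j < size (mkseq a n))%N, act (mkseq a n) j,
         A j (ext (mkseq a n)) = A j (p1 \o a) &
         D j (ext (mkseq a n)) = D j (p1 \o a)]).
  move=> j; have [N1 NA] := lA j (p1 \o a); have [N2 ND] := lD j (p1 \o a).
  have aE n i : (i < n)%N -> ext (mkseq a n) i = (p1 \o a) i.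
    by move=> ni; rewrite /ext nth_mkseq.
  exists (maxn j.+1 (maxn N1 N2)) => n; rewrite !geq_max => /and3P[jn n1 n2].
  have EA : A j (ext (mkseq a n)) = A j (p1 \o a).
    by apply: NA => i iN; apply: aE; exact: leq_trans iN _.
  have ED' : D j (ext (mkseq a n)) = D j (p1 \o a).
    by apply: ND => i iN; apply: aE; exact: leq_trans iN _.
  rewrite size_mkseq; split=> // b; rewrite size_mkseq => bE; rewrite EA ED'; split.
    apply: NA => i iN; have jn' : (i < n)%N by exact: leq_trans iN _.
    by rewrite bE// aE.
  apply: ND => i iN; have jn' : (i < n)%N by exact: leq_trans iN _.
  by rewrite bE// aE.
exists T, V; split.
  split=> //.
  - move=> s.
    have -> : T s = (if `[< V s !=set0 >] then
        [set x | forall i, (i < size s)%N -> (if `[< act s i >] then A i (ext s) else setT) x] else set0).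
      apply/seteqP; split=> x; case: (asboolP (V s !=set0)) => Vs.
      + by move=> [_ Ax] i si; case: asboolP => // sA; exact: Ax.
      + by move=> [].
      + by move=> Ax; split=> // i si sA; have := Ax i si; rewrite asboolT.
      + by [].
    case: ifP => // _.
    have -> : [set x | forall i, (i < size s)%N -> (if `[< act s i >] then A i (ext s) else setT) x] =
       \bigcap_(i in [set i | (i < size s)%N]) (if `[< act s i >] then A i (ext s) else setT) by [].
    by apply: bigcap_measurableType => i _; case: ifP.
  - move=> s.
    have -> : V s = [set y | forall i, (i < size s)%N ->
       ((if `[< act s i >] then D i (ext s) else setT) `&` C i (p2 (nth 0%N s i))) y].
      apply/seteqP; split=> y Vy i si; have := Vy i si; case: asboolP => sA [Dy Cy]; split=> //.
      exact: Dy.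
    apply: base_bigcap => i; apply: (sb_I sb); last exact: sb_C sb _ _.
    by case: ifP => // _; exact: sb_T sb.
  - move=> s k x [[y Vy] Ax]; split; first by exists y; exact: VS Vy.
    move=> i si sA; have [sA' <- _] := actr _ k _ sA.
    by apply: Ax => //; rewrite size_rcons; exact: ltnW.
  - move=> s k; exists (p2 k) => y /(_ (size s)).
    by rewrite size_rcons => /(_ (ltnSn _))[_]; rewrite nth_rcons ltnn eqxx.
  - by move=> s x [].
move=> x y; rewrite ED; split.
- move=> [a aP]; have [b bP] := choice (fun n => sb_cover sb n y).
  exists (fun n => pickle (a n, b n)) => n; set g := fun n => _.
  have pg : p1 \o g = a by apply/funext => j; rewrite /p1 /g /= pickleK.
  have extE j m : (j < m)%N -> ext (mkseq g m) j = a j.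
    by move=> jm; rewrite /ext nth_mkseq// -pg.
  have Vy : V (mkseq g n) y.
    move=> i; rewrite size_mkseq => im; split.
      move=> /(_ a)[j|_ <-]; last by case: (aP i).
      by rewrite size_mkseq => jn; rewrite extE.
    by rewrite nth_mkseq// /p2 /g pickleK.
  split=> //; split; first by exists y.
  move=> i; rewrite size_mkseq => im /(_ a)[j|<- _]; last by case: (aP i).
  by rewrite size_mkseq => jn; rewrite extE.
- move=> [a aP]; exists (p1 \o a) => i.
  have [N /(_ N (leqnn _)) [iN sA <- <-]] := actg a i.
  have [[_ Ax] Vy] := aP N; split; first exact: Ax.
  by have [+ _] := Vy i iN; apply.
Qed.

Section branches.
Variables (T V : seq nat -> set X).
Hypothesis st : souslin_tree T V.

(** Completeness, applied to the closed sets [V (mkseq a n) `&` B] of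
    vanishing diameter. *)
Lemma tree_point_in a (B : set X) : F B ->
  (forall n, V (mkseq a n) `&` B !=set0) ->
  exists y, B y /\ forall n, V (mkseq a n) y.
Proof.
move=> FB VB.
have [||||y yP] := @sb_complete _ _ _ _ sb (fun n => V (mkseq a n) `&` B) _ _ _ _.
- by move=> n; apply: (sb_I sb) => //; exact: st_closed st _.
- by move=> n y [+ By]; rewrite mkseqS => /(st_V st).
- move=> n; have [i iP] := st_small st (mkseq a n) (a n).
  by exists i => y; rewrite mkseqS => -[/iP + _]; rewrite size_mkseq.
- exact: VB.
- exists y; split; first by case: (yP 0%N).
  by move=> n; case: (yP n).
Qed.

Lemma tree_point a x : (forall n, T (mkseq a n) x) ->
  exists y, forall n, V (mkseq a n) y.
Proof.
move=> aT; have [n|y [_ yP]] := @tree_point_in a setT (sb_T sb); last by exists y.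
by have [y Vy] := st_V0 st (aT n); exists y.
Qed.

Lemma tree_point_uniq a y y' :
  (forall n, V (mkseq a n) y) -> (forall n, V (mkseq a n) y') -> y = y'.
Proof.
move=> ya y'a; apply: contrapT => /(sb_sep sb)[n nP].
have [i iP] := st_small st (mkseq a n) (a n).
apply: (nP i); rewrite size_mkseq -mkseqS in iP.
by split; apply: iP.
Qed.

End branches.
End tree.

(** * Real-valued probabilities *)

Section real_probability.
Context (K : realType) (d : measure_display) (X : measurableType d).
Variable mu : probability X K.

Definition Pr (A : set X) : K := fine (mu A).

Lemma PrE A : measurable A -> mu A = (Pr A)%:E.
Proof. by move=> mA; rewrite /Pr fineK// fin_num_measure. Qed.

Lemma Pr_ge0 A : 0 <= Pr A.
Proof. exact: fine_ge0. Qed.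

Lemma PrT : Pr setT = 1.
Proof. by rewrite /Pr probability_setT. Qed.

Lemma Pr0 : Pr set0 = 0.
Proof. by rewrite /Pr measure0. Qed.

Lemma Pr_le A B : measurable A -> measurable B -> A `<=` B -> Pr A <= Pr B.
Proof.
by move=> mA mB AB; rewrite -lee_fin -!PrE//; apply: le_measure; rewrite ?inE.
Qed.

Lemma Pr_le1 A : measurable A -> Pr A <= 1.
Proof. by move=> mA; rewrite -PrT; apply: Pr_le. Qed.

Lemma PrID A B : measurable A -> measurable B ->
  Pr A = Pr (A `&` B) + Pr (A `\` B).
Proof.
move=> mA mB; apply: EFin_inj; rewrite EFinD -!PrE//.
- by rewrite addeC; exact: measureDI.
- exact: measurableD.
- exact: measurableI.
Qed.

Lemma PrU A B : measurable A -> measurable B -> A `&` B = set0 ->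
  Pr (A `|` B) = Pr A + Pr B.
Proof.
move=> mA mB AB; apply: EFin_inj; rewrite EFinD -!PrE//.
- exact: measureU.
- exact: measurableU.
Qed.

Lemma PrU_le A B : measurable A -> measurable B ->
  Pr (A `|` B) <= Pr A + Pr B.
Proof.
move=> mA mB; rewrite (_ : A `|` B = A `|` (B `\` A)); last first.
  by rewrite setUDr setDv setD0.
rewrite PrU//; last 2 first.
- exact: measurableD.
- by apply/seteqP; split=> // x [? []].
by rewrite lerD2l; apply: Pr_le => //; exact: measurableD.
Qed.

Lemma PrC A : measurable A -> Pr (~` A) = 1 - Pr A.
Proof.
move=> mA; rewrite -PrT (PrID measurableT mA) setTI setTD; ring.
Qed.

Lemma Pr_null A : measurable A -> Pr A = 0 -> mu.-negligible A.
Proof. by move=> mA A0; exists A; split=> //; rewrite PrE// A0. Qed.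

Lemma negligible_Pr A : measurable A -> mu.-negligible A -> Pr A = 0.
Proof. by move=> mA /(measure_negligible mA); rewrite /Pr => ->. Qed.

Lemma Pr_ae_le A B : measurable A -> measurable B ->
  mu.-negligible (A `\` B) -> Pr A <= Pr B.
Proof.
move=> mA mB /(negligible_Pr (measurableD mA mB)) AB.
rewrite (PrID mA mB) AB addr0; apply: Pr_le => //; exact: measurableI.
Qed.

Lemma negligible_union_seq (A : seq nat -> set X) :
  (forall s, mu.-negligible (A s)) -> mu.-negligible [set x | exists s, A s x].
Proof.
move=> nA; pose B k := if (unpickle k : option (seq nat)) is Some s then A s else set0.
have nB : mu.-negligible (\bigcup_k B k).
  apply: negligible_bigcup => k; rewrite /B; case: unpickle => // *.
  exact: negligible_set0.
apply: negligibleS nB => x [s As]; exists (pickle s) => //.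
by rewrite /B pickleK.
Qed.

Lemma Pr_bigcup_tail (A : nat -> set X) (e : K) : 0 < e ->
  (forall n, measurable (A n)) ->
  exists n, Pr (\bigcup_i A i `\` \big[setU/set0]_(i < n) A i) < e.
Proof.
move=> e0 mA.
have mU n : measurable (\big[setU/set0]_(i < n) A i) by apply: bigsetU_measurable.
have mB : measurable (\bigcup_i A i) by exact: bigcupT_measurable.
pose F n := \bigcup_i A i `\` \big[setU/set0]_(i < n) A i.
have mF n : measurable (F n) by exact: measurableD.
have F0 : \bigcap_n F n = set0.
  apply/seteqP; split=> // x Fx; have [[i _ Ai] _] := Fx 0%N I.
  have [_] := Fx i.+1 I; apply.
  by rewrite -bigcup_mkord; exists i => /=.
have : mu \o F @ \oo --> mu (\bigcap_n F n).
  apply: nonincreasing_cvg_mu => //.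
  - by rewrite -ge0_fin_numE// fin_num_measure.
  - by rewrite F0.
  - move=> m n mn; apply/subsetPset; apply: setDS.
    by rewrite -!bigcup_mkord => x [i im Ai]; exists i => //=; exact: leq_trans im mn.
rewrite F0 measure0 => /fine_cvgP[_] /cvgrPdist_lt /(_ _ e0)[n _ /(_ n (leqnn _))].
by rewrite /= sub0r normrN ger0_norm ?fine_ge0// => Fn; exists n.
Qed.

(** The union of a sequence of members whose measures tend to the supremum
    cannot be enlarged by a set of positive measure. *)
Lemma ess_max (M : set (set X)) : M !=set0 ->
  (forall A, M A -> measurable A) ->
  (forall A : nat -> set X, (forall n, M (A n)) -> M (\bigcup_n A n)) ->
  exists2 A, M A & forall B, M B -> mu.-negligible (B `\` A).
Proof.
move=> [A0 MA0] mM UM.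
pose S := [set Pr A | A in M].
have hS : has_sup S.
  split; first by exists (Pr A0), A0.
  by exists 1 => _ [A MA <-]; apply: Pr_le1; exact: mM.
have /choice[A AP] : forall n : nat, exists A, M A /\ sup S - n.+1%:R^-1 < Pr A.
  move=> n; have [|_ [A MA <-] ?] := @sup_adherent _ S n.+1%:R^-1 _ hS.
    by rewrite invr_gt0.
  by exists A.
have MU : M (\bigcup_n A n) by apply: UM => n; case: (AP n).
exists (\bigcup_n A n) => // B MB.
have mB := mM _ MB; have mU := mM _ MU.
have mBU := measurableD mB mU.
apply: Pr_null => //; apply/eqP; rewrite eq_le Pr_ge0 andbT leNgt; apply/negP => BU.
have [n nP] : exists n, n.+1%:R^-1 < Pr (B `\` \bigcup_n A n).
  exact: exists_small_inv.
have [MAn An] := AP n.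
have : Pr (A n) <= Pr (\bigcup_n A n).
  apply: Pr_le => //; first exact: mM.
  exact: bigcup_sup.
have : Pr (\bigcup_n A n `|` (B `\` \bigcup_n A n)) <= sup S.
  apply: sup_ubound; first by case: hS.
  exists (\bigcup_n A n `|` (B `\` \bigcup_n A n)) => //.
  rewrite setUDr setDv setD0.
  have -> : \bigcup_n A n `|` B = \bigcup_n (if n is n'.+1 then A n' else B).
    apply/seteqP; split=> [x [[k _ Ak]|Bx]|x [[|k] _ /= Ak]].
    - by exists k.+1.
    - by exists 0%N.
    - by right.
    - by left; exists k.
  by apply: UM => -[|k] //; case: (AP k).
rewrite PrU//; last by apply/seteqP; split=> // x [? []].
move: nP An; set q := n.+1%:R^-1; lra.
Qed.

(** The complement of an essentially largest measurable set that is disjoint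
    from [G]. *)
Lemma measurable_hull (G : set X) : exists H, [/\ measurable H, G `<=` H &
  forall B, measurable B -> G `<=` B -> mu.-negligible (H `\` B)].
Proof.
have [|||A [mA AG] AP] := @ess_max [set A | measurable A /\ A `&` G = set0].
- by exists set0; split=> //; rewrite set0I.
- by move=> A [].
- move=> A AP; split; first by apply: bigcupT_measurable => n; case: (AP n).
  by rewrite setI_bigcupl bigcup0// => n _; case: (AP n).
exists (~` A); split; first exact: measurableC.
  by move=> x Gx Ax; suff : (A `&` G) x by rewrite AG.
move=> B mB GB.
have -> : ~` A `\` B = ~` B `\` A by rewrite !setDE setIC.
apply: AP; split; first exact: measurableC.
by apply/seteqP; split=> // x [nBx /GB].
Qed.

End real_probability.

(** * Measurable selection along a tree *)

Section select.
Context (K : realType) (d : measure_display) (X : measurableType d).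
Variable mu : probability X K.
Context (F : set (set X)) (C : nat -> nat -> set X).
Hypothesis sb : souslin_base F C.

Section selection.
Variables (T V : seq nat -> set X).
Hypothesis st : souslin_tree F C T V.

Lemma take_mkseq (a : nat -> nat) m n : (m <= n)%N ->
  take m (mkseq a n) = mkseq a m.
Proof. by move=> mn; rewrite /mkseq -map_take take_iota (minn_idPl mn). Qed.

Lemma treeT_take s n : T s `<=` T (take n s).
Proof.
elim/last_ind: s => [|s k IH] //; have [ns|ns] := leqP n (size s).
  by rewrite -cats1 takel_cat// cats1 => x /(st_T st) /IH.
by rewrite take_oversize// size_rcons.
Qed.

Lemma treeV_take s n : V s `<=` V (take n s).
Proof.
elim/last_ind: s => [|s k IH] //; have [ns|ns] := leqP n (size s).
  by rewrite -cats1 takel_cat// cats1 => x /(st_V st) /IH.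
by rewrite take_oversize// size_rcons.
Qed.

Section leftmost.
Variable H : seq nat -> set X.
Hypothesis mH : forall s, measurable (H s).
Hypothesis HT : forall s, H s `<=` T s.

Let kmin s x : nat := if pselect (exists k, `[< H (rcons s k) x >]) is left e
  then ex_minn e else 0%N.

Let mkmin s k : measurable [set x | kmin s x = k].
Proof.
(* The value [0] is also the default one, taken when no [k] qualifies. *)
have -> : [set x | kmin s x = k] =
    (H (rcons s k) `\` \bigcup_(j in [set j | (j < k)%N]) H (rcons s j)) `|`
    (if k == 0%N then ~` \bigcup_j H (rcons s j) else set0).
  apply/seteqP; split=> x /=; rewrite /kmin; case: pselect => [e|ne].
  - case: ex_minnP => m /asboolP Hm mmin <-; left; split=> // -[j /= jm Hj].
    by have /mmin := asboolT Hj; rewrite leqNgt jm.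
  - move=> <-; right; rewrite eqxx => -[j _ Hj]; apply: ne.
    by exists j; apply/asboolP.
  - case: ex_minnP => m /asboolP Hm mmin [[Hk nHk]|]; last first.
      by case: eqP => // _ nH; exfalso; apply: nH; exists m.
    apply/eqP; rewrite eqn_leq mmin ?andbT; last exact/asboolP.
    by rewrite leqNgt; apply/negP => mk; apply: nHk; exists m.
  - by case=> [[Hk _]|]; [exfalso; apply: ne; exists k; apply/asboolP|case: eqP].
apply: measurableU.
  by apply: measurableD => //; apply: bigcup_measurable => j _.
by case: ifP => // _; apply: measurableC; exact: bigcupT_measurable.
Qed.

Fixpoint leftmost n s x : seq nat :=
  if n is n'.+1 then rcons (leftmost n' s x) (kmin (leftmost n' s x) x) else s.

Let size_leftmost n s x : size (leftmost n s x) = (size s + n)%N.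
Proof. by elim: n => [|n IH] /=; rewrite ?addn0// size_rcons IH addnS. Qed.

Let mleftmost n s u : measurable [set x | leftmost n s x = u].
Proof.
elim: n u => [|n IH] u /=.
  have [->|su] := eqVneq s u.
    by rewrite (_ : mkset _ = setT)//; apply/seteqP.
  rewrite (_ : mkset _ = set0)//; apply/seteqP; split=> // x /= E.
  by rewrite E eqxx in su.
elim/last_ind: u => [|u k _].
  rewrite (_ : mkset _ = set0)//; apply/seteqP; split=> // x /=.
  by case: leftmost.
rewrite (_ : mkset _ = [set x | leftmost n s x = u] `&` [set x | kmin u x = k]).
  by apply: measurableI.
apply/seteqP; split=> [x /= /eqP|x /= [-> ->]//].
by rewrite eqseq_rcons => /andP[/eqP -> /eqP ->].
Qed.

Let lbr s x j := nth 0%N (leftmost j.+1 s x) j.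

Let lbrE n s x : mkseq (lbr s x) (size s + n) = leftmost n s x.
Proof.
have step m n' j : (j < size s + m)%N ->
    nth 0%N (leftmost (m + n') s x) j = nth 0%N (leftmost m s x) j.
  move=> jm; elim: n' => [|n' IH]; first by rewrite addn0.
  by rewrite addnS /= nth_rcons size_leftmost addnA (leq_trans jm (leq_addr _ _)).
apply: (@eq_from_nth _ 0%N); first by rewrite size_mkseq size_leftmost.
move=> j; rewrite size_mkseq => jn; rewrite nth_mkseq// /lbr.
have [jn'|nj] := leqP j.+1 n.
  by rewrite -(subnKC jn') step//; lia.
by rewrite -(subnKC (ltnW nj)) step//.
Qed.

(** At each node the least [k] for which [x] remains in [H] is a measurable
    function of [x], and following it gives a branch that depends measurably
    on [x]. The point selected by this branch lies in a closed set [B] exactly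
    when all sets [V] along the branch meet [B], and this is a condition on
    countably many nodes. *)
Lemma leftmost_selection (N : set X) : measurable N ->
  (forall s x, ~ N x -> H s x -> exists k, H (rcons s k) x) ->
  exists f : seq nat -> X -> X, (forall s, measurable_fun setT (f s)) /\
   forall s x, ~ N x -> H s x -> exists a, [/\ mkseq a (size s) = s,
     forall n, (size s <= n)%N -> H (mkseq a n) x &
     forall n, V (mkseq a n) (f s x)].
Proof.
move=> mN NH.
have Hl s x n : ~ N x -> H s x -> H (leftmost n s x) x.
  move=> Nx Hs; elim: n => [//|n IH] /=; rewrite /kmin; case: pselect => [e|].
    by case: ex_minnP => m /asboolP.
  have [k Hk] := NH _ _ Nx IH; case; exists k; exact/asboolP.
have HlT s x n : ~ N x -> H s x -> T (mkseq (lbr s x) n) x.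
  move=> Nx Hs; have [ns|sn] := leqP n (size s).
    rewrite -(@take_mkseq _ n (size s))//; apply: treeT_take; apply: HT.
    by have := lbrE 0 s x; rewrite addn0 => ->.
  by rewrite -(subnKC (ltnW sn)) lbrE; apply: HT; exact: Hl.
pose f s x := if `[< H s x /\ ~ N x >] then
  xget x [set y | forall n, V (mkseq (lbr s x) n) y] else x.
have fP s x : ~ N x -> H s x -> forall n, V (mkseq (lbr s x) n) (f s x).
  move=> Nx Hs; rewrite /f asboolT//.
  have [y yP] := tree_point sb st (fun n => HlT s x n Nx Hs).
  exact: (@xgetI _ x [set y | forall n, V (mkseq (lbr s x) n) y] y yP).
exists f; split; last first.
  move=> s x Nx Hs; exists (lbr s x); split.
  - by have := lbrE 0 s x; rewrite addn0 => ->.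
  - by move=> n sn; rewrite -(subnKC sn) lbrE; exact: Hl.
  - exact: fP.
move=> s; apply: (measurability _ (sb_gen sb)) => _ [B FB <-].
rewrite setTI.
rewrite (_ : f s @^-1` B = ((H s `\` N) `&` \bigcap_n \bigcup_(u in [set u | V u `&` B !=set0])
   [set x | leftmost n s x = u]) `|` (B `&` ~` (H s `\` N))).
  apply: measurableU.
    apply: measurableI; first exact: measurableD.
    apply: bigcapT_measurable => n.
    pose up k : option (seq nat) := unpickle k.
    rewrite (_ : \bigcup_(_ in _) _ =
      \bigcup_(k in [set k | if up k is Some u then V u `&` B !=set0 else False])
       [set x | up k = Some (leftmost n s x)]).
      suff mo (o : option (seq nat)) : (if o is Some u then V u `&` B !=set0 else False) ->
          measurable [set x | o = Some (leftmost n s x)].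
        by apply: bigcup_measurable => k kP; exact: (mo (up k) kP).
      case: o => // u _.
      rewrite (_ : mkset _ = [set x | leftmost n s x = u]) //.
      by apply/seteqP; split=> x /= [->].
    apply/seteqP; split=> [x [u VB xu]|x [k]].
      by exists (pickle u); rewrite /mkset /up pickleK// xu.
    by move=> + xk; rewrite /mkset xk => Vu; exists (leftmost n s x).
  apply: measurableI; first exact: base_measurable sb _ FB.
  by apply: measurableC; exact: measurableD.
apply/seteqP; split=> x /=.
- move=> Bf; have [[Hs Nx]|nHs] := pselect (H s x /\ ~ N x); last first.
    right; split; last by [].
    by move: Bf; rewrite /f asboolF.
  left; split=> // n _; exists (leftmost n s x) => //.
  by exists (f s x); split=> //; rewrite -lbrE; exact: fP.
- move=> [[[Hs Nx] xB]|[Bx nHs]]; last by rewrite /f asboolF.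
  have [n|y [By yP]] := tree_point_in sb st (a := lbr s x) FB.
    have [u /= VB lu] := xB n I.
    have [y [Vy By]] := VB; exists y; split=> //.
    have [ns|sn] := leqP n (size s + n); last by lia.
    by rewrite -(take_mkseq _ ns) lbrE lu; exact: treeV_take.
  by rewrite (tree_point_uniq sb st (fP _ _ Nx Hs) yP).
Qed.

End leftmost.

(** The set [G s] of the [x] that have a branch through [s] is a projection,
    which need not be measurable; [H s] is its measurable hull, cut down to
    [T s]. Since [G s] is contained in the union of the sets [G (rcons s k)],
    the set [H s] is contained in the union of the hulls [H (rcons s k)] up to
    a null set. Outside the countable union [N] of these null sets, every node
    of [H] has a successor in [H], and leftmost branches exist. *)
Lemma tree_selection : exists (H : seq nat -> set X) (N : set X)
    (f : seq nat -> X -> X),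
  [/\ forall s, measurable (H s), forall s, H s `<=` T s,
      forall s x, (exists a, branch T s x a) -> H s x, measurable N &
      [/\ mu.-negligible N, forall s, measurable_fun setT (f s),
      forall s x, ~ N x -> H s x -> exists k, H (rcons s k) x &
      forall s x, ~ N x -> H s x -> exists a, [/\ mkseq a (size s) = s,
       forall n, (size s <= n)%N -> H (mkseq a n) x &
       forall n, V (mkseq a n) (f s x)]]].
Proof.
pose G s := [set x | exists a, branch T s x a].
have GT s : G s `<=` T s by move=> x [a [<- +]]; apply.
have /choice[H0 H0P] := fun s => measurable_hull mu (G s).
pose H s := H0 s `&` T s.
have mH s : measurable (H s).
  by apply: measurableI; [case: (H0P s)|exact: st_meas st _].
have GH s : G s `<=` H s.
  by move=> x Gx; split; [have [_ + _] := H0P s; exact|exact: GT].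
have GE s : G s `<=` \bigcup_k G (rcons s k).
  move=> x [a [as_ aT]]; exists (a (size s)) => //; exists a; split=> //.
  by rewrite size_rcons mkseqS as_.
pose N0 s := H s `\` \bigcup_k H (rcons s k).
have nN0 s : mu.-negligible (N0 s).
  have [_ _ HP] := H0P s.
  apply: (@negligibleS _ _ _ _ (H0 s `\` \bigcup_k H (rcons s k))).
    by move=> x [[]].
  apply: HP; first exact: bigcupT_measurable.
  by apply: subset_trans (GE s) _; apply: subset_bigcup => k _; exact: GH.
have [N [mN N0' sN]] := negligible_union_seq nN0.
have NH s x : ~ N x -> H s x -> exists k, H (rcons s k) x.
  move=> Nx Hs; apply: contrapT => nk; apply: Nx; apply: sN; exists s.
  by split=> // -[k _ Hk]; apply: nk; exists k.
have HT s : H s `<=` T s by move=> x [].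
have [f [mf fP]] := leftmost_selection mH HT mN NH.
by exists H, N, f; split=> //; split=> //; exists N; split.
Qed.

End selection.
End select.

(** * Countable sections are covered by measurable functions *)

Section lusin_novikov.
Context (K : realType) (d : measure_display) (X : measurableType d).
Variable mu : probability X K.
Context (F : set (set X)) (C : nat -> nat -> set X).
Hypothesis sb : souslin_base F C.

Definition ae_covered (f : nat -> X -> X) (E : set (X * X)) :=
  mu.-negligible [set x | exists y, E (x, y) /\ forall i, y <> f i x].

Section tree.
Variables (T V : seq nat -> set X).
Hypothesis st : souslin_tree F C T V.

Let cyl s D := [set xy | D xy.1 /\
  exists a, branch T s xy.1 a /\ forall n, V (mkseq a n) xy.2].

Let good s := [set D | measurable D /\ exists f : nat -> X -> X,
  (forall i, measurable_fun setT (f i)) /\ ae_covered f (cyl s D)].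

Let good0 s : good s set0.
Proof.
split=> //; exists (fun=> id); split; first by move=> i; exact: measurable_id.
by apply: negligibleS (negligible_set0 mu) => x [y [[]]].
Qed.

Let goodU s (D : nat -> set X) : (forall n, good s (D n)) ->
  good s (\bigcup_n D n).
Proof.
move=> gD; have /choice[f fP] := fun n => (gD n).2.
split; first by apply: bigcupT_measurable => n; case: (gD n).
exists (fun k => if (unpickle k : option (nat * nat)) is Some (n, i) then f n i else id).
split=> [k|].
  case: unpickle => [[n i]|]; last exact: measurable_id.
  by case: (fP n).
have : mu.-negligible (\bigcup_n [set x | exists y, cyl s (D n) (x, y) /\ forall i, y <> f n i x]).
  by apply: negligible_bigcup => n; case: (fP n).
apply: negligibleS => x [y [[/= [n _ Dn] aP] yf]].
exists n => //; exists y; split=> // i.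
by have := yf (pickle (n, i)); rewrite pickleK.
Qed.

(** Let [D s] be the essentially largest set over which the part of [E] below
    the node [s] is covered by measurable functions, and remove these sets
    from the tree. The sets [H] and the selections [f s] of the remaining tree
    are those of [tree_selection]. On [Q s] every node [t] of [H] below [s]
    has [f s x] in [V t], so that [f s] alone covers what the remaining tree
    has below [s], and the functions attached to the sets [D t] cover the
    removed parts; by maximality [Q s] lies in [D s] up to a null set, whereas
    [H] avoids [D s], so [Q s] is null. Over a point [x] outside all null
    sets, a node in [H] can thus be extended, inside [H], so as to exclude any
    prescribed [y]. If the root were in [H], excluding one after the other the
    points of the countable section of [E] at [x] would produce a branch whose
    point belongs to that section but differs from all its points. Hence the
    root is not in [H] almost everywhere, and the functions attached to the
    sets [D s] cover [E]. *)
Lemma tree_lusin_novikov (E : set (X * X)) :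
  (forall x y, E (x, y) <-> exists a, forall n, T (mkseq a n) x /\ V (mkseq a n) y) ->
  {ae mu, forall x, countable [set y | E (x, y)]} ->
  exists f, (forall i, measurable_fun setT (f i)) /\ ae_covered f E.
Proof.
move=> ET cE.
have /choice[D DP] : forall s, exists D, good s D /\
    forall B, good s B -> mu.-negligible (B `\` D).
  move=> s; have [|||D gD DP] := @ess_max _ _ _ mu (good s).
  - by exists set0.
  - by move=> ? [].
  - exact: goodU.
  - by exists D.
have mD s : measurable (D s) by case: (DP s) => -[].
have /choice[g gP] := fun s => (DP s).1.2.
pose bad s := [set x | exists y, cyl s (D s) (x, y) /\ forall i, y <> g s i x].
pose T' s := T s `\` \bigcup_(k in [set k | (k <= size s)%N]) D (take k s).
have st' : souslin_tree F C T' V.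
  split.
  - move=> s; apply: measurableD; first exact: st_meas st _.
    by apply: bigcup_measurable => k _.
  - exact: st_closed st.
  - move=> s k x [Tx nx]; split; first exact: st_T st _ _ _ Tx.
    move=> [j /= js Dj]; apply: nx; exists j => /=; first by rewrite size_rcons ltnW.
    by rewrite -cats1 takel_cat.
  - exact: st_V st.
  - exact: st_small st.
  - by move=> s x [/(st_V0 st)].
have [H [N [f [mH HT' GH mN [nN mf NH fP]]]]] := tree_selection mu sb st'.
pose Q s := H s `\` \bigcup_(t in setT)
  (if take (size s) t == s then H t `&` ~` (f s @^-1` V t) else set0).
have mVf s t : measurable (f s @^-1` V t).
  by rewrite -[_ @^-1` _]setTI; apply: mf => //; exact: base_measurable sb _ (st_closed st _).
have mQ s : measurable (Q s).
  apply: measurableD => //; apply: countable_bigcupT_measurable => [|t]; first exact: countableP.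
  by case: ifP => // _; apply: measurableI => //; exact: measurableC.
have branchT' s x a : branch T s x a -> (forall n, ~ D (mkseq a n) x) ->
    branch T' s x a.
  move=> [as_ aT] aD; split=> // n; split=> // -[k /= ]; rewrite size_mkseq => kn.
  by rewrite take_mkseq//; exact: aD.
have branchH s x a n : branch T' s x a -> H (mkseq a n) x.
  by move=> [as_ aT]; apply: GH; exists a; split=> //; rewrite size_mkseq.
have nbad : mu.-negligible [set x | exists s, bad s x].
  by apply: negligible_union_seq => s; case: (gP s).
pose fam h k := if (unpickle k : option (option (seq nat * nat))) is Some o then
  (if o is Some p then g p.1 p.2 else h) else h.
have mfam h : measurable_fun setT h -> forall k, measurable_fun setT (fam h k).
  move=> mh k; rewrite /fam; case: unpickle => [[[s i]|]|]//=.
  by case: (gP s).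
have gQ s : good s (Q s).
  split=> //; exists (fam (f s)); split; first exact: mfam.
  apply: negligibleS (negligibleU nN nbad) => x [y [[/= [Hs nQ] [a [ab Va]]] yf]].
  apply: contrapT => /not_orP[Nx nb].
  have aD n : ~ D (mkseq a n) x.
    move=> Dn; apply: nb; exists (mkseq a n); exists y; split.
      by split=> //; exists a; split=> //; split; [rewrite size_mkseq|case: ab].
    by move=> i; have := yf (pickle (Some (mkseq a n, i))); rewrite /fam pickleK.
  have ab' := branchT' _ _ _ ab aD.
  have [n nV] : exists n, ~ V (mkseq a n) (f s x).
    apply/existsNP => VV; apply: (yf (pickle (None : option (seq nat * nat)))).
    by rewrite /fam pickleK; apply: (tree_point_uniq sb st (a := a)).
  apply: nQ; exists (mkseq a (maxn n (size s))) => //.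
  rewrite take_mkseq ?leq_maxr//; have [-> _] := ab; rewrite eqxx; split.
    exact: branchH ab'.
  move=> /= Vf; apply: nV; rewrite -(@take_mkseq _ n (maxn n (size s))) ?leq_maxl//.
  exact: (treeV_take st) Vf.
have nQ s : mu.-negligible (Q s).
  apply: negligibleS ((DP s).2 _ (gQ s)) => x Qx; split=> // Dx.
  have [/HT'[_ +] _] := Qx; apply; exists (size s) => //=.
  by rewrite take_size.
have nQQ : mu.-negligible [set x | exists s, Q s x] by exact: negligible_union_seq.
have H0 : forall x, ~ N x -> ~ (exists s, Q s x) -> countable [set y | E (x, y)] ->
    ~ H [::] x.
  move=> x Nx nQx /countable_injP[e einj] Hx.
  (* If [y] is the selected point, [x] not being in [Q s] provides the
     extension; otherwise the selected branch leaves [y] at some node. *)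
  have split1 s y : H s x -> exists t,
      [/\ take (size s) t = s, (size s < size t)%N, H t x & ~ V t y].
    move=> Hs.
    have [t [st_ Ht Vt]] : exists t, [/\ take (size s) t = s, H t x & ~ V t y].
      have [yf|yf] := pselect (y = f s x).
        apply: contrapT => nt; apply: nQx; exists s; split=> // -[t _].
        case: eqP => // ts [Ht nV]; apply: nt; exists t; split=> //.
        by rewrite yf.
      have [a [as_ aH aV]] := fP s x Nx Hs.
      have [n nV] : exists n, ~ V (mkseq a n) y.
        apply/existsNP => VV; apply: yf.
        by apply: (tree_point_uniq sb st (a := a)).
      exists (mkseq a (maxn n (size s))); split.
      - by rewrite take_mkseq ?leq_maxr.
      - by apply: aH; rewrite leq_maxr.
      - move=> /= Vf; apply: nV; rewrite -(@take_mkseq _ n (maxn n (size s))) ?leq_maxl//.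
        exact: (treeV_take st) Vf.
    have [k Hk] := NH _ _ Nx Ht.
    exists (rcons t k); split=> //; last by move=> /(st_V st).
      rewrite -cats1 takel_cat// -{1}st_ size_take.
      by case: ltnP => // /ltnW.
    by rewrite size_rcons ltnS -{1}st_ size_take; case: ltnP => // /ltnW.
  have /choice[G1 GP] : forall sk : seq nat * nat, exists t, H sk.1 x ->
      [/\ take (size sk.1) t = sk.1, (size sk.1 < size t)%N, H t x &
        forall y, E (x, y) -> e y = sk.2 -> ~ V t y].
    move=> [s k] /=; have [Hs|] := pselect (H s x); last by exists [::].
    have [[y [Ey ey]]|ny] := pselect (exists y, E (x, y) /\ e y = k).
      have [t [t1 t2 t3 t4]] := split1 s y Hs; exists t => _; split=> // y' Ey' ey'.
      by rewrite (einj y' y) ?inE// ey ey'.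
    have [t [t1 t2 t3 _]] := split1 s x Hs; exists t => _; split=> // y Ey ey.
    by exfalso; apply: ny; exists y.
  pose fix sg n := if n is n'.+1 then G1 (sg n', n') else [::].
  have Hsg n : H (sg n) x.
    by elim: n => [|n IH] //=; have [] := GP (sg n, n) IH.
  have tsg n : take (size (sg n)) (sg n.+1) = sg n.
    by have [] := GP (sg n, n) (Hsg n).
  have ssg n : (size (sg n) < size (sg n.+1))%N.
    by have [] := GP (sg n, n) (Hsg n).
  have nsg n : (n <= size (sg n))%N.
    by elim: n => // n IH; exact: leq_ltn_trans IH (ssg n).
  have szmono n m : (size (sg n) <= size (sg (n + m)))%N.
    elim: m => [|m IH]; first by rewrite addn0.
    by rewrite addnS; apply: leq_trans IH (ltnW (ssg _)).
  have step n m j : (j < size (sg n))%N -> nth 0%N (sg (n + m)%N) j = nth 0%N (sg n) j.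
    move=> jn; elim: m => [|m IH]; first by rewrite addn0.
    rewrite -IH addnS -[in RHS](tsg (n + m)%N) nth_take//.
    exact: leq_trans jn (szmono n m).
  pose a j := nth 0%N (sg j.+1) j.
  have aE n : mkseq a (size (sg n)) = sg n.
    apply: (@eq_from_nth _ 0%N); first by rewrite size_mkseq.
    move=> j; rewrite size_mkseq => jn; rewrite nth_mkseq// /a.
    have [nj|jn'] := leqP n j.+1.
      by rewrite -(subnKC nj) step.
    by rewrite -(subnKC (ltnW jn')) step.
  have aT n : T (mkseq a n) x.
    rewrite -(take_mkseq _ (nsg n)) aE; apply: (treeT_take st).
    by have [] := HT' _ _ (Hsg n).
  have [y Vy] := tree_point sb st aT.
  have Ey : E (x, y) by apply/ET; exists a.
  have [_ _ _] := GP (sg (e y), e y) (Hsg _).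
  by move=> /(_ y Ey erefl); apply; have := Vy (size (sg (e y).+1)); rewrite aE.
exists (fam id); split; first by apply: mfam; exact: measurable_id.
apply: negligibleS (negligibleU (negligibleU nN nQQ) (negligibleU nbad cE)).
move=> x [y [/ET[a aP] yf]]; apply: contrapT => /not_orP[/not_orP[Nx Qx] /not_orP[nb /contrapT cx]].
apply: (H0 x) => //; rewrite -[[::]]/(mkseq a 0).
apply: (branchH [::]); apply: branchT'; first by split=> // n; case: (aP n).
move=> n Dn; apply: nb; exists (mkseq a n); exists y; split.
  split=> //; exists a; split=> [|m]; last by case: (aP m).
  by split=> [|m]; [rewrite size_mkseq|case: (aP m)].
by move=> i; have := yf (pickle (Some (mkseq a n, i))); rewrite /fam pickleK.
Qed.

End tree.

Theorem lusin_novikov (E : set (X * X)) : measurable E ->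
  {ae mu, forall x, countable [set y | E (x, y)]} ->
  exists f, (forall i, measurable_fun setT (f i)) /\ ae_covered f E.
Proof.
move=> /(souslin_tree_of sb)[T [V [st ET]]].
exact: tree_lusin_novikov st _ ET.
Qed.

End lusin_novikov.

(** * Full groups and the Feldman-Moore theorem *)

Section integral_extra.
Local Open Scope ereal_scope.
Context (K : realType) (d : measure_display) (X : measurableType d).
Variable mu : {measure set X -> \bar K}.

(** The integral of a nonnegative function is a supremum over the simple
    functions below it, whence monotonicity without measurability. The number
    of points of a section is integrated in this way. *)
Lemma ge0_le_integral_lower (f1 f2 : X -> \bar K) :
  (forall x, 0 <= f1 x) -> (forall x, f1 x <= f2 x) ->
  \int[mu]_x f1 x <= \int[mu]_x f2 x.
Proof.
move=> f10 f12; rewrite !ge0_integralTE//; last first.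
  by move=> x; exact: le_trans (f10 x) (f12 x).
apply: le_ereal_sup => _ [h hf <-]; exists h => // x.
exact: le_trans (hf x) (f12 x).
Qed.

Lemma counting1 (a : X) : counting [set a] = 1 :> \bar K.
Proof.
rewrite /counting asboolT ?fset_set1; last exact: finite_set1.
by rewrite finmap.cardfs1.
Qed.

Lemma counting0 : counting (set0 : set X) = 0 :> \bar K.
Proof. by rewrite /counting asboolT ?fset_set0 ?finmap.cardfs0. Qed.

Lemma counting_ge0 (A : set X) : 0 <= counting A :> \bar K.
Proof. by rewrite /counting; case: ifP => // _; rewrite lee_fin. Qed.

Lemma counting_ge1 (A : set X) : A !=set0 -> 1 <= counting A :> \bar K.
Proof.
move=> [a Aa]; rewrite /counting; case: ifPn => [/asboolP fA|_]; last exact: leey.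
rewrite lee_fin ler1n finmap.cardfs_gt0; apply/finmap.fset0Pn; exists a.
by rewrite in_fset_set// inE.
Qed.

End integral_extra.

Lemma measurable_fun_piecewise d d' (T : measurableType d)
    (T' : measurableType d') (A : set T) (f g : T -> T') :
  measurable A -> measurable_fun setT f -> measurable_fun setT g ->
  measurable_fun setT (fun x => if x \in A then f x else g x).
Proof.
move=> mA mf mg; apply: measurable_fun_ifT => //.
apply: (measurable_fun_bool true).
rewrite setTI (_ : _ @^-1` _ = A) //.
by apply/seteqP; split=> x; [exact: set_mem|exact: mem_set].
Qed.

Section relation.
Context (K : realType) (d : measure_display) (X : measurableType d).
Variable mu : probability X K.
Context (F : set (set X)) (C : nat -> nat -> set X).
Hypothesis sb : souslin_base F C.
Implicit Types (R : set (X * X)).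

Lemma measurable_eq_fun d' (T : measurableType d') (f g : T -> X) :
  measurable_fun setT f -> measurable_fun setT g ->
  measurable [set x | f x = g x].
Proof.
move=> mf mg.
rewrite (_ : mkset _ = \bigcap_n \bigcup_i (f @^-1` C n i `&` g @^-1` C n i)).
  apply: bigcapT_measurable => n; apply: bigcupT_measurable => i.
  have mC := base_measurable sb (sb_C sb n i).
  by apply: measurableI; rewrite -[_ @^-1` _]setTI; [exact: mf|exact: mg].
apply/seteqP; split=> [x /= fg n _|x fg].
  by have [i Ci] := sb_cover sb n (f x); exists i => //; split=> //=; rewrite -fg.
apply: contrapT => /(sb_sep sb)[n nP].
by have [i _ [Cf Cg]] := fg n I; exact: (nP i).
Qed.

(** A section of [N] that contains a point [f x] has at least one element. *)
Lemma rel_measure_eq0_graph (N : set (X * X)) (f : X -> X) :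
  measurable N -> rel_measure mu N = 0%E -> measurable_fun setT f ->
  mu.-negligible [set x | N (x, f x)].
Proof.
move=> mN N0 mf; set B := [set x | _].
have mB : measurable B.
  rewrite -[B]setTI; apply: (_ : measurable_fun setT (fun x => (x, f x))) => //.
  exact: measurable_fun_pair.
apply: Pr_null => //; apply/eqP; rewrite eq_le Pr_ge0 andbT -lee_fin -PrE//.
rewrite -[leRHS]/(0%E) -N0 -[B in leLHS]setIT -(integral_indic mu measurableT)//.
apply: ge0_le_integral_lower => x; first by rewrite lee_fin.
rewrite indicE; have [xB|_] := boolP (x \in B); last exact: counting_ge0.
apply: counting_ge1; exists (f x); rewrite /xsection /= inE.
by rewrite inE in xB.
Qed.

Let graph_on (f : X -> X) (B : set X) : set (X * X) :=
  [set xy | B xy.1 /\ f xy.1 = xy.2].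

Let mgraph f B : measurable_fun setT f -> measurable B ->
  measurable (graph_on f B).
Proof.
move=> mf mB; apply: measurableI.
  by rewrite -[X in measurable X]setTI; exact: measurable_fst.
apply: measurable_eq_fun; last exact: measurable_snd.
by apply: measurableT_comp => //; exact: measurable_fst.
Qed.

Let rel_measure_graph f B : measurable B -> rel_measure mu (graph_on f B) = mu B.
Proof.
move=> mB; rewrite /rel_measure -[B in RHS]setIT -(integral_indic mu measurableT)//.
apply: eq_integral => x _; rewrite indicE.
have [xB|xB] := boolP (x \in B).
  rewrite (_ : xsection _ x = [set f x]) ?counting1//.
  rewrite inE in xB.
  by apply/seteqP; split=> [y|_ ->]; rewrite /xsection/= inE /graph_on//= => -[].
rewrite (_ : xsection _ x = set0) ?counting0//.
apply/seteqP; split=> // y; rewrite /xsection/= inE /graph_on /= => -[Bx].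
by move: xB; rewrite notin_setE.
Qed.

(** Exchanging the two coordinates of the graph of [f] above [f @^-1` N] gives
    a set that lies above the null set [N], and its measure is that of the
    graph. *)
Lemma graph_nonsingular R f (N : set X) : measure_preserving_rel mu R ->
  measurable_fun setT f -> (forall x, R (x, f x)) ->
  mu.-negligible N -> mu.-negligible (f @^-1` N).
Proof.
move=> pR mf fR [N' [mN N0 NN']].
apply: (@negligibleS _ _ _ _ (f @^-1` N')); first exact: preimage_subset.
have mB : measurable (f @^-1` N') by rewrite -[_ @^-1` _]setTI; exact: mf.
apply/negligibleP => //.
suff : rel_measure mu (graph_on f (f @^-1` N')) = 0%E by rewrite rel_measure_graph.
rewrite -pR; last 2 first.
- exact: mgraph.
- by move=> [x y] [/= _ <-].
apply/eqP; rewrite eq_le; apply/andP; split; last first.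
  by apply: integral_ge0 => x _; exact: counting_ge0.
apply: (@le_trans _ _ (\int[mu]_x ((cst +oo%E) \_ N') x)%E).
  apply: ge0_le_integral_lower => y; first exact: counting_ge0.
  rewrite patchE; case: ifPn => [_|yN]; first by rewrite leey.
  rewrite (_ : xsection _ y = set0) ?counting0//.
  apply/seteqP; split=> // x; rewrite /xsection/= inE /graph_on /= => -[+ fx].
  by rewrite fx => N'y; move: yN; rewrite notin_setE.
by rewrite -integral_mkcond integral_cst//= N0 mule0.
Qed.

(** Exchanging the coordinates of the graph of [g] above [B] gives the graph
    of the inverse of [g] above [g @` B], so that [mu B <= mu (g @` B)] for
    all [B]. The complement of [A] gives the reverse inequality. As [g] stays
    in the classes of [R] only almost everywhere, [B] is first cut down to a
    set where it does. *)
Lemma full_group_image R g (A : set X) : measurable R ->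
  measure_preserving_rel mu R ->
  full_group mu R g -> measurable A -> mu (g @` A) = mu A.
Proof.
move=> mR pR [bg mg img aeg] mA.
have [g' gK g'K] := bg.
have le B : measurable B -> Pr mu B <= Pr mu (g @` B).
  move=> mB; pose B' := B `&` [set x | R (x, g x)].
  have mB' : measurable B'.
    apply: measurableI => //; rewrite -[X in measurable X]setTI.
    apply: (_ : measurable_fun setT (fun x => (x, g x))) => //.
    exact: measurable_fun_pair.
  apply: (@le_trans _ _ (Pr mu B')).
    apply: Pr_ae_le => //; apply: negligibleS aeg => x [Bx nB'] Rx.
    by apply: nB'.
  apply: (@le_trans _ _ (Pr mu (g @` B'))); last first.
    by apply: Pr_le; [exact: img|exact: img|apply: image_subset => x []].
  rewrite -lee_fin -!PrE//; last exact: img.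
  rewrite -(rel_measure_graph g mB') -pR; last 2 first.
  - exact: mgraph.
  - by move=> [x y] [/= [_ Rx] <-].
  rewrite /rel_measure -[in leRHS](setIT (g @` B')) -(integral_indic mu measurableT); last exact: img.
  apply: ge0_le_integral_lower => y; first exact: counting_ge0.
  rewrite indicE; have [yg|yg] := boolP (y \in g @` B').
    move: yg; rewrite inE => -[x B'x <-].
    rewrite (_ : xsection _ _ = [set x]) ?counting1//.
    apply/seteqP; split=> [z|_ ->]; rewrite /xsection/= inE /graph_on//=.
    by move=> [_ /(can_inj gK)].
  rewrite (_ : xsection _ _ = set0) ?counting0//.
  apply/seteqP; split=> // z; rewrite /xsection/= inE /graph_on /= => -[B'z gz].
  by move: yg; rewrite notin_setE; apply; exists z.
have gC : g @` (~` A) = ~` (g @` A).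
  apply/seteqP; split=> [_ [x nAx <-] [x' Ax' /(can_inj gK) xx']|y nAy].
    by rewrite xx' in Ax'.
  exists (g' y); last by rewrite g'K.
  by move=> Ay; apply: nAy; exists (g' y); rewrite ?g'K.
rewrite !PrE//; last exact: img.
congr EFin; apply/eqP; rewrite eq_le le// andbT.
have := le _ (measurableC mA); rewrite gC !PrC//; last exact: img.
lra.
Qed.

Lemma full_group_preimage R g (A : set X) : measurable R ->
  measure_preserving_rel mu R ->
  full_group mu R g -> measurable A -> mu (g @^-1` A) = mu A.
Proof.
move=> mR pR fg mA; have [[g' gK g'K] mg _ _] := fg.
have mgA : measurable (g @^-1` A) by rewrite -[_ @^-1` _]setTI; exact: mg.
rewrite -(full_group_image mR pR fg mgA); congr (mu _).
by apply/seteqP; split=> [_ [x Ax <-]//|y Ay]; exists (g' y); rewrite /= g'K.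
Qed.

(** The points [x] and [g x] are equivalent for every [x], so that no null set
    has to be removed when such maps are composed. *)
Definition inv_in R (g : X -> X) :=
  [/\ measurable_fun setT g, forall x, g (g x) = x & forall x, R (x, g x)].

Lemma inv_in_preimage R g : inv_in R g -> forall A, g @` A = g @^-1` A.
Proof.
move=> [_ gg _] A; apply/seteqP; split=> [_ [x Ax <-]|x Ax]; first by rewrite /= gg.
by exists (g x).
Qed.

Lemma inv_in_full_group R g : inv_in R g -> full_group mu R g.
Proof.
move=> gR; have [mg gg Rg] := gR; split => //.
- by exists g.
- by move=> A mA; rewrite (inv_in_preimage gR) -[_ @^-1` _]setTI; exact: mg.
- exact: aeW.
Qed.

(** Let the functions [f i] cover the classes. On [B (i, j, n, l)] the
    function [f i] has [f j] as an inverse and moves every point out of the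
    set [C n l] that contains it, so the image of [B] is disjoint from [B],
    and exchanging [B] with its image is an involution. If [y] differs from
    [x] and is equivalent to it, then [y = f i x] for some [i], [x = f j y]
    for some [j] by [graph_nonsingular], and some [C n l] separates the two
    points. *)
Theorem feldman_moore R : dmp_equivalence_rel mu R ->
  exists g : nat -> X -> X, (forall j, inv_in R (g j)) /\
    {ae mu, forall x, forall y, R (x, y) -> exists j, y = g j x}.
Proof.
move=> [[mR Rr Rs Rt] cR pR].
have [f0 [mf0 cf0]] := lusin_novikov sb mR cR.
have mpair (h : X -> X) : measurable_fun setT h -> measurable [set x | R (x, h x)].
  move=> mh; rewrite -[X in measurable X]setTI.
  apply: (_ : measurable_fun setT (fun x => (x, h x))) => //.
  exact: measurable_fun_pair.
pose f i x := if x \in [set x | R (x, f0 i x)] then f0 i x else x.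
have mf i : measurable_fun setT (f i).
  by apply: measurable_fun_piecewise => //; exact: mpair.
have fR i x : R (x, f i x).
  by rewrite /f; case: ifPn => // ; rewrite inE.
have cf : {ae mu, forall x, forall y, R (x, y) -> exists i, y = f i x}.
  apply: negligibleS cf0 => x /= nx; apply: contrapT => nex; apply: nx => y Rxy.
  apply: contrapT => ny; apply: nex; exists y; split=> // i yf.
  apply: ny; exists i; rewrite /f ifT// inE /=.
  by rewrite -yf.
pose T4 := (nat * nat * nat * nat)%type.
pose B (q : T4) := let: (i, j, n, l) := q in
  [set x | f j (f i x) = x] `&` (C n l `&` ~` (f i @^-1` C n l)).
have mB q : measurable (B q).
  case: q => [[[i j] n] l]; apply: measurableI.
    apply: measurable_eq_fun; last exact: measurable_id.
    exact: measurableT_comp.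
  have mC := base_measurable sb (sb_C sb n l).
  apply: measurableI => //; apply: measurableC.
  by rewrite -[_ @^-1` _]setTI; exact: mf.
pose g (q : T4) := let: (i, j, n, l) := q in fun x =>
  if x \in B (i, j, n, l) then f i x else
  if x \in [set y | B (i, j, n, l) (f j y) /\ f i (f j y) = y] then f j x else x.
have gI q : inv_in R (g q).
  case: q => [[[i j] n] l]; split.
  - apply: measurable_fun_piecewise; [exact: (mB (i, j, n, l))|exact: mf|].
    apply: measurable_fun_piecewise => //.
    apply: (@measurableI _ _ (f j @^-1` B (i, j, n, l))).
      rewrite -[X in measurable X]setTI; exact: (mf j measurableT _ (mB (i, j, n, l))).
    apply: measurable_eq_fun; last exact: measurable_id.
    exact: measurableT_comp.
  - move=> x; rewrite /g; set B1 := B _; set B2 := [set y | _].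
    have [xB|nxB] := boolP (x \in B1).
      have [fjix [_ nC]] := set_mem xB.
      rewrite ifF; last by apply: memNset => -[_ [Cf _]]; exact: nC Cf.
      rewrite ifT; first exact: fjix.
      by apply: mem_set; rewrite /B2 /= fjix; split=> //; exact: set_mem xB.
    have [xB2|nx2] := boolP (x \in B2); last by rewrite (negbTE nxB) (negbTE nx2).
    have [xB fx] := set_mem xB2.
    by rewrite ifT; [exact: fx|exact: mem_set xB].
  - move=> x; rewrite /g; case: ifPn => _; first exact: fR.
    by case: ifPn => _; [exact: fR|exact: Rr].
pose G k := if k is k'.+1 then
  (if (unpickle k' : option T4) is Some q then g q else id) else id.
have idI : inv_in R id by split=> //; exact: measurable_id.
exists G; split.
  by case=> [|k] //; rewrite /G; case: unpickle => [q|].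
have := negligibleU cf (negligible_bigcup
  (fun i => graph_nonsingular pR (mf i) (fR i) cf)).
apply: negligibleS => x /= nx; apply: contrapT => /not_orP[/contrapT cx nU].
apply: nx => y Rxy; have [yx|yx] := pselect (x = y); first by exists 0%N.
have [i yE] := cx y Rxy; rewrite {}yE in yx *.
have [j xj] : exists j, x = f j (f i x).
  apply: contrapT => nj; apply: nU; exists i => //= all.
  by apply: nj; apply: all; apply: Rs.
have [n nl] := sb_sep sb yx; have [l xl] := sb_cover sb n x.
exists (pickle ((i, j, n, l) : T4)).+1; rewrite /G pickleK /g ifT// inE.
by split=> //; split=> //= fl; exact: (nl l).
Qed.

End relation.

(** * Expectations and ultralimits *)

Section expectation.
Context (K : realType) (d : measure_display) (X : measurableType d).
Variable mu : probability X K.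
Implicit Types (f h : X -> K) (A B : set X).

(** The bounded measurable functions are stable under the algebraic
    operations, and [Ex] is linear on them without any integrability
    condition. *)
Definition bmf f := measurable_fun setT f /\ exists M, forall x, `|f x| <= M.

Definition Ex f : K := \int[mu]_x f x.

Lemma bmf_integrable f : bmf f -> mu.-integrable setT (EFin \o f).
Proof.
move=> [mf [M fM]]; apply: measurable_bounded_integrable => //.
  by rewrite -ge0_fin_numE// fin_num_measure.
exists M; split; first exact: num_real.
by move=> y My x _ /=; exact: le_trans (fM x) (ltW My).
Qed.

Lemma bmf_cst c : bmf (fun=> c).
Proof. by split; [exact: measurable_cst|exists `|c|]. Qed.

Lemma bmfD f h : bmf f -> bmf h -> bmf (fun x => f x + h x).
Proof.
move=> [mf [M fM]] [mh [N hN]]; split; first exact: measurable_funD.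
by exists (M + N) => x; apply: le_trans (ler_normD _ _) _; exact: lerD.
Qed.

Lemma bmfN f : bmf f -> bmf (fun x => - f x).
Proof.
move=> [mf [M fM]]; split; first exact: measurableT_comp.
by exists M => x; rewrite normrN.
Qed.

Lemma bmfB f h : bmf f -> bmf h -> bmf (fun x => f x - h x).
Proof. by move=> bf bh; apply: bmfD => //; exact: bmfN. Qed.

Lemma bmfM f h : bmf f -> bmf h -> bmf (fun x => f x * h x).
Proof.
move=> [mf [M fM]] [mh [N hN]]; split; first exact: measurable_funM.
by exists (M * N) => x; rewrite normrM; apply: ler_pM.
Qed.

Lemma bmf_norm f : bmf f -> bmf (fun x => `|f x|).
Proof.
move=> [mf [M fM]]; split; first exact: measurableT_comp.
by exists M => x; rewrite normr_id.
Qed.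

Lemma bmf_indic A : measurable A -> bmf (\1_A : X -> K).
Proof.
move=> mA; split; first exact: measurable_indic.
by exists 1 => x; rewrite indicE; case: (_ \in _); rewrite ?normr0 ?normr1.
Qed.

Lemma bmf_sum (I : Type) (s : seq I) (P : pred I) (f : I -> X -> K) :
  (forall i, bmf (f i)) -> bmf (fun x => \sum_(i <- s | P i) f i x).
Proof.
move=> bf; elim: s => [|i s IH].
  by under eq_fun do rewrite big_nil; exact: bmf_cst.
under eq_fun do rewrite big_cons.
by case: (P i) => //; exact: bmfD.
Qed.

Lemma bmf_comp f (g : X -> X) : bmf f -> measurable_fun setT g -> bmf (f \o g).
Proof.
move=> [mf [M fM]] mg; split; first exact: measurableT_comp.
by exists M => x /=.
Qed.

Lemma bmf_nat (k : X -> nat) m : (forall l, measurable [set x | k x = l]) ->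
  (forall x, (k x <= m)%N) -> bmf (fun x => (k x)%:R).
Proof.
move=> mk km.
rewrite (_ : (fun x => _) = fun x => \sum_(l < m.+1) (l%:R * \1_[set x | k x = l] x)).
  apply: bmf_sum => l; apply: bmfM; first exact: bmf_cst.
  exact: bmf_indic.
apply/funext => x; have kx : (k x < m.+1)%N by rewrite ltnS.
rewrite (bigD1 (Ordinal kx))//= big1 ?addr0.
  by rewrite indicE mem_set// mulr1.
move=> l lk; rewrite indicE memNset ?mulr0//= => kl.
by move/eqP: lk; apply; apply: val_inj.
Qed.

Lemma ExD f h : bmf f -> bmf h -> Ex (fun x => f x + h x) = Ex f + Ex h.
Proof. by move=> bf bh; rewrite /Ex RintegralD//; exact: bmf_integrable. Qed.

Lemma ExB f h : bmf f -> bmf h -> Ex (fun x => f x - h x) = Ex f - Ex h.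
Proof. by move=> bf bh; rewrite /Ex RintegralB//; exact: bmf_integrable. Qed.

Lemma ExZ c f : bmf f -> Ex (fun x => c * f x) = c * Ex f.
Proof. by move=> bf; rewrite /Ex RintegralZl//; exact: bmf_integrable. Qed.

Lemma Ex_cst c : Ex (fun=> c) = c.
Proof. by rewrite /Ex Rintegral_cst// -[fine _]/(Pr mu setT) PrT mulr1. Qed.

Lemma Ex_le f h : bmf f -> bmf h -> (forall x, f x <= h x) -> Ex f <= Ex h.
Proof. by move=> bf bh fh; apply: le_Rintegral => //; exact: bmf_integrable. Qed.

Lemma Ex_indic A : measurable A -> Ex \1_A = Pr mu A.
Proof. by move=> mA; rewrite /Ex /Rintegral/Pr integral_indic// setIT. Qed.

Lemma Ex_sum (I : Type) (s : seq I) (P : pred I) (f : I -> X -> K) :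
  (forall i, bmf (f i)) ->
  Ex (fun x => \sum_(i <- s | P i) f i x) = \sum_(i <- s | P i) Ex (f i).
Proof.
move=> bf; elim: s => [|i s IH].
  by under eq_fun do rewrite big_nil; rewrite Ex_cst big_nil.
under eq_fun do rewrite big_cons.
rewrite big_cons; case: (P i) => //; rewrite ExD ?IH//.
exact: bmf_sum.
Qed.

Lemma Ex_comp f g : bmf f -> measurable_fun setT g ->
  (forall A, measurable A -> mu (g @^-1` A) = mu A) -> Ex (f \o g) = Ex f.
Proof.
move=> bf mg gA; rewrite /Ex /Rintegral; congr fine.
have E : (\int[pushforward mu g]_y (EFin \o f) y = \int[mu]_y (EFin \o f) y)%E.
  by apply: eq_measure_integral => A mA _; exact: gA.
rewrite -[RHS]E integral_pushforward//.
- by case: bf => mf _; exact/measurable_EFinP.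
- by apply: bmf_integrable; exact: bmf_comp.
Qed.

Lemma Ex_ae_le f h : bmf f -> bmf h -> {ae mu, forall x, f x <= h x} ->
  Ex f <= Ex h.
Proof.
move=> bf bh [N [mN N0 fhN]].
pose f' x := f x * \1_(~` N) x; pose h' x := h x * \1_(~` N) x.
have bI : bmf (\1_(~` N) : X -> K) by apply: bmf_indic; exact: measurableC.
have E u : bmf u -> Ex u = Ex (fun x => u x * \1_(~` N) x).
  move=> bu; rewrite /Ex /Rintegral; congr fine; apply: ae_eq_integral => //.
  - by case: bu => mu' _; exact/measurable_EFinP.
  - by case: (bmfM bu bI) => mu' _; exact/measurable_EFinP.
  - exists N; split=> // x /= /not_implyP[_ nE]; apply: contrapT => Nx; apply: nE.
    by rewrite indicE mem_set// mulr1.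
rewrite (E f)// (E h)//; apply: Ex_le; [exact: bmfM|exact: bmfM|].
move=> x; rewrite indicE; have [xN|xN] := boolP (x \in ~` N); last by rewrite !mulr0.
rewrite !mulr1; apply: contrapT => nfh; move: xN; rewrite inE; apply.
exact: fhN.
Qed.

End expectation.

Section ultralimits.
Context (K : realType).
Implicit Types (u v : nat -> K).

Lemma ultrafilter_oo : exists U : set_system nat, UltraFilter U /\ \oo `<=` U.
Proof. exact: ultraFilterLemma. Qed.

Lemma cvg_sumr (G : set_system nat) {FG : Filter G} (I : Type) (s : seq I) (P : pred I)
  (u : I -> nat -> K) (l : I -> K) : (forall i, u i @ G --> l i) ->
  (fun n => \sum_(i <- s | P i) u i n) @ G --> \sum_(i <- s | P i) l i.
Proof. by move=> ul; apply: cvg_big => // x; exact: add_continuous. Qed.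

Variable U : set_system nat.
Hypothesis UU : UltraFilter U.
Hypothesis ooU : \oo `<=` U.

Definition ulim u : K := lim (u @ U).

(** A segment is compact. *)
Lemma ulimP u M : (forall n, `|u n| <= M) -> u @ U --> ulim u.
Proof.
move=> uM; suff : cvg (u @ U) by [].
have UF : UltraFilter (u @ U).
  split=> [|G FG sUG].
    exact: fmap_proper_filter.
  apply/seteqP; split; last exact: sUG.
  move=> A GA; apply: contrapT => nA.
  have : U (~` (u @^-1` A)).
    by have [//|] := in_ultra_setVsetC (u @^-1` A) UU.
  move=> /(sUG (~` A)) GnA.
  have : G (A `&` ~` A) by exact: filterI.
  by rewrite setICr; exact: filter_not_empty.
have := @segment_compact K (- M) M; rewrite compact_ultra.
move=> /(_ (u @ U) UF); case.
  apply: (@filterS _ U _ setT); last exact: filterT.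
  by move=> n _ /=; rewrite in_itv/= -ler_norml.
by move=> l [_ ul]; apply/cvg_ex; exists l.
Qed.

Lemma ulim_unique u l : u @ U --> l -> ulim u = l.
Proof. by move=> ul; apply/cvg_lim. Qed.

Lemma cvg_oo_ultra (T : topologicalType) (u : nat -> T) (l : T) : u @ \oo --> l -> u @ U --> l.
Proof. by move=> ul A /ul; apply: ooU. Qed.

Lemma ultra_le u v a b : u @ U --> a -> v @ U --> b ->
  (forall n, u n <= v n) -> a <= b.
Proof.
move=> ua vb uv; apply: ler_cvg_to ua vb _; exact: nearW.
Qed.

Lemma ultra_near u a e : 0 < e -> u @ U --> a -> \forall n \near U, `|u n - a| < e.
Proof. by move=> e0 /cvgrPdist_lt/(_ e e0); apply: filterS => n; rewrite distrC. Qed.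

End ultralimits.

Lemma not_cvg0_subseq (K : realType) (u : nat -> K) : ~ (u @ \oo --> 0) ->
  exists e : K, 0 < e /\ exists phi : nat -> nat,
    (forall n, (n <= phi n)%N) /\ forall n, e <= `|u (phi n)|.
Proof.
move=> nu; have [e [e0 eP]] : exists e : K, 0 < e /\
    forall n, exists m, (n <= m)%N /\ e <= `|u m|.
  apply: contrapT => ne; apply: nu; apply/cvgrPdist_lt => e e0.
  apply: contrapT => nn; apply: ne; exists e; split=> // n.
  apply: contrapT => nm; apply: nn; exists n => // m /= nm'.
  rewrite sub0r normrN ltNge; apply/negP => em; apply: nm.
  by exists m.
have [phi phiP] := choice eP; exists e; split=> //; exists phi.
by split=> n; case: (phiP n).
Qed.

Lemma cvg_subseq_ge (K : realType) (u : nat -> K) (l : K) (phi : nat -> nat) :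
  (forall n, (n <= phi n)%N) -> u @ \oo --> l -> (u \o phi) @ \oo --> l.
Proof.
move=> phin ul; apply: cvg_comp ul => A [n _ nA].
by exists n => // m /= nm; apply: nA => /=; exact: leq_trans nm (phin m).
Qed.

(** * Mixing of almost invariant sequences *)

Section density.
Context (K : realType) (d : measure_display) (X : measurableType d).
Variable mu : probability X K.
Variable nu : set X -> K.
Hypothesis nu_ge0 : forall A, measurable A -> 0 <= nu A.
Hypothesis nu_le : forall A, measurable A -> nu A <= Pr mu A.
Hypothesis nuU : forall A B, measurable A -> measurable B -> A `&` B = set0 ->
  nu (A `|` B) = nu A + nu B.

Let nu_null A : measurable A -> Pr mu A = 0 -> nu A = 0.
Proof. by move=> mA A0; apply/eqP; rewrite eq_le nu_ge0// andbT -A0 nu_le. Qed.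

(** An additive set function between [0] and [mu] inherits countable
    additivity from [mu], so that it is a charge and has a density. *)
Definition dominated_charge (A : set X) : \bar K := (nu A)%:E.

Let charge0 : dominated_charge set0 = 0%E.
Proof. by rewrite /dominated_charge nu_null// Pr0. Qed.

Let charge_fin A : measurable A -> dominated_charge A \is a fin_num.
Proof. by []. Qed.

Let charge_sigma_add : semi_sigma_additive dominated_charge.
Proof.
move=> F mF tF mUF.
have mUn n : measurable (\big[setU/set0]_(i < n) F i) by apply: bigsetU_measurable.
have fin_add n : \sum_(i < n) nu (F i) = nu (\big[setU/set0]_(i < n) F i).
  elim: n => [|n IH]; first by rewrite !big_ord0 nu_null// Pr0.
  rewrite !big_ord_recr/= IH nuU//; first exact: mUn.
  rewrite -bigcup_mkord; apply/seteqP; split=> // x [[i /= ilt Fi] Fn].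
  have /trivIsetP/(_ i n I I) := tF.
  rewrite neq_ltn ilt => /(_ isT) FF; suff : set0 x by [].
  by rewrite -FF.
suff : (fun n => \sum_(0 <= i < n) nu (F i)) @ \oo --> nu (\bigcup_n F n).
  move=> cvgn; rewrite /dominated_charge.
  rewrite (_ : (fun n => _) = EFin \o (fun n => \sum_(0 <= i < n) nu (F i))).
    by apply: cvg_EFin; [exact: nearW|exact: cvgn].
  by apply/funext => n /=; rewrite sumEFin.
apply/cvgrPdist_lt => e e0.
have [n0 n0e] := @Pr_bigcup_tail _ _ _ mu F e e0 mF.
exists n0 => // n /= n0n; rewrite big_mkord fin_add.
have -> : nu (\bigcup_i F i) = nu (\big[setU/set0]_(i < n) F i) +
    nu (\bigcup_i F i `\` \big[setU/set0]_(i < n) F i).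
  rewrite -nuU//; last 2 first.
  - exact: measurableD.
  - by apply/seteqP; split=> // x [? []].
  congr nu; apply/seteqP; split=> x.
    by move=> Fx; have [|] := pselect ((\big[setU/set0]_(i < n) F i) x); [left|right].
  by case=> [|[]//]; rewrite -bigcup_mkord => -[i _ Fi]; exists i.
rewrite addrAC subrr add0r ger0_norm; last by apply: nu_ge0; exact: measurableD.
apply: le_lt_trans n0e; apply: (le_trans (nu_le _)); first exact: measurableD.
apply: Pr_le; [exact: measurableD|exact: measurableD|].
apply: setDS; rewrite -!bigcup_mkord => x [i /= ilt Fi].
by exists i => //=; exact: leq_trans ilt n0n.
Qed.

HB.instance Definition _ := isCharge.Build _ _ _ dominated_charge
  charge0 charge_fin charge_sigma_add.

(** [L] is the set where the density of [nu] is greater than [c]. *)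
Lemma density_level_set (c : K) : exists L, [/\ measurable L,
  forall B, measurable B -> B `<=` L -> nu B <= c * Pr mu B -> Pr mu B = 0 &
  forall B, measurable B -> B `<=` ~` L -> nu B <= c * Pr mu B].
Proof.
have dom : dominated_charge `<< mu.
  apply/null_content_dominatesP => A mA A0.
  by rewrite /dominated_charge nu_null// /Pr A0.
pose f := Radon_Nikodym dominated_charge mu.
have ff x : f x \is a fin_num by exact: Radon_Nikodym_fin_num.
have intf : mu.-integrable setT f by exact: Radon_Nikodym_integrable.
have fE A : measurable A -> (nu A)%:E = (\int[mu]_(x in A) f x)%E.
  by move=> mA; rewrite -Radon_Nikodym_integral.
have mf : measurable_fun setT f by exact: measurable_int intf.
have intfA A : measurable A -> mu.-integrable A f.
  by move=> mA; exact: integrableS intf.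
have intcA A : measurable A -> mu.-integrable A (cst c%:E).
  move=> mA; apply: (integrableS measurableT) => //.
  exact: (bmf_integrable mu (bmf_cst X c)).
have intc A : measurable A -> (\int[mu]_(x in A) (cst c%:E) x = (c * Pr mu A)%:E)%E.
  by move=> mA; rewrite integral_cst// EFinM -PrE.
exists [set x | (c%:E < f x)%E]; split.
- by rewrite -[X in measurable X]setTI; exact: emeasurable_fun_o_infty.
- move=> B mB BL nuB.
  have int0 : (\int[mu]_(x in B) `|f x - c%:E| = 0)%E.
    apply/eqP; rewrite eq_le integral_ge0 ?andbT; last by move=> *; exact: abse_ge0.
    under eq_integral => x xB.
      rewrite gee0_abs; last by rewrite sube_ge0// ltW//; apply: BL; rewrite inE in xB.
      over.
    rewrite integralB//; [|exact: intfA|exact: intcA].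
    by rewrite -fE// intc// -EFinB lee_fin subr_le0.
  have /ae_eq_integral_abs-/(_ _)[] := int0.
  - exact: mB.
  - by apply: emeasurable_funB; [exact: measurable_funTS|exact: measurable_cst].
  move=> N [mN N0 NB]; apply: negligible_Pr => //; exists N; split=> //.
  apply: subset_trans NB => x Bx /= /(_ Bx) E.
  by have := BL _ Bx => /=; rewrite -sube_gt0 E ltxx.
- move=> B mB BL; rewrite -lee_fin fE// -intc//.
  apply: le_integral; [exact: mB|exact: intfA|exact: intcA|].
  move=> x; rewrite inE => /BL /= /negP; rewrite -leNgt; exact.
Qed.

End density.

Section mixing.
Context (K : realType) (d : measure_display) (X : measurableType d).
Variable mu : probability X K.
Context (F : set (set X)) (C0 : nat -> nat -> set X).
Hypothesis sb : souslin_base F C0.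
Variable S : set (X * X).
Hypothesis mS : measurable S.
Hypothesis pS : measure_preserving_rel mu S.
Hypothesis eS : ergodic mu S.

Definition almost_invariant (A : nat -> set X) :=
  (forall n, measurable (A n)) /\
  forall g, full_group mu S g ->
    (fun n => Pr mu ((g @` A n) `+` A n)) @ \oo --> 0.

Lemma almost_invariant_subseq A phi : (forall n, (n <= phi n)%N) ->
  almost_invariant A -> almost_invariant (A \o phi).
Proof.
move=> phin [mA iA]; split=> [n|g gS]; first exact: mA.
exact: (cvg_subseq_ge phin (iA g gS)).
Qed.

Lemma measurableY A B : measurable A -> measurable B -> measurable (A `+` B : set X).
Proof. by move=> mA mB; rewrite setY_def; apply: measurableU; exact: measurableD. Qed.

Lemma Pr_symdiff_sub A B C : measurable A -> measurable B -> measurable C ->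
  Pr mu (A `&` C) <= Pr mu (B `&` C) + Pr mu (A `+` B).
Proof.
move=> mA mB mC; apply: (@le_trans _ _ (Pr mu ((B `&` C) `|` (A `+` B)))); last first.
  by apply: PrU_le; [exact: measurableI|exact: measurableY].
apply: Pr_le; [exact: measurableI| |].
  by apply: measurableU; [exact: measurableI|exact: measurableY].
move=> x [Ax Cx]; have [Bx|Bx] := pselect (B x); first by left.
by right; rewrite setY_def; left.
Qed.

(** Otherwise a subsequence stays away from [0], and along an ultrafilter
    [mu (A n `&` C)] tends to [nu C], where [nu] is additive, below [mu] and
    invariant under the full group of [S]. The set [L] where the density of
    [nu] exceeds its mean value [nu setT] is then invariant, hence of measure
    [0] or [1]. A function cannot exceed its mean almost everywhere, so [L] is
    null; a function that almost nowhere exceeds its mean equals it almost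
    everywhere. This gives [nu B = nu setT * mu B], a contradiction. *)
Theorem mixing A : almost_invariant A -> forall B, measurable B ->
  (fun n => Pr mu (A n `&` B) - Pr mu (A n) * Pr mu B) @ \oo --> 0.
Proof.
move=> iA B mB; apply: contrapT => /not_cvg0_subseq[e [e0 [phi [phin eP]]]].
have {}eP n : e <= `|Pr mu ((A \o phi) n `&` B) - Pr mu ((A \o phi) n) * Pr mu B|.
  exact: eP.
have {iA} := almost_invariant_subseq phin iA; move: (A \o phi) eP => {}A eP [mA iA].
have [U [UU ooU]] := ultrafilter_oo.
pose nu C := ulim U (fun n => Pr mu (A n `&` C)).
have mAC C n : measurable C -> measurable (A n `&` C) by exact: measurableI.
have nuP C : measurable C -> (fun n => Pr mu (A n `&` C)) @ U --> nu C.
  move=> mC; apply: (ulimP UU (M := 1)) => n.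
  by rewrite ger0_norm ?Pr_ge0// Pr_le1//; exact: mAC.
have nu_ge0 C : measurable C -> 0 <= nu C.
  move=> mC; apply: (ultra_le UU (cvg_cst 0) (nuP _ mC)) => n; exact: Pr_ge0.
have nu_le C : measurable C -> nu C <= Pr mu C.
  move=> mC; apply: (ultra_le UU (nuP _ mC) (cvg_cst (Pr mu C))) => n.
  by apply: Pr_le => //; exact: mAC.
have nuU C D : measurable C -> measurable D -> C `&` D = set0 ->
    nu (C `|` D) = nu C + nu D.
  move=> mC mD CD.
  apply: (ulim_unique UU).
  rewrite (_ : (fun n => _) = (fun n => Pr mu (A n `&` C) + Pr mu (A n `&` D))).
    by apply: cvgD; exact: nuP.
  apply/funext => n; rewrite setIUr PrU//; try exact: mAC.
  by rewrite setIACA CD setI0.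
have nu_inv g C : full_group mu S g -> measurable C -> nu (g @` C) = nu C.
  move=> gS mC; have [bg mg img _] := gS.
  have E n : `|Pr mu (A n `&` g @` C) - Pr mu (A n `&` C)| <=
      Pr mu (g @` A n `+` A n).
    have -> : Pr mu (A n `&` C) = Pr mu (g @` A n `&` g @` C).
      rewrite /Pr -(full_group_image sb mS pS gS (mAC _ n mC)); congr (fine (mu _)).
      have [g' gK g'K] := bg.
      apply/seteqP; split=> [_ [x [Ax Cx] <-]|_ [[x Ax <-] [x' Cx' /(can_inj gK) xx]]].
        by split; exists x.
      by rewrite xx in Cx'; exists x.
    have h1 := @Pr_symdiff_sub (A n) (g @` A n) (g @` C) (mA n) (img _ (mA n)) (img _ mC).
    have h2 := @Pr_symdiff_sub (g @` A n) (A n) (g @` C) (img _ (mA n)) (mA n) (img _ mC).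
    rewrite (setYC (A n)) in h1.
    by rewrite ler_norml; apply/andP; split; lra.
  have c1 : (fun n => Pr mu (A n `&` g @` C) - Pr mu (A n `&` C)) @ U -->
      nu (g @` C) - nu C by apply: cvgB; apply: nuP => //; exact: img.
  apply/eqP; rewrite -subr_eq0 -(ulim_unique UU c1); apply/eqP.
  apply: (ulim_unique UU); apply/norm_cvg0P.
  apply: (squeeze_cvgr _ (cvg_cst 0) (cvg_oo_ultra ooU (iA _ gS))).
  by apply: nearW => n /=; rewrite normr_ge0/= E.
have [L [mL L1 L2]] := @density_level_set _ _ _ mu nu nu_ge0 nu_le nuU (nu setT).
have Linv g : full_group mu S g -> mu (g @` L `+` L) = 0%E.
  move=> gS; have [bg mg img _] := gS.
  have [g' gK g'K] := bg.
  have PD D : measurable D -> D `<=` L -> g @` D `<=` ~` L -> Pr mu D = 0.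
    move=> mD DL gDL; apply: L1 => //.
    rewrite -(nu_inv g D gS mD) /Pr -(full_group_image sb mS pS gS mD).
    by apply: L2 => //; exact: img.
  have h1 : Pr mu (L `\` g @^-1` L) = 0.
    apply: PD; last by move=> _ [x [_ nx] <-].
    - by apply: measurableD => //; rewrite -[_ @^-1` _]setTI; exact: mg.
    - by move=> x [].
  have ginv D : measurable D -> Pr mu (g @` D) = Pr mu D.
    by move=> mD; rewrite /Pr (full_group_image sb mS pS gS mD).
  have mgL := img _ mL.
  have h2 : Pr mu (g @` L `\` L) = 0.
    have mD : measurable (L `\` g @^-1` L).
      by apply: measurableD => //; rewrite -[_ @^-1` _]setTI; exact: mg.
    rewrite -h1 -(ginv _ mD); congr Pr.
    apply/seteqP; split=> [_ [[x Lx <-] nx]|_ [x [Lx nx] <-]]; first by exists x.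
    by split => //; exists x.
  have h3 : Pr mu (L `\` g @` L) = 0.
    have := PrID mu mL mgL; rewrite -[in LHS](ginv _ mL) (PrID mu mgL mL) h2 addr0.
    by rewrite setIC => /esym/eqP; rewrite -subr_eq0 addrAC subrr add0r => /eqP.
  rewrite PrE; last by exact: measurableY.
  congr EFin; apply/eqP; rewrite eq_le Pr_ge0 andbT setY_def.
  apply: (le_trans (PrU_le _ _ _)); [exact: measurableD|exact: measurableD|].
  by rewrite h2 h3 addr0.
have [L0|L1'] := eS mL Linv; last first.
  (* The density would exceed its mean almost everywhere. *)
  have LC0 : Pr mu (~` L) = 0 by rewrite PrC// /Pr L1' subrr.
  have nuL : nu setT = nu L.
    rewrite -(setUv L) nuU ?setICr//; last exact: measurableC.
    have -> : nu (~` L) = 0; last by rewrite addr0.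
    apply/eqP; rewrite eq_le nu_ge0 ?andbT -?LC0 ?nu_le//; exact: measurableC.
  have : Pr mu L = 0.
    by apply: L1 => //; rewrite -nuL /Pr L1' mulr1.
  by rewrite /Pr L1' => /eqP; rewrite /= oner_eq0.
have nuB C : measurable C -> nu C <= nu setT * Pr mu C.
  move=> mC.
  have -> : nu C = nu (C `&` ~` L) + nu (C `&` L).
    rewrite -nuU; first by rewrite -setIUr setUC setUv setIT.
    - by apply: measurableI => //; exact: measurableC.
    - exact: measurableI.
    - by rewrite setIACA setICl setI0.
  have -> : nu (C `&` L) = 0.
    have mCL := measurableI _ _ mC mL.
    apply/eqP; rewrite eq_le nu_ge0// andbT (le_trans (nu_le _ mCL))//.
    have -> : 0 = Pr mu L by rewrite /Pr L0.
    by apply: Pr_le.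
  rewrite addr0; apply: (le_trans (L2 _ _ _)).
  - by apply: measurableI => //; exact: measurableC.
  - by move=> x [].
  apply: ler_wpM2l; first exact: nu_ge0.
  by apply: Pr_le => //; apply: measurableI => //; exact: measurableC.
have nuE : nu B = nu setT * Pr mu B.
  apply/eqP; rewrite eq_le nuB//=.
  have := nuB _ (measurableC mB); rewrite PrC// mulrBr mulr1.
  have : nu setT = nu B + nu (~` B).
    by rewrite -nuU ?setUv ?setICr//; exact: measurableC.
  lra.
have c1 : (fun n => Pr mu (A n `&` B) - Pr mu (A n) * Pr mu B) @ U --> (0 : K).
  have -> : 0 = nu B - nu setT * Pr mu B by rewrite nuE subrr.
  apply: cvgB; first exact: nuP.
  apply: cvgMl; have := nuP _ measurableT.
  by under eq_fun do rewrite setIT.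
have [n /=] := filter_ex (ultra_near UU e0 c1).
by rewrite subr0 ltNge eP.
Qed.

End mixing.

(** * Almost invariant sequences of small measure *)

Section small_sets.
Context (K : realType) (d : measure_display) (X : measurableType d).
Variable mu : probability X K.
Context (F : set (set X)) (C0 : nat -> nat -> set X).
Hypothesis sb : souslin_base F C0.
Variable S : set (X * X).
Hypothesis mS : measurable S.
Hypothesis pS : measure_preserving_rel mu S.

Lemma strongly_ergodicP : strongly_ergodic mu S <->
  forall A, almost_invariant mu S A ->
    (fun n => Pr mu (A n) * (1 - Pr mu (A n))) @ \oo --> 0.
Proof.
have E (A : nat -> set X) : (forall n, measurable (A n)) ->
    (fun n => mu (A n) * (1 - mu (A n)))%E =
    EFin \o (fun n => Pr mu (A n) * (1 - Pr mu (A n))).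
  by move=> mA; apply/funext => n /=; rewrite PrE// -EFinB -EFinM.
have E' (A : nat -> set X) g : (forall n, measurable (A n)) -> full_group mu S g ->
    (fun n => mu (g @` A n `+` A n)) =
    EFin \o (fun n => Pr mu (g @` A n `+` A n)).
  move=> mA [_ _ img _]; apply/funext => n /=; rewrite PrE//.
  by apply: measurableY => //; exact: img.
split=> SS A.
- move=> [mA iA].
  have : (fun n => mu (A n) * (1 - mu (A n)))%E @ \oo --> 0%E.
    apply: SS => // g gS; rewrite E'//.
    by apply: cvg_EFin; [exact: nearW|exact: iA].
  by rewrite E// => /fine_cvgP[_].
- move=> mA iA; rewrite E//; apply: cvg_EFin; first exact: nearW.
  by apply: SS; split=> // g gS; have := iA g gS; rewrite E'// => /fine_cvgP[_].
Qed.

Hypothesis eS : ergodic mu S.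

Lemma almost_invariantI A B : almost_invariant mu S A -> almost_invariant mu S B ->
  almost_invariant mu S (fun n => A n `&` B n).
Proof.
move=> [mA iA] [mB iB]; split=> [n|g gS]; first exact: measurableI.
have [bg mg img _] := gS.
have c : (fun n => Pr mu (g @` A n `+` A n) + Pr mu (g @` B n `+` B n)) @ \oo --> (0 : K).
  by rewrite -[0](addr0 (0 : K)); apply: cvgD; [exact: iA|exact: iB].
have mgA n := img _ (mA n).
have mgB n := img _ (mB n).
have mAY n := measurableY (mgA n) (mA n).
have mBY n := measurableY (mgB n) (mB n).
apply: (squeeze_cvgr _ (cvg_cst 0) c); apply: nearW => n /=; rewrite Pr_ge0/=.
apply: (@le_trans _ _ (Pr mu ((g @` A n `+` A n) `|` (g @` B n `+` B n)))); last first.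
  exact: PrU_le.
apply: Pr_le; [|exact: measurableU|].
  apply: measurableY; first by apply: img; exact: measurableI.
  exact: measurableI.
have [g' gK g'K] := bg.
move=> z [[[x [Ax Bx] xz] nAB]|[[Az Bz] nAB]].
- have [Az|Az] := pselect (A n z); last by left; left; split=> //; exists x.
  by right; left; split; [exists x|move=> Bz; apply: nAB].
- have [Ag|Ag] := pselect ((g @` A n) z); last by left; right.
  right; right; split=> // -[x' Bx' xz]; apply: nAB.
  have [x Ax xz'] := Ag; exists x => //; split=> //.
  by rewrite (can_inj gK (etrans xz' (esym xz))).
Qed.

(** By mixing, [A m `&` A n] has a measure close to that of [A m] times that
    of [A n] if [m] is large compared with [n]: a bound [c] becomes nearly
    [c ^+ 2], which is less than [c * ((1 + c) / 2)] by the margin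
    [c * (1 - c) / 2]. *)
Lemma almost_invariant_shrink A (eta c : K) : almost_invariant mu S A -> 0 < eta -> c < 1 ->
  (forall n, eta <= Pr mu (A n) <= c) ->
  exists A', almost_invariant mu S A' /\ exists eta', 0 < eta' /\
    forall n, eta' <= Pr mu (A' n) <= c * ((1 + c) / 2).
Proof.
move=> iA eta0 c1 Ac; have [mA _] := iA.
have c0 : 0 < c by have /andP[h1 h2] := Ac 0%N; lra.
have etac : eta <= c by have /andP[h1 h2] := Ac 0%N; lra.
have e2 : 0 < eta * eta / 2 by rewrite divr_gt0// mulr_gt0.
have e3 : 0 < c * (1 - c) / 2 by rewrite divr_gt0// mulr_gt0// subr_gt0.
have /choice[phi phiP] : forall n, exists m, (n <= m)%N /\
    (`|Pr mu (A m `&` A n) - Pr mu (A m) * Pr mu (A n)| < eta * eta / 2 /\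
     `|Pr mu (A m `&` A n) - Pr mu (A m) * Pr mu (A n)| < c * (1 - c) / 2).
  move=> n; have /cvgrPdist_lt mix := mixing sb mS pS eS iA (mA n).
  have [n1 _ h1] := mix _ e2; have [n2 _ h2] := mix _ e3.
  exists (maxn n (maxn n1 n2)); split; first exact: leq_maxl.
  have := h1 (maxn n (maxn n1 n2)); have := h2 (maxn n (maxn n1 n2)).
  rewrite /= !leq_max !leqnn !orbT => /(_ isT) + /(_ isT).
  by rewrite !sub0r !normrN.
exists (fun n => (A \o phi) n `&` A n); split.
  apply: almost_invariantI => //; apply: almost_invariant_subseq => // n.
  by case: (phiP n).
exists (eta * eta / 2); split=> // n /=.
have [_ []] := phiP n.
have /andP[a1 a2] := Ac n; have /andP[b1 b2] := Ac (phi n).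
rewrite !ltr_norml => /andP[h1 _] /andP[_ h2].
have l1 : eta * eta <= Pr mu (A (phi n)) * Pr mu (A n) by apply: ler_pM => //; exact: ltW.
have l2 : Pr mu (A (phi n)) * Pr mu (A n) <= c * c by apply: ler_pM => //; exact: Pr_ge0.
by apply/andP; split; nra.
Qed.

(** Bounds [c] on the measures are at most [1 - e] at each step, so that every
    step of [almost_invariant_shrink] divides them by at least [1 / q], where
    [q = (1 + (1 - e)) / 2] is less than [1]. *)
Lemma exists_small_almost_invariant (e0 : K) : 0 < e0 -> ~ strongly_ergodic mu S ->
  exists A, almost_invariant mu S A /\ exists eta, 0 < eta /\
    forall n, eta <= Pr mu (A n) <= e0.
Proof.
move=> e00 /strongly_ergodicP nS.
have [A [iA nA]] : exists A, almost_invariant mu S A /\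
    ~ (fun n => Pr mu (A n) * (1 - Pr mu (A n))) @ \oo --> 0.
  by apply: contrapT => h; apply: nS => A iA; apply: contrapT => nA; apply: h; exists A.
have [e [e_gt0 [phi [phin eP]]]] := not_cvg0_subseq nA.
have iA' := almost_invariant_subseq phin iA.
have {}eP n : e <= Pr mu ((A \o phi) n) <= 1 - e.
  have p0 := Pr_ge0 mu ((A \o phi) n).
  have p1 : Pr mu ((A \o phi) n) <= 1 by apply: Pr_le1; case: iA'.
  have := eP n; rewrite -[A (phi n)]/((A \o phi) n).
  rewrite ger0_norm; last by rewrite mulr_ge0// subr_ge0.
  by move=> h; apply/andP; split; nra.
move: (A \o phi) iA' eP => {nA phin iA}A iA eP.
pose q := (1 + (1 - e)) / 2.
have e1 : 0 <= 1 - e by have /andP[h1 h2] := eP 0%N; lra.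
have q1 : q < 1 by rewrite /q; lra.
have q0 : 0 <= q by rewrite /q; lra.
have step k : exists A, almost_invariant mu S A /\ exists eta, 0 < eta /\
    forall n, eta <= Pr mu (A n) <= (1 - e) * q ^+ k.
  elim: k => [|k [B [iB [eta [eta0 etaP]]]]].
    by exists A; split=> //; exists e; split=> // n; rewrite expr0 mulr1.
  have qk1 : q ^+ k <= 1 by apply: exprn_ile1 => //; exact: ltW.
  have qk0 : 0 <= q ^+ k by exact: exprn_ge0.
  have c1 : (1 - e) * q ^+ k < 1 by nra.
  have [B' [iB' [eta' [eta'0 etaP']]]] := almost_invariant_shrink iB eta0 c1 etaP.
  exists B'; split=> //; exists eta'; split=> // n.
  have /andP[-> h] /= := etaP' n; apply: (le_trans h).
  rewrite exprSr [leRHS]mulrA; apply: ler_wpM2l; first by rewrite mulr_ge0.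
  by rewrite /q; nra.
have : (fun k => (1 - e) * q ^+ k) @ \oo --> 0.
  rewrite -[0](mulr0 (1 - e)); apply: cvgMr; apply: cvg_expr.
  by rewrite ger0_norm.
move=> /cvgrPdist_lt/(_ e0 e00)[k _ /(_ k (leqnn _))] /=.
rewrite sub0r normrN ger0_norm; last by rewrite mulr_ge0// exprn_ge0.
move=> ke; have [B [iB [eta [eta0 etaP]]]] := step k.
exists B; split=> //; exists eta; split=> // n.
by have /andP[-> h] := etaP n; exact: le_trans h (ltW ke).
Qed.

End small_sets.

(** * Nearly invariant unions of level sets *)

Section nat_valued.
Context (K : realType) (d : measure_display) (X : measurableType d).
Variable mu : probability X K.

Definition mnat (f : X -> nat) := forall l, measurable [set x | f x = l].

Lemma mnat_preimage f (P : set nat) : mnat f -> measurable (f @^-1` P).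
Proof.
move=> mf; rewrite (_ : f @^-1` P = \bigcup_(l in P) [set x | f x = l]).
  by apply: bigcup_measurable => l _; exact: mf.
by apply/seteqP; split=> [x Px|x [l Pl /= fl]]; [exists (f x)|rewrite /= fl].
Qed.

Lemma mnat2 (op : nat -> nat -> nat) f g : mnat f -> mnat g ->
  mnat (fun x => op (f x) (g x)).
Proof.
move=> mf mg l.
rewrite (_ : mkset _ = \bigcup_a ([set x | f x = a] `&` g @^-1` [set b | op a b = l])).
  apply: bigcupT_measurable => a; apply: measurableI => //; exact: mnat_preimage.
by apply/seteqP; split=> [x /= fg|x [a _ [/= <- //]]]; exists (f x).
Qed.

Lemma mnat_cst n : mnat (fun=> n).
Proof.
move=> l; have [->|nl] := eqVneq n l.
  by rewrite (_ : mkset _ = setT)//; exact/seteqP.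
rewrite (_ : mkset _ = set0)//; apply/seteqP; split=> // x /= E.
by rewrite E eqxx in nl.
Qed.

Lemma mnat_sum (I : Type) (s : seq I) (P : pred I) (f : I -> X -> nat) :
  (forall i, mnat (f i)) -> mnat (fun x => \sum_(i <- s | P i) f i x)%N.
Proof.
move=> mf; elim: s => [|i s IH].
  by under eq_fun do rewrite big_nil; exact: mnat_cst.
by under eq_fun do rewrite big_cons; case: (P i) => //; exact: mnat2.
Qed.

Lemma mnat_comp f (g : X -> X) : mnat f -> measurable_fun setT g -> mnat (f \o g).
Proof.
by move=> mf mg l; rewrite -[X in measurable X]setTI; exact: (mg measurableT _ (mf l)).
Qed.

Lemma mnat_mem (A : set X) : measurable A -> mnat (fun x => (x \in A) : nat).
Proof.
move=> mA [|[|l]].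
- rewrite (_ : mkset _ = ~` A); first exact: measurableC.
  apply/seteqP; split=> x /=; first by case: (boolP (x \in A)) => //; rewrite notin_setE.
  by move=> nA; rewrite memNset.
- rewrite (_ : mkset _ = A)//.
  apply/seteqP; split=> x /=; first by case: (boolP (x \in A)) => //; rewrite inE.
  by move=> Ax; rewrite mem_set.
- rewrite (_ : mkset _ = set0)//; apply/seteqP; split=> // x /=.
  by case: (_ \in _).
Qed.

Lemma mnat_bmf f m : mnat f -> (forall x, (f x <= m)%N) ->
  bmf (fun x => (f x)%:R : K).
Proof. by move=> mf fm; exact: bmf_nat mf fm. Qed.

Lemma sum_levels t m : (t <= m)%N -> (\sum_(l < m) (l < t) = t)%N.
Proof.
suff -> : (\sum_(l < m) (l < t) = minn m t)%N by move=> /minn_idPr.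
elim: m => [|m IH]; first by rewrite big_ord0 min0n.
by rewrite big_ord_recr/= IH; lia.
Qed.

Lemma Pr_bigU_le (A : nat -> set X) n : (forall i, measurable (A i)) ->
  Pr mu (\big[setU/set0]_(i < n) A i) <= \sum_(i < n) Pr mu (A i).
Proof.
move=> mA; elim: n => [|n IH]; first by rewrite !big_ord0 Pr0.
rewrite !big_ord_recr/=; apply: (le_trans (PrU_le _ _ _)) => //.
  by apply: bigsetU_measurable.
by rewrite lerD2r.
Qed.

(** A natural number [t <= m] is the number of [l < m] below it. *)
Lemma Ex_levels f m (B : set X) : mnat f -> (forall x, (f x <= m)%N) ->
  measurable B ->
  \sum_(l < m) Pr mu (B `&` [set x | (l < f x)%N]) =
  Ex mu (fun x => \1_B x * (f x)%:R).
Proof.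
move=> mf fm mB.
have mlev (l : nat) : measurable (B `&` [set x | (l < f x)%N]).
  by apply: measurableI => //; exact: (mnat_preimage [set i | (l < i)%N] mf).
under eq_bigr do rewrite -Ex_indic//.
rewrite -Ex_sum; last by move=> l; exact: bmf_indic.
congr Ex; apply/funext => x.
rewrite -(sum_levels (fm x)) natr_sum mulr_sumr; apply: eq_bigr => l _.
rewrite !indicE in_setI; case: (x \in B); rewrite ?mul0r//= mul1r.
by have [fl|fl] := boolP (l < f x)%N; [rewrite mem_set|rewrite memNset//=; exact/negP].
Qed.

(** The number of [l < m] that lie below exactly one of two natural numbers is
    their distance. *)
Lemma Ex_levels_dist f f' m : mnat f -> mnat f' ->
  (forall x, (f x <= m)%N) -> (forall x, (f' x <= m)%N) ->
  \sum_(l < m) Pr mu ([set x | (l < f x)%N] `+` [set x | (l < f' x)%N]) =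
  Ex mu (fun x => `|(f x)%:R - (f' x)%:R|).
Proof.
move=> mf mf' fm fm'.
have ml (h : X -> nat) : mnat h -> forall l : nat, measurable [set x | (l < h x)%N].
  by move=> mh l; exact: (mnat_preimage [set i | (l < i)%N] mh).
under eq_bigr => l _.
  rewrite -Ex_indic; last by apply: measurableY; exact: ml.
  over.
rewrite -Ex_sum; last by move=> l; apply: bmf_indic; apply: measurableY; exact: ml.
congr Ex; apply/funext => x.
have E (a b : nat) : (a <= b)%N -> (b <= m)%N ->
    (\sum_(l < m) ((l < b) && (a <= l)) = b - a)%N.
  move=> ab bm; have am := leq_trans ab bm.
  apply: (@addIn a); rewrite subnK// -{2}(sum_levels am) -[RHS](sum_levels bm) -big_split/=.
  by apply: eq_bigr => l _; case: ltnP => lb; case: leqP => al //=; exfalso; lia.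
have indE (l : nat) : \1_([set x | (l < f x)%N] `+` [set x | (l < f' x)%N]) x =
   (((l < f x) && (f' x <= l)) || ((l < f' x) && (f x <= l)))%N%:R :> K.
  rewrite indicE; congr (_%:R); congr nat_of_bool; apply/idP/idP.
    rewrite inE => -[[/= -> /negP]|[/= -> /negP]]; rewrite -leqNgt => ->//.
    by rewrite orbT.
  move=> /orP[/andP[a b]|/andP[a b]]; rewrite inE; [left|right]; split=> //=.
    by apply/negP; rewrite -leqNgt.
  by apply/negP; rewrite -leqNgt.
under eq_bigr do rewrite indE.
rewrite -natr_sum.
have [ff|/ltnW ff] := leqP (f' x) (f x).
  rewrite -natrB// normr_nat; congr (_%:R); rewrite -(E _ _ ff (fm x)).
  apply: eq_bigr => l _; congr nat_of_bool.
  by apply/idP/idP; lia.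
rewrite distrC -natrB// normr_nat; congr (_%:R); rewrite -(E _ _ ff (fm' x)).
apply: eq_bigr => l _; congr nat_of_bool.
by apply/idP/idP; lia.
Qed.

End nat_valued.

Lemma filter_forall_lt (T : Type) (U : set_system T) (P : nat -> T -> Prop) r :
  Filter U -> (forall i, \forall n \near U, P i n) ->
  \forall n \near U, forall i, (i < r)%N -> P i n.
Proof.
move=> UF UP; elim: r => [|r IH]; first exact: nearW.
apply: filterS2 IH (UP r) => n Pn Prn i.
by rewrite ltnS leq_eqVlt => /predU1P[->//|ir]; exact: Pn.
Qed.

Section nearly_invariant_union.
Context (K : realType) (d : measure_display) (X : measurableType d).
Variable mu : probability X K.
Variable U : set_system nat.
Hypothesis UU : UltraFilter U.
Variables (Z : nat -> set X) (eps : K).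
Hypothesis mZ : forall n, measurable (Z n).
Hypothesis mixZ : forall B, measurable B ->
  (fun n => Pr mu (Z n `&` B)) @ U --> eps * Pr mu B.

Definition mu_inv (g : X -> X) := [/\ measurable_fun setT g,
  forall x, g (g x) = x & forall A, measurable A -> mu (g @^-1` A) = mu A].

Lemma mix_limit_ge0 : 0 <= eps.
Proof.
have := mixZ measurableT; rewrite PrT mulr1 => h.
by apply: (ultra_le UU (cvg_cst 0) h) => n; exact: Pr_ge0.
Qed.

(** The level sets reduce this to the case of indicator functions, and the
    involution [g] carries [Z n] to the other side of the intersection. *)
Lemma mix_Ex (f : X -> nat) m (g : X -> X) : mnat f -> (forall x, (f x <= m)%N) ->
  mu_inv g ->
  (fun n => Ex mu (fun x => (f x)%:R * \1_(Z n) (g x))) @ U -->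
    eps * Ex mu (fun x => (f x)%:R).
Proof.
move=> mf fm [mg gg gmu].
have mgA A : measurable A -> measurable (g @^-1` A).
  by move=> mA; rewrite -[_ @^-1` _]setTI; exact: mg.
have mlev (l : nat) : measurable [set x | (l < f x)%N].
  exact: (mnat_preimage [set i | (l < i)%N] mf).
have -> : Ex mu (fun x => (f x)%:R) = \sum_(l < m) Pr mu [set x | (l < f x)%N].
  have := Ex_levels mu mf fm measurableT; under eq_bigr do rewrite setTI.
  by move=> ->; congr Ex; apply/funext => x; rewrite indicT mul1r.
rewrite mulr_sumr.
rewrite (_ : (fun n => _) = (fun n => \sum_(l < m) Pr mu (g @^-1` Z n `&` [set x | (l < f x)%N]))).
  apply: cvg_sumr => l.
  rewrite (_ : Pr mu [set x | (l < f x)%N] = Pr mu (g @^-1` [set x | (l < f x)%N])); last first.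
    by rewrite /Pr gmu.
  rewrite (_ : (fun n => _) = fun n => Pr mu (Z n `&` g @^-1` [set x | (l < f x)%N])).
    by apply: mixZ; exact: mgA.
  apply/funext => n; rewrite [RHS]/Pr -gmu; last by apply: measurableI => //; exact: mgA.
  rewrite /Pr; congr (fine (mu _)).
  by apply/seteqP; split=> x /=; rewrite /preimage/= gg.
apply/funext => n; rewrite (Ex_levels mu mf fm (mgA _ (mZ n))).
by congr Ex; apply/funext => x; rewrite mulrC.
Qed.

Variables (J m : nat) (g : nat -> X -> X) (k : nat -> X -> nat).
Hypothesis g_inv : forall j, mu_inv (g j).
Hypothesis mk : forall j, mnat (k j).
Hypothesis km : forall x, (\sum_(j < J) k j x <= m)%N.

Let k_le j x : (j < J)%N -> (k j x <= m)%N.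
Proof.
by move=> jJ; apply: leq_trans (km x); rewrite (bigD1 (Ordinal jJ))//= leq_addr.
Qed.

(** When [Z n] is a union of classes, this is the weight that [x] gives to the
    classes in [Z n]. *)
Definition marked n x := (\sum_(j < J) k j x * (g j x \in Z n))%N.

Lemma marked_le n x : (marked n x <= m)%N.
Proof.
apply: leq_trans (km x); apply: leq_sum => j _.
by case: (g j x \in Z n); rewrite ?muln1 ?muln0.
Qed.

Lemma mnat_marked n : mnat (marked n).
Proof.
apply: mnat_sum => j; apply: mnat2 => //.
apply: (mnat_comp (f := fun y => (y \in Z n) : nat)); first exact: mnat_mem.
by case: (g_inv j).
Qed.

Let lev l n := [set x | (l < marked n x)%N].

Let mlev l n : measurable (lev l n).
Proof. exact: (mnat_preimage [set i | (l < i)%N] (mnat_marked n)). Qed.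

Lemma Ex_marked B : measurable B ->
  (fun n => Ex mu (fun x => \1_B x * (marked n x)%:R)) @ U -->
  eps * Ex mu (fun x => \1_B x * (\sum_(j < J) k j x)%:R).
Proof.
move=> mB.
pose kB j x := (if (j < J)%N then (x \in B) * k j x else 0)%N.
have mkB j : mnat (kB j).
  rewrite /kB; case: (j < J)%N; last exact: mnat_cst.
  by apply: mnat2 => //; exact: mnat_mem.
have kBm j x : (kB j x <= m)%N.
  rewrite /kB; case: ifP => // jJ; case: (x \in B); rewrite ?mul0n ?mul1n//.
  exact: k_le.
have -> : (fun x => \1_B x * (\sum_(j < J) k j x)%:R) =
    (fun x => \sum_(j < J) (kB j x)%:R) :> (X -> K).
  apply/funext => x; rewrite natr_sum mulr_sumr; apply: eq_bigr => j _.
  by rewrite /kB ltn_ord natrM indicE.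
rewrite Ex_sum; last by move=> j; exact: mnat_bmf (mkB j) (kBm j).
rewrite mulr_sumr.
rewrite (_ : (fun n => _) = (fun n => \sum_(j < J) Ex mu (fun x => (kB j x)%:R * \1_(Z n) (g j x)))).
  by apply: cvg_sumr => j; exact: mix_Ex (mkB j) (kBm j) (g_inv j).
apply/funext => n.
rewrite -Ex_sum; last first.
  move=> j; apply: bmfM; first exact: mnat_bmf (mkB j) (kBm j).
  apply: (bmf_comp (f := \1_(Z n))); first exact: bmf_indic.
  by case: (g_inv j).
congr Ex; apply/funext => x; rewrite natr_sum mulr_sumr; apply: eq_bigr => j _.
by rewrite /kB ltn_ord !natrM !indicE mulrA.
Qed.

Let W l B := ulim U (fun n => Pr mu (B `&` lev l n)).

Let WP l B : measurable B -> (fun n => Pr mu (B `&` lev l n)) @ U --> W l B.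
Proof.
move=> mB; apply: (ulimP UU (M := 1)) => n.
by rewrite ger0_norm ?Pr_ge0// Pr_le1//; exact: measurableI.
Qed.

Let W_sum B : measurable B ->
  \sum_(l < m) W l B = eps * Ex mu (fun x => \1_B x * (\sum_(j < J) k j x)%:R).
Proof.
move=> mB; rewrite -(ulim_unique UU (Ex_marked mB)).
apply/esym/(ulim_unique UU).
rewrite (_ : (fun n => _) = (fun n => \sum_(l < m) Pr mu (B `&` lev l n))).
  by apply: cvg_sumr => l; exact: WP.
by apply/funext => n; rewrite (Ex_levels mu (mnat_marked n) (marked_le n) mB).
Qed.

Let W_sum_le B : measurable B -> \sum_(l < m) W l B <= eps * (m%:R * Pr mu B).
Proof.
move=> mB; rewrite W_sum//; apply: ler_wpM2l; first exact: mix_limit_ge0.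
rewrite -Ex_indic// -ExZ; last exact: bmf_indic.
apply: Ex_le.
- apply: bmfM; first exact: bmf_indic.
  by apply: mnat_bmf km; apply: mnat_sum.
- by apply: bmfM; [exact: bmf_cst|exact: bmf_indic].
- by move=> x; rewrite mulrC; apply: ler_wpM2r; [rewrite indicE|rewrite ler_nat].
Qed.

Let W_mono l A B : measurable A -> measurable B -> A `<=` B -> W l A <= W l B.
Proof.
move=> mA mB AB; apply: (ultra_le UU (@WP l _ mA) (@WP l _ mB)) => n.
by apply: Pr_le; [exact: measurableI|exact: measurableI|exact: setSI].
Qed.

Variables (r : nat) (b : K).
Hypothesis hb : forall i, (i < r)%N -> exists (u : nat -> K) c,
  [/\ u @ U --> c, c <= b &
  forall n, Ex mu (fun x => `|(marked n x)%:R - (marked n (g i x))%:R|) <= u n].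

Let D l i := ulim U (fun n => Pr mu (lev l n `+` g i @^-1` lev l n)).

Let mglev l i n : measurable (g i @^-1` lev l n).
Proof. by have [mg _ _] := g_inv i; rewrite -[_ @^-1` _]setTI; exact: mg. Qed.

Let DP l i : (fun n => Pr mu (lev l n `+` g i @^-1` lev l n)) @ U --> D l i.
Proof.
apply: (ulimP UU (M := 1)) => n.
by rewrite ger0_norm ?Pr_ge0// Pr_le1//; exact: measurableY.
Qed.

Let D_sum i : (i < r)%N -> \sum_(l < m) D l i <= b.
Proof.
move=> /hb[u [c [uc cb uP]]]; apply: le_trans cb.
have Ds : (fun n => \sum_(l < m) Pr mu (lev l n `+` g i @^-1` lev l n)) @ U -->
    \sum_(l < m) D l i.
  by apply: cvg_sumr => l; exact: DP.
apply: (ultra_le UU Ds uc) => n; apply: le_trans (uP n).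
have [mg _ _] := g_inv i.
by rewrite -(Ex_levels_dist mu (mnat_marked n) (mnat_comp (mnat_marked n) mg)
  (marked_le n) (fun x => marked_le n (g i x))).
Qed.

(** The level set of index [q] is added at an index [n] for which the measures
    of the level set, of its part in [C], and of its symmetric differences
    with its translates are within [eta] of their limits [W q setT], [W q C]
    and [D q i]. The measure of the union is obtained by inclusion-exclusion. *)
Lemma nearly_invariant_union_step (eta : K) : 0 < eta -> forall q, exists C, [/\ measurable C,
  Pr mu C <= \sum_(l < q) W l setT + q%:R * eta,
  \sum_(l < q) (W l setT - W l C) - q%:R * (eta + eta) <= Pr mu C &
  forall i, (i < r)%N -> Pr mu (C `+` g i @^-1` C) <= \sum_(l < q) D l i + q%:R * eta].
Proof.
move=> eta0; elim=> [|q [C [mC C1 C2 C3]]].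
  exists set0; split=> //.
  - by rewrite Pr0 big_ord0 mul0r addr0.
  - by rewrite Pr0 big_ord0 mul0r subr0.
  - by move=> i _; rewrite preimage_set0 big_ord0 mul0r addr0 setY0 Pr0.
have n1 := ultra_near UU eta0 (@WP q _ measurableT).
have n2 := ultra_near UU eta0 (@WP q _ mC).
have n3 : \forall n \near U, forall i, (i < r)%N ->
    `|Pr mu (lev q n `+` g i @^-1` lev q n) - D q i| < eta.
  apply: (@filter_forall_lt _ U (fun i n =>
    `|Pr mu (lev q n `+` g i @^-1` lev q n) - D q i| < eta)) => i.
  exact: (ultra_near UU eta0 (@DP q i)).
have [n [[h1 h2] h3]] := filter_ex (filterI (filterI n1 n2) n3).
exists (C `|` lev q n).
have mCl : measurable (C `|` lev q n) by exact: measurableU.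
have E : Pr mu (C `|` lev q n) = Pr mu C + Pr mu (lev q n) - Pr mu (C `&` lev q n).
  rewrite (PrID mu (mlev q n) mC) setIC addrA addrAC addrK -PrU//; last 2 first.
  - exact: measurableD.
  - by apply/seteqP; split=> // x [? []].
  by rewrite setUDr setDv setD0.
move: h1 h2; rewrite setTI !ltr_norml => /andP[h1 h1'] /andP[h2 h2'].
split=> //.
- rewrite big_ord_recr/= E -natr1 mulrDl mul1r.
  have := Pr_ge0 mu (C `&` lev q n); lra.
- rewrite big_ord_recr/= E -natr1 mulrDl mul1r.
  have hm l : W l C <= W l (C `|` lev q n) by apply: W_mono => // x; left.
  have : \sum_(l < q) (W l setT - W l (C `|` lev q n)) <= \sum_(l < q) (W l setT - W l C).
    by apply: ler_sum => l _; rewrite lerD2l lerN2.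
  have := hm q; lra.
- move=> i ir; have := C3 i ir; have := h3 i ir.
  rewrite ltr_norml big_ord_recr/= -natr1 mulrDl mul1r => /andP[_ h4] h5.
  have [mg _ _] := g_inv i.
  have mgC : measurable (g i @^-1` C) by rewrite -[_ @^-1` _]setTI; exact: mg.
  have : Pr mu ((C `|` lev q n) `+` g i @^-1` (C `|` lev q n)) <=
      Pr mu (C `+` g i @^-1` C) + Pr mu (lev q n `+` g i @^-1` lev q n).
    apply: le_trans (PrU_le mu _ _); [|exact: measurableY|exact: measurableY].
    apply: Pr_le; [|by apply: measurableU; exact: measurableY|].
      by apply: measurableY => //; rewrite preimage_setU; exact: measurableU.
    move=> x; rewrite preimage_setU /setY /setU /setD /=; tauto.
  lra.
Qed.

(** The limits of the measures of the level sets add up to the limit of the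
    mean of [marked n], and this holds on [C] as well, where the sum is at
    most [eps * m * Pr mu C]. The overlaps that are lost when the level sets
    are united are controlled by this last bound. *)
Lemma nearly_invariant_union (eta : K) : 0 < eta -> exists C, [/\ measurable C,
  Pr mu C <= eps * m%:R + eta,
  eps * Ex mu (fun x => (\sum_(j < J) k j x)%:R) - eps * m%:R * Pr mu C - eta <= Pr mu C &
  forall i, (i < r)%N -> Pr mu (C `+` g i @^-1` C) <= b + eta].
Proof.
(* Each of the [m] steps costs at most [2 * e]. *)
move=> eta0; pose e := eta / (m.+1%:R * 2).
have e0 : 0 < e by rewrite divr_gt0// mulr_gt0.
have me : m%:R * (e + e) <= eta.
  have -> : eta = m.+1%:R * (e + e) by rewrite /e; field; rewrite addrC natr1 pnatr_eq0.
  by apply: ler_wpM2r; [rewrite addr_ge0// ltW|rewrite ler_nat].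
have me' : m%:R * e <= eta.
  apply: le_trans me; apply: ler_wpM2l => //; lra.
have [C [mC C1 C2 C3]] := nearly_invariant_union_step e0 m.
exists C; split=> //.
- apply: (le_trans C1); apply: lerD => //.
  by apply: le_trans (W_sum_le measurableT) _; rewrite PrT mulr1.
- apply: le_trans C2; apply: lerB => //.
  rewrite sumrB -mulrA; apply: lerB; last exact: W_sum_le.
  rewrite W_sum//; under [in leRHS]eq_fun do rewrite indicT mul1r.
  by [].
- by move=> i ir; apply: (le_trans (C3 i ir)); apply: lerD => //; exact: D_sum.
Qed.

End nearly_invariant_union.

(** * Marked weights seen from two points of a class *)

Section disagreement_cvg0.
Context (K : realType) (d : measure_display) (X : measurableType d).
Variable mu : probability X K.
Context (F : set (set X)) (C0 : nat -> nat -> set X).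
Hypothesis sb : souslin_base F C0.
Variable S : set (X * X).
Hypothesis dS : dmp_equivalence_rel mu S.

Definition disagreement (Z : set X) (phi psi : X -> X) :=
  [set x | S (phi x, psi x)] `&` (phi @^-1` Z `+` psi @^-1` Z).

Lemma measurable_pair_preimage (E : set (X * X)) (phi psi : X -> X) :
  measurable E -> measurable_fun setT phi -> measurable_fun setT psi ->
  measurable [set x | E (phi x, psi x)].
Proof.
move=> mE mphi mpsi; rewrite -[X in measurable X]setTI.
apply: (_ : measurable_fun setT (fun x => (phi x, psi x))) => //.
exact: measurable_fun_pair.
Qed.

Lemma measurable_disagreement Z phi psi : measurable Z ->
  measurable_fun setT phi -> measurable_fun setT psi ->
  measurable (disagreement Z phi psi).
Proof.
move=> mZ mphi mpsi; apply: measurableI.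
  by apply: measurable_pair_preimage => //; case: dS => -[].
by apply: measurableY; rewrite -[_ @^-1` _]setTI; [exact: mphi|exact: mpsi].
Qed.

(** Almost everywhere on the set where [phi] and [psi] are equivalent, [psi]
    is [s k \o phi] for some [k], with the involutions [s k] that generate
    [S]; up to a set of small measure finitely many [k] suffice. For one [k],
    the disagreement lies in the preimage by [phi] of the symmetric difference
    of [Z n] and its translate by [s k]. *)
Lemma disagreement_cvg0 (Z : nat -> set X) phi psi : almost_invariant mu S Z ->
  measurable_fun setT phi -> measurable_fun setT psi ->
  (forall A, measurable A -> mu (phi @^-1` A) = mu A) ->
  (fun n => Pr mu (disagreement (Z n) phi psi)) @ \oo --> 0.
Proof.
move=> [mZ iZ] mphi mpsi phimu.
have [s [sI scov]] := feldman_moore sb dS.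
have ms k : measurable_fun setT (s k) by case: (sI k).
pose E k := [set x | psi x = s k (phi x)].
have mE k : measurable (E k).
  by apply: (measurable_eq_fun sb) => //; exact: measurableT_comp.
have cs : (fun n => \sum_(k < 0) Pr mu (s k @` Z n `+` Z n)) @ \oo --> (0 : K).
  by under eq_fun do rewrite big_ord0; exact: cvg_cst.
have {}cs q : (fun n => \sum_(k < q) Pr mu (s k @` Z n `+` Z n)) @ \oo --> (0 : K).
  elim: q => [//|q IH]; under eq_fun do rewrite big_ord_recr/=.
  have h : (fun n => \sum_(k < q) Pr mu (s k @` Z n `+` Z n) +
      Pr mu (s q @` Z n `+` Z n)) @ \oo --> (0 + 0 : K).
    by apply: cvgD => //; apply: iZ; exact: inv_in_full_group.
  by rewrite addr0 in h.
apply/cvgrPdist_lt => e e0.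
have e2 : 0 < e / 2 by rewrite divr_gt0.
have [q qe] := Pr_bigcup_tail mu e2 mE.
have /cvgrPdist_lt/(_ _ e2)[n0 _ n0P] := cs q.
exists n0 => // n n0n; rewrite sub0r normrN ger0_norm ?Pr_ge0//.
have := n0P n n0n; rewrite sub0r normrN ger0_norm; last by apply: sumr_ge0 => *; exact: Pr_ge0.
move=> sn.
pose tail := \bigcup_i E i `\` \big[setU/set0]_(i < q) E i.
pose B k := phi @^-1` (s k @` Z n `+` Z n).
have msZ k : measurable (s k @` Z n).
  by rewrite (inv_in_preimage (sI k)) -[_ @^-1` _]setTI; exact: ms.
have mY k := measurableY (msZ k) (mZ n).
have mB k : measurable (B k) by rewrite /B -[_ @^-1` _]setTI; exact: mphi.
have mtail : measurable tail.
  by apply: measurableD; [exact: bigcupT_measurable|exact: bigsetU_measurable].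
have mBU : measurable (\big[setU/set0]_(k < q) B k) by exact: bigsetU_measurable.
have mD := measurable_disagreement (mZ n) mphi mpsi.
apply: (@le_lt_trans _ _ (Pr mu (\big[setU/set0]_(k < q) B k `|` tail))); last first.
  apply: (le_lt_trans (PrU_le mu mBU mtail)).
  have := Pr_bigU_le mu q mB.
  have -> : \sum_(i < q) Pr mu (B i) = \sum_(k < q) Pr mu (s k @` Z n `+` Z n).
    by apply: eq_bigr => k _; rewrite /Pr phimu.
  move: qe; rewrite -/tail => qe h; lra.
apply: Pr_ae_le => //; first exact: measurableU.
have [N [mN N0 covN]] := scov.
exists (phi @^-1` N); split; first by rewrite -[_ @^-1` _]setTI; exact: mphi.
  by rewrite phimu.
apply: subset_trans (preimage_subset covN) => x [[Sx Yx] nx] /= cx; apply: nx.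
have [k psik] := cx _ Sx.
have [[j jq Ej]|nE] := pselect (exists2 j, (j < q)%N & E j x); [left|right].
  rewrite -bigcup_mkord; exists j => //; rewrite /B.
  rewrite (inv_in_preimage (sI j)); move: Yx.
  rewrite /setY /setU /setD /preimage /=.
  by rewrite -[s j (phi x)]Ej; tauto.
split; first by exists k.
by rewrite -bigcup_mkord => -[j /= jq Ej]; apply: nE; exists j.
Qed.

End disagreement_cvg0.

(** The classes are enumerated in two ways, with weights [a] and [b] carried
    by representatives [f] and [f'], and the relation [s] identifies the
    entries that stand for the same class; [z] and [w] tell which entries are
    marked. The sum [u] transports the weights [b] to the first enumeration
    and keeps its marks. Its distance to the first sum comes from the
    differences of weights; its distance to the second one comes from pairs
    with different marks, and from weights on classes that the first
    enumeration misses. *)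
Lemma matching_le (K : realType) (J m : nat) (a b : nat -> nat) (z w f f' : nat -> bool)
    (s : nat -> nat -> bool) :
  (forall j, (j < J)%N -> ~~ f j -> a j = 0%N) ->
  (forall i, (i < J)%N -> ~~ f' i -> b i = 0%N) ->
  (forall i, (i < J)%N -> (b i <= m)%N) ->
  (forall i j j', (j < J)%N -> (j' < J)%N -> f j -> f j' -> s i j -> s i j' -> j = j') ->
  `|(\sum_(j < J) a j * z j)%N%:R - (\sum_(i < J) b i * w i)%N%:R| <=
  \sum_(j < J) (f j)%:R * `|(a j)%:R - (\sum_(i < J) b i * s i j)%N%:R| * (z j)%:R +
  \sum_(i < J) (f' i)%:R * `|(b i)%:R - (\sum_(j < J) a j * s i j)%N%:R| * (w i)%:R +
  m%:R * \sum_(i < J) \sum_(j < J) (s i j && (z j != w i))%:R :> K.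
Proof.
move=> af bf bm inj.
pose u : K := \sum_(i < J) (b i)%:R * \sum_(j < J) (f j && s i j && z j)%:R.
have uE : u = \sum_(j < J) (f j)%:R * (\sum_(i < J) b i * s i j)%N%:R * (z j)%:R.
  rewrite /u; under eq_bigr do rewrite mulr_sumr; rewrite exchange_big/=.
  apply: eq_bigr => j _; rewrite natr_sum mulr_sumr mulr_suml.
  apply: eq_bigr => i _; rewrite natrM.
  by case: (f j); case: (s i j); case: (z j); rewrite /= ?(mulr0, mul0r, mulr1, mul1r).
have h1 : `|(\sum_(j < J) a j * z j)%N%:R - u| <=
    \sum_(j < J) (f j)%:R * `|(a j)%:R - (\sum_(i < J) b i * s i j)%N%:R| * (z j)%:R.
  rewrite uE natr_sum -sumrB; apply: le_trans (ler_norm_sum _ _ _) _.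
  apply: ler_sum => j _; rewrite natrM.
  have [fj|nfj] := boolP (f j); last by rewrite (af j)// !mul0r subrr normr0.
  by rewrite !mul1r -mulrBl normrM [`|(z j)%:R|]ger0_norm.
have h2 : `|u - (\sum_(i < J) b i * w i)%N%:R| <=
    \sum_(i < J) (f' i)%:R * `|(b i)%:R - (\sum_(j < J) a j * s i j)%N%:R| * (w i)%:R +
    m%:R * \sum_(i < J) \sum_(j < J) (s i j && (z j != w i))%:R.
  rewrite /u natr_sum -sumrB mulr_sumr -big_split/=.
  apply: le_trans (ler_norm_sum _ _ _) _.
  apply: ler_sum => i _; rewrite natrM -mulrBr normrM normr_nat.
  have S0 : 0 <= \sum_(j < J) (s i j && (z j != w i))%:R :> K by apply: sumr_ge0.
  have [fi|nfi] := boolP (f' i); last first.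
    by rewrite (bf i)// !mul0r add0r mulr_ge0.
  have [[j jJ /andP[fj sij]]|nj] := pselect (exists2 j, (j < J)%N & f j && s i j).
  - have -> : \sum_(j < J) (f j && s i j && z j)%:R = (z j)%:R :> K.
      rewrite (bigD1 (Ordinal jJ))//= fj sij/= big1 ?addr0// => j' j'j.
      case E: (f j' && s i j' && z j') => //; case/andP: E => /andP[fj' sij'] _.
      exfalso; move/eqP: j'j; apply.
      by apply: val_inj => /=; exact: inj fj' fj sij' sij.
    apply: (@le_trans _ _ (m%:R * (s i j && (z j != w i))%:R)).
      rewrite sij/=; apply: ler_pM => //; first by rewrite ler_nat bm.
      by case: (z j); case: (w i); rewrite /= ?subrr ?normr0// ?subr0 ?sub0r ?normrN normr1.
    apply: ler_wpDl; first by rewrite !mulr_ge0.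
    apply: ler_wpM2l => //.
    by rewrite (bigD1 (Ordinal jJ))//= lerDl sumr_ge0.
  - rewrite big1; last first.
      move=> j _; case E: (f j && s i j && z j) => //; case/andP: E => fs _.
      by exfalso; apply: nj; exists j.
    have -> : (\sum_(j < J) a j * s i j = 0)%N.
      rewrite big1// => j _; have [fj|nfj] := boolP (f j); last by rewrite (af j).
      have [sij|] := boolP (s i j); last by rewrite muln0.
      by exfalso; apply: nj; exists j => //; rewrite fj.
    rewrite sub0r normrN normr_nat subr0 normr_nat mul1r.
    by rewrite lerDl mulr_ge0.
rewrite -addrA; apply: le_trans (lerD h1 h2).
by rewrite -[X in `|X|](subrKA u); exact: ler_normD.
Qed.

Section discrepancy.
Context (K : realType) (d : measure_display) (X : measurableType d).
Variable mu : probability X K.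
Context (F : set (set X)) (C0 : nat -> nat -> set X).
Hypothesis sb : souslin_base F C0.
Variables (S : set (X * X)) (J : nat) (g : nat -> X -> X) (k : nat -> X -> nat).

(** Selecting the least index in each class makes the enumeration of the
    classes by the points [g j x] injective. *)
Definition first_rep j x := forall i, (i < j)%N -> ~ S (g i x, g j x).

Definition class_weight y z := (\sum_(i < J) k i y * ((g i y, z) \in S))%N.

(** Truncated subtraction is used in both directions, which makes this the
    distance of the two weights. *)
Definition class_diff (h : X -> X) j x : nat :=
  if `[< first_rep j x >] then
    (class_weight x (g j x) - class_weight (h x) (g j x) +
     (class_weight (h x) (g j x) - class_weight x (g j x)))%N else 0%N.

Hypothesis dS : dmp_equivalence_rel mu S.
Variable m : nat.
Hypothesis g_inv : forall j, mu_inv mu (g j).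
Hypothesis mk : forall j, mnat (k j).
Hypothesis km : forall x, (\sum_(j < J) k j x <= m)%N.
Hypothesis kfirst : forall j x, (j < J)%N -> ~ first_rep j x -> k j x = 0%N.

Let Sr x : S (x, x). Proof. by case: dS => -[]. Qed.
Let Ss x y : S (x, y) -> S (y, x). Proof. by case: dS => -[_ _ + _] _ _; exact. Qed.
Let St x y z : S (x, y) -> S (y, z) -> S (x, z).
Proof. by case: dS => -[_ _ _ +] _ _; exact. Qed.
Let mS : measurable S. Proof. by case: dS => -[]. Qed.
Let mg j : measurable_fun setT (g j). Proof. by case: (g_inv j). Qed.

Lemma first_rep_inj i j x : first_rep i x -> first_rep j x ->
  S (g i x, g j x) -> i = j.
Proof.
move=> fi fj Sij; apply/eqP; rewrite eqn_leq; apply/andP; split.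
  by rewrite leqNgt; apply/negP => ji; apply: (fi j ji); exact: Ss.
by rewrite leqNgt; apply/negP => ij; apply: (fj i ij).
Qed.

Lemma measurable_first_rep j : measurable [set x | first_rep j x].
Proof.
rewrite (_ : mkset _ = \bigcap_(i in [set i | (i < j)%N]) ~` [set x | S (g i x, g j x)]).
  apply: bigcap_measurableType => i _; apply: measurableC.
  exact: measurable_pair_preimage.
by apply/seteqP; split=> x xP i ij; exact: xP.
Qed.

Lemma class_weight_first j x : (j < J)%N -> first_rep j x ->
  class_weight x (g j x) = k j x.
Proof.
move=> jJ fj; rewrite /class_weight (bigD1 (Ordinal jJ))//= mem_set; last exact: Sr.
rewrite muln1 big1 ?addn0// => i ij; have [Si|nSi] := pselect (S (g i x, g j x)); last first.
  by rewrite memNset// muln0.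
have [fi|nfi] := pselect (first_rep i x); last by rewrite kfirst.
by exfalso; move/eqP: ij; apply; apply: val_inj; exact: first_rep_inj Si.
Qed.

Lemma class_weight_le y z : (class_weight y z <= m)%N.
Proof.
apply: leq_trans (km y); apply: leq_sum => i _.
by case: ((g i y, z) \in S); rewrite ?muln1 ?muln0.
Qed.

Lemma class_diff_le h j x : (class_diff h j x <= m)%N.
Proof.
rewrite /class_diff; case: ifP => // _.
have := class_weight_le x (g j x); have := class_weight_le (h x) (g j x); lia.
Qed.

Lemma mnat_class_weight (phi psi : X -> X) : measurable_fun setT phi ->
  measurable_fun setT psi -> mnat (fun x => class_weight (phi x) (psi x)).
Proof.
move=> mphi mpsi; apply: mnat_sum => i; apply: mnat2; first exact: (mnat_comp (mk i)).
rewrite (_ : (fun x => _) = (fun x => (x \in [set x | S (g i (phi x), psi x)]) : nat)).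
  apply: mnat_mem; apply: measurable_pair_preimage => //.
  exact: measurableT_comp.
by apply/funext => x; congr nat_of_bool; apply/idP/idP; rewrite !inE.
Qed.

Lemma mnat_class_diff h j : measurable_fun setT h -> mnat (class_diff h j).
Proof.
move=> mh.
rewrite (_ : class_diff h j = fun x => ((x \in [set x | first_rep j x]) *
  (class_weight x (g j x) - class_weight (h x) (g j x) +
     (class_weight (h x) (g j x) - class_weight x (g j x))))%N).
  apply: mnat2; first exact/mnat_mem/measurable_first_rep.
  have m1 : mnat (fun x => class_weight x (g j x)).
    by apply: mnat_class_weight => //; exact: measurable_id.
  have m2 : mnat (fun x => class_weight (h x) (g j x)) by exact: mnat_class_weight.
  by apply: (mnat2 addn); exact: (mnat2 subn).
apply/funext => x; rewrite /class_diff; case: asboolP => fj.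
  by rewrite mem_set// mul1n.
by rewrite memNset.
Qed.

Variable U : set_system nat.
Hypothesis UU : UltraFilter U.
Hypothesis ooU : \oo `<=` U.
Variables (Z : nat -> set X) (eps : K).
Hypothesis iZ : almost_invariant mu S Z.
Hypothesis mixZ : forall B, measurable B ->
  (fun n => Pr mu (Z n `&` B)) @ U --> eps * Pr mu B.

Let mZ n : measurable (Z n). Proof. by case: iZ. Qed.

Lemma natr_truncated_dist (a b : nat) : (a - b + (b - a))%N%:R = `|a%:R - b%:R| :> K.
Proof.
have [ab|/ltnW ba] := leqP a b.
  have -> : (a - b + (b - a) = b - a)%N by lia.
  by rewrite natrB// distrC ger0_norm// subr_ge0 ler_nat.
have -> : (a - b + (b - a) = a - b)%N by lia.
by rewrite natrB// ger0_norm// subr_ge0 ler_nat.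
Qed.

(** The enumerations of classes based at [x] and at [h x] are compared by
    [matching_le]. Differences of weights count only where the class is
    marked, which by mixing multiplies their mean by [eps]; they occur once
    for each enumeration, whence the factor [2], as [h] preserves the measure.
    Equivalent points with different marks are negligible by
    [disagreement_cvg0]. *)
Lemma marked_discrepancy h : mu_inv mu h -> exists (u : nat -> K) c,
  [/\ u @ U --> c,
   c <= 2 * (eps * \sum_(j < J) Ex mu (fun x => (class_diff h j x)%:R)) &
   forall n, Ex mu (fun x => `|(marked Z J g k n x)%:R - (marked Z J g k n (h x))%:R|) <= u n].
Proof.
move=> [mh hh hmu].
have mD j := mnat_class_diff j mh.
have Dm := class_diff_le h.
have bD j : bmf (fun x => (class_diff h j x)%:R : K) by exact: mnat_bmf (mD j) (Dm j).
have bZ n (phi : X -> X) : measurable_fun setT phi -> bmf (fun x => \1_(Z n) (phi x) : K).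
  by move=> mphi; apply: (bmf_comp (f := \1_(Z n))) => //; exact: bmf_indic.
have bDZ n j : bmf (fun x => (class_diff h j x)%:R * \1_(Z n) (g j x) : K).
  by apply: bmfM => //; exact: bZ.
pose v n := \sum_(j < J) Ex mu (fun x => (class_diff h j x)%:R * \1_(Z n) (g j x)).
pose A i j n := disagreement S (Z n) (g i \o h) (g j).
have mgh i : measurable_fun setT (g i \o h) by exact: measurableT_comp.
have mA i j n : measurable (A i j n) by exact: (measurable_disagreement dS).
pose w n := \sum_(i < J) \sum_(j < J) Pr mu (A i j n).
exists (fun n => v n + v n + m%:R * w n).
exists (eps * \sum_(j < J) Ex mu (fun x => (class_diff h j x)%:R) +
        eps * \sum_(j < J) Ex mu (fun x => (class_diff h j x)%:R) + m%:R * 0).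
have cv : v @ U --> eps * \sum_(j < J) Ex mu (fun x => (class_diff h j x)%:R).
  rewrite mulr_sumr; apply: cvg_sumr => j.
  exact: (mix_Ex UU mZ mixZ (mD j) (Dm j) (g_inv j)).
split.
- apply: cvgD; first exact: cvgD.
  apply: cvgMr; apply: (cvg_oo_ultra ooU).
  have -> : 0 = \sum_(i < J) \sum_(j < J) 0 :> K.
    by rewrite big1// => i _; rewrite big1.
  apply: cvg_big => [|i _]; first exact: add_continuous.
  apply: cvg_big => [|j _]; first exact: add_continuous.
  apply: (disagreement_cvg0 sb dS iZ) => // B mB; have [_ _ gmu] := g_inv i.
  rewrite comp_preimage hmu ?gmu//.
  by rewrite -[_ @^-1` _]setTI; exact: mg.
- by rewrite mulr0 addr0; set q := eps * _; lra.
move=> n.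
have Ev : v n = Ex mu (fun x => \sum_(j < J) ((class_diff h j x)%:R * \1_(Z n) (g j x))).
  by rewrite Ex_sum.
have Ev' : v n = Ex mu ((fun x => \sum_(j < J) ((class_diff h j x)%:R * \1_(Z n) (g j x))) \o h).
  by rewrite Ex_comp//; exact: bmf_sum.
have Ew : m%:R * w n = Ex mu (fun x => m%:R * \sum_(i < J) \sum_(j < J) \1_(A i j n) x).
  rewrite ExZ; last by apply: bmf_sum => i; apply: bmf_sum => j; exact: bmf_indic.
  congr (_ * _); rewrite Ex_sum; last by move=> i; apply: bmf_sum => j; exact: bmf_indic.
  apply: eq_bigr => i _; rewrite Ex_sum; last by move=> j; exact: bmf_indic.
  by apply: eq_bigr => j _; rewrite Ex_indic.
have bv : bmf (fun x => \sum_(j < J) ((class_diff h j x)%:R * \1_(Z n) (g j x)) : K).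
  exact: bmf_sum.
have bv' := bmf_comp bv mh.
have bw : bmf (fun x => m%:R * \sum_(i < J) \sum_(j < J) \1_(A i j n) x : K).
  apply: bmfM; first exact: bmf_cst.
  by apply: bmf_sum => i; apply: bmf_sum => j; exact: bmf_indic.
rewrite {1}Ev Ev' Ew -ExD// -ExD//; last exact: bmfD.
have mm := mnat_marked mZ J g_inv mk n.
have mle x : (marked Z J g k n x <= m)%N by apply: marked_le.
apply: Ex_le.
- apply: bmf_norm; apply: bmfB; first exact: mnat_bmf mm mle.
  apply: (bmf_comp (f := fun x => (marked Z J g k n x)%:R) _ mh).
  exact: mnat_bmf mm mle.
- by apply: bmfD => //; exact: bmfD.
move=> x.
have c1 y j : (j < J)%N -> ~~ `[< first_rep j y >] -> k j y = 0%N.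
  by move=> jJ /asboolPn nf; exact: kfirst.
have c2 i : (i < J)%N -> (k i (h x) <= m)%N.
  by move=> iJ; apply: leq_trans (km (h x)); rewrite (bigD1 (Ordinal iJ))//= leq_addr.
have c3 i j j' : (j < J)%N -> (j' < J)%N -> `[< first_rep j x >] ->
    `[< first_rep j' x >] -> (g i (h x), g j x) \in S ->
    (g i (h x), g j' x) \in S -> j = j'.
  move=> jJ j'J /asboolP fj /asboolP fj'; rewrite !inE => s1 s2.
  by apply: first_rep_inj fj fj' _; exact: St (Ss s1) s2.
apply: le_trans (@matching_le K J m _ _ (fun j => g j x \in Z n)
  (fun i => g i (h x) \in Z n) _ _ (fun i j => (g i (h x), g j x) \in S)
  (c1 x) (c1 (h x)) c2 c3) _.
apply: lerD; first apply: lerD.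
- apply: ler_sum => j _; rewrite indicE; apply: ler_wpM2r => //.
  rewrite /class_diff; case: asboolP => fj; last by rewrite mul0r.
  by rewrite mul1r class_weight_first// natr_truncated_dist.
- apply: ler_sum => i _; rewrite indicE; apply: ler_wpM2r => //.
  rewrite /class_diff; case: asboolP => fi; last by rewrite mul0r.
  rewrite mul1r class_weight_first// hh natr_truncated_dist.
  rewrite (_ : (\sum_(j < J) _)%N = class_weight x (g i (h x)))//.
  apply: eq_bigr => j _; congr (_ * nat_of_bool _)%N.
  by apply/idP/idP; rewrite !inE; exact: Ss.
- apply: ler_wpM2l => //; apply: ler_sum => i _; apply: ler_sum => j _.
  rewrite indicE ler_nat; case: andP => // -[]; rewrite inE => Sij zw.
  rewrite mem_set//; split=> //.
  move: zw; rewrite /setY /setU /setD /preimage /=.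
  have [gz|gz] := boolP (g j x \in Z n); have [hz|hz] := boolP (g i (h x) \in Z n) => // _.
  + by right; rewrite inE in gz; move: hz; rewrite notin_setE.
  + by left; rewrite inE in hz; move: gz; rewrite notin_setE.
Qed.

End discrepancy.

(** * Sums over quotient classes *)

Section class_sums.
Context (K : realType) (d : measure_display) (X : measurableType d).
Variable mu : probability X K.
Variables (R S : set (X * X)) (g : nat -> X -> X).
Hypothesis dR : dmp_equivalence_rel mu R.
Hypothesis dS : dmp_equivalence_rel mu S.
Hypothesis SR : S `<=` R.
Hypothesis gR : forall j x, R (x, g j x).

Let Sr x : S (x, x). Proof. by case: dS => -[]. Qed.
Let Ss x y : S (x, y) -> S (y, x). Proof. by case: dS => -[_ _ + _] _ _; exact. Qed.
Let St x y z : S (x, y) -> S (y, z) -> S (x, z).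
Proof. by case: dS => -[_ _ _ +] _ _; exact. Qed.
Let Rs x y : R (x, y) -> R (y, x). Proof. by case: dR => -[_ _ + _] _ _; exact. Qed.
Let Rt x y z : R (x, y) -> R (y, z) -> R (x, z).
Proof. by case: dR => -[_ _ _ +] _ _; exact. Qed.

Lemma rel_class_eq x y : S (x, y) -> rel_class S x = rel_class S y.
Proof.
move=> Sxy; apply/seteqP; split=> z; first by apply: St; exact: Ss.
exact: St.
Qed.

Lemma class_quotient_eq x y : R (x, y) -> class_quotient R S x = class_quotient R S y.
Proof.
move=> Rxy; have : rel_class R x = rel_class R y.
  apply/seteqP; split=> z; first by apply: Rt; exact: Rs.
  exact: Rt.
by rewrite /class_quotient => ->.
Qed.

Definition class_sum J x (phi : set X -> K) :=
  \sum_(j < J | `[< first_rep S g j x >]) phi (rel_class S (g j x)).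

Variable x : X.
Hypothesis cov : forall y, R (x, y) -> exists j, y = g j x.
Variable phi : set X -> K.
Hypothesis phi0 : forall c, 0 <= phi c.

(** The first representatives enumerate the quotient without repetition. *)
Lemma esum_class_quotient : (\esum_(c in class_quotient R S x) (phi c)%:E =
  \sum_(j <oo | `[< first_rep S g j x >]) (phi (rel_class S (g j x)))%:E)%E.
Proof.
rewrite nneseries_esum; last by move=> j _; rewrite lee_fin.
apply: (@reindex_esum K _ _ _ _ (fun j => rel_class S (g j x))); split.
- move=> j _; split; first by exists (g j x).
  by move=> z Sz; apply: Rt (gR j x) _; exact: SR.
- move=> i j; rewrite !inE => /asboolP fi /asboolP fj ij.
  apply: (first_rep_inj dS fi fj).
  suff : rel_class S (g i x) (g j x) by [].
  by rewrite ij; exact: Sr.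
- move=> c [[y ->] cR].
  have [j0 yE] := cov (cR _ (Sr y)).
  have ex : exists j, `[< S (g j x, y) >].
    by exists j0; apply/asboolP; rewrite yE; exact: Sr.
  case: (ex_minnP ex) => j /asboolP Sj jmin; exists j; last first.
    exact: rel_class_eq.
  apply/asboolP => i ij Sij.
  by have := jmin i; rewrite leqNgt ij /= => /(_ (asboolT (St Sij Sj))).
Qed.

Lemma class_sum_le_esum J :
  ((class_sum J x phi)%:E <= \esum_(c in class_quotient R S x) (phi c)%:E)%E.
Proof.
rewrite esum_class_quotient /class_sum -sumEFin -(big_mkord (fun j => `[< first_rep S g j x >])
  (fun j => (phi (rel_class S (g j x)))%:E)).
by apply: nneseries_lim_ge => j _ _; rewrite lee_fin.
Qed.

Lemma esum_le_class_sum M : (forall J, class_sum J x phi <= M) ->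
  (\esum_(c in class_quotient R S x) (phi c)%:E <= M%:E)%E.
Proof.
move=> fM; rewrite esum_class_quotient; apply: lime_le.
  by apply: is_cvg_nneseries_cond => j _ _; rewrite lee_fin.
apply: nearW => J; rewrite (big_mkord (fun j => `[< first_rep S g j x >])
  (fun j => (phi (rel_class S (g j x)))%:E)) sumEFin lee_fin.
exact: fM.
Qed.

Lemma class_sum_mono J J' : (J <= J')%N -> class_sum J x phi <= class_sum J' x phi.
Proof.
move=> JJ'; rewrite /class_sum.
rewrite -(big_mkord (fun j => `[< first_rep S g j x >]) (fun j => phi (rel_class S (g j x)))).
rewrite -(big_mkord (fun j => `[< first_rep S g j x >]) (fun j => phi (rel_class S (g j x)))).
rewrite (@big_cat_nat _ _ _ J 0%N J')//= lerDl.
by apply: sumr_ge0.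
Qed.

End class_sums.

Section complex_estimate.
Context (K : realType).
Local Notation normc := ComplexField.Normc.normc.

Lemma normc_sqr (a : K[i]) : normc a ^+ 2 = complex.Re a ^+ 2 + complex.Im a ^+ 2.
Proof. by case: a => a b /=; rewrite sqr_sqrtr// addr_ge0// sqr_ge0. Qed.

(** From [0 <= ((u - v) - t * (u + v)) ^+ 2] and its variants, for the real
    and imaginary parts. With [t] of the order of the distance of two unit
    vectors, it bounds the total variation between their square moduli by a
    multiple of that distance. *)
Lemma normc_sqr_diff (t : K) (a b : K[i]) : 0 < t ->
  `|normc a ^+ 2 - normc b ^+ 2| <=
  t * (normc a ^+ 2 + normc b ^+ 2) + (normc (a - b)) ^+ 2 / (2 * t).
Proof.
move=> t0; rewrite !normc_sqr raddfB/= raddfB/=.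
move: (complex.Re a) (complex.Im a) (complex.Re b) (complex.Im b) => a1 a2 b1 b2.
have key (u v : K) : `|u ^+ 2 - v ^+ 2| <= t * (u ^+ 2 + v ^+ 2) + (u - v) ^+ 2 / (2 * t).
  have t2 : 0 < 2 * t by rewrite mulr_gt0.
  have -> : t * (u ^+ 2 + v ^+ 2) + (u - v) ^+ 2 / (2 * t) =
     (2 * t * t * (u ^+ 2 + v ^+ 2) + (u - v) ^+ 2) / (2 * t).
    by field; rewrite gt_eqF.
  rewrite ler_pdivlMr// -[X in _ * X](ger0_norm (ltW t2)) -normrM ler_norml.
  have h1 := sqr_ge0 ((u - v) - t * (u + v)); have h2 := sqr_ge0 (t * (u - v)).
  have h3 := sqr_ge0 ((u - v) + t * (u + v)).
  by apply/andP; split; lra.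
have := key a1 b1; have := key a2 b2.
have := ler_normD (a1 ^+ 2 - b1 ^+ 2) (a2 ^+ 2 - b2 ^+ 2).
have -> : a1 ^+ 2 + a2 ^+ 2 - (b1 ^+ 2 + b2 ^+ 2) =
  a1 ^+ 2 - b1 ^+ 2 + (a2 ^+ 2 - b2 ^+ 2) by ring.
rewrite !mulrDl; lra.
Qed.

End complex_estimate.

(** * Rounding square moduli to integer weights *)

Section ae_tools.
Context (K : realType) (d : measure_display) (X : measurableType d).
Variable mu : probability X K.

Lemma ae_forall_nat (P : nat -> X -> Prop) :
  (forall n, {ae mu, forall x, P n x}) -> {ae mu, forall x, forall n, P n x}.
Proof.
move=> aeP; apply: negligibleS (negligible_bigcup aeP) => x /= /existsNP[n nP].
by exists n.
Qed.

Lemma ae_preimage g (P : X -> Prop) : measurable_fun setT g ->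
  (forall A, measurable A -> mu (g @^-1` A) = mu A) ->
  {ae mu, forall x, P x} -> {ae mu, forall x, P (g x)}.
Proof.
move=> mg gmu [N [mN N0 PN]]; exists (g @^-1` N); split.
- by rewrite -[_ @^-1` _]setTI; exact: mg.
- by rewrite gmu.
- by move=> x nP; exact: PN.
Qed.

Lemma Ex_fin_le (f : X -> K) (h : X -> \bar K) c : bmf f -> (forall x, 0 <= f x) ->
  (forall x, ((f x)%:E <= h x)%E) -> (\int[mu]_x h x <= c%:E)%E -> Ex mu f <= c.
Proof.
move=> bf f0 fh hc; rewrite -lee_fin; apply: le_trans hc.
have -> : (Ex mu f)%:E = (\int[mu]_x (f x)%:E)%E.
  rewrite /Ex /Rintegral fineK//; apply: integrable_fin_num => //.
  exact: (bmf_integrable mu bf).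
by apply: ge0_le_integral_lower => // x; rewrite lee_fin.
Qed.

Lemma bounded_convergence0 (f : nat -> X -> \bar K) (M : K) :
  (forall n, measurable_fun setT (f n)) -> (forall n x, (0 <= f n x)%E) ->
  {ae mu, forall x, forall n, (f n x <= M%:E)%E} ->
  {ae mu, forall x, f ^~ x @ \oo --> 0%E} ->
  (fun n => \int[mu]_x f n x)%E @ \oo --> 0%E.
Proof.
move=> mf f0 fM fc.
have [||||_ _] := @dominated_convergence _ _ _ mu setT measurableT f (cst 0%E) (cst M%:E) mf.
- exact: measurable_cst.
- by apply: filterS fc => x + _.
- exact: (bmf_integrable mu (bmf_cst X M)).
- by apply: filterS fM => x fx n _; rewrite gee0_abs.
by rewrite integral0.
Qed.

End ae_tools.

Section folner.
Context (K : realType) (d : measure_display) (X : measurableType d).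
Variable mu : probability X K.
Context (F : set (set X)) (C0 : nat -> nat -> set X).
Hypothesis sb : souslin_base F C0.
Variables (R S : set (X * X)) (g : nat -> X -> X).
Hypothesis dR : dmp_equivalence_rel mu R.
Hypothesis dS : dmp_equivalence_rel mu S.
Hypothesis SR : S `<=` R.
Hypothesis gI : forall j, inv_in R (g j).
Hypothesis gcov : {ae mu, forall x, forall y, R (x, y) -> exists j, y = g j x}.

Let gR j x : R (x, g j x). Proof. by case: (gI j). Qed.
Let mg j : measurable_fun setT (g j). Proof. by case: (gI j). Qed.
Let gg j x : g j (g j x) = x. Proof. by case: (gI j). Qed.
Let mR : measurable R. Proof. by case: dR => -[]. Qed.
Let pR : measure_preserving_rel mu R. Proof. by case: dR. Qed.
Let Rt x y z : R (x, y) -> R (y, z) -> R (x, z).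
Proof. by case: dR => -[_ _ _ +] _ _; exact. Qed.
Let gmu j A : measurable A -> mu (g j @^-1` A) = mu A.
Proof. by apply: (full_group_preimage sb mR pR); exact: inv_in_full_group. Qed.

Lemma inv_in_mu_inv j : mu_inv mu (g j).
Proof. by split; [exact: mg|exact: gg|exact: gmu]. Qed.

Local Notation normc := ComplexField.Normc.normc.
Local Notation CQ := (class_quotient R S).

Section family.
Variable xi : X -> set X -> K[i].
Hypothesis mxi : measurable_l2_family mu R S xi.
Hypothesis xi1 : {ae mu, forall x, l2norm (CQ x) (xi x) = 1%E}.

(** For almost every [y], a probability measure on the classes inside the
    class of [y]. *)
Definition sqmod (y : X) (c : set X) : K := normc (xi y c) ^+ 2.

Lemma sqmod_ge0 y c : 0 <= sqmod y c. Proof. exact: sqr_ge0. Qed.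

Lemma esum_sqmod : {ae mu, forall x, (\esum_(c in CQ x) (sqmod x c)%:E = 1)%E}.
Proof.
apply: filterS xi1 => x; rewrite /l2norm => h.
rewrite -(@sqr_sqrte K (esum _ _)); first by rewrite h expe2 mule1.
by apply: esum_ge0 => c _; rewrite lee_fin sqr_ge0.
Qed.

(** Measurability is known up to a null set only; truncation at [1] provides a
    bound valid everywhere. *)
Lemma sqmod_version h : full_group mu R h -> exists b : X -> K,
  [/\ measurable_fun setT b, forall x, 0 <= b x <= 1 &
      {ae mu, forall x, b x = sqmod x (rel_class S (h x))}].
Proof.
move=> hG; have [_ /(_ h hG)[[a ma aE] [c mc cE]]] := mxi.
exists (fun x => Num.min (a x ^+ 2 + c x ^+ 2) 1); split.
- apply: measurable_minr => //; apply: measurable_funD; exact: measurable_funX.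
- move=> x; rewrite le_min ler01 andbT ge_min lexx orbT andbT.
  by rewrite addr_ge0// sqr_ge0.
have [_ _ _ hR] := hG.
apply: filterS (filterI (filterI aE cE) (filterI hR esum_sqmod)).
move=> x [[aEx cEx] [Rx e1]].
rewrite -aEx -cEx -normc_sqr -/(sqmod _ _); apply/min_idPl.
rewrite -lee_fin -e1; apply: esum_ge; exists [set rel_class S (h x)].
  split; first exact: finite_set1.
  move=> _ ->; split; first by exists (h x).
  by move=> z Sz; apply: Rt Rx _; exact: SR.
by rewrite fsbig_set1.
Qed.

Lemma full_group_comp i j : full_group mu R (g j \o g i).
Proof.
split.
- by apply: bij_comp; [exists (g j)|exists (g i)].
- exact: measurableT_comp.
- move=> A mA; rewrite -image_comp.
  rewrite (inv_in_preimage (gI i)) (inv_in_preimage (gI j)).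
  have m1 : measurable (g i @^-1` A) by rewrite -[_ @^-1` _]setTI; exact: mg.
  by rewrite -[X in measurable X]setTI; exact: mg.
- by apply: aeW => x /=; exact: Rt (gR i x) (gR j _).
Qed.

(** At the point [g i x], the map [g j \o g i] takes the value [g j x]. *)
Lemma sqmod_moved_version i j : exists b : X -> K,
  [/\ measurable_fun setT b, forall x, 0 <= b x <= 1 &
      {ae mu, forall x, b x = sqmod (g i x) (rel_class S (g j x))}].
Proof.
have [b [mb b01 bE]] := sqmod_version (full_group_comp i j).
exists (b \o g i); split => //.
- exact: measurableT_comp.
- by move=> x; exact: b01.
- apply: filterS (ae_preimage (@mg i) (@gmu i) bE) => x /= ->.
  by rewrite gg.
Qed.

End family.

Section rounding.
Variables (nu : X -> set X -> K) (b : nat -> X -> K).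
Hypothesis nu0 : forall y c, 0 <= nu y c.
Hypothesis mb : forall j, measurable_fun setT (b j).
Hypothesis b01 : forall j x, 0 <= b j x <= 1.
Variable J m : nat.

Definition partial_mass x := \sum_(j < J) (`[< first_rep S g j x >])%:R * b j x.

(** Without the condition on [partial_mass], which holds almost everywhere,
    the total weight would not be bounded by [m] at every point. *)
Definition rounded j x : nat :=
  if `[< first_rep S g j x /\ partial_mass x <= 1 >] && (j < J)%N
  then Num.truncn (m%:R * b j x) else 0%N.

Lemma bmf_first_mul j (f : X -> K) : bmf f -> bmf (fun x => (`[< first_rep S g j x >])%:R * f x).
Proof.
move=> bf; apply: bmfM => //.
rewrite (_ : (fun x => _) = \1_[set x | first_rep S g j x]).
  by apply: bmf_indic; exact: (measurable_first_rep dS inv_in_mu_inv).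
by apply/funext => x; rewrite indicE; congr (_%:R).
Qed.

Lemma bmf_b j : bmf (b j).
Proof.
split; first exact: mb.
by exists 1 => x; have /andP[h1 h2] := b01 j x; rewrite ger0_norm.
Qed.

Lemma bmf_partial_mass : bmf partial_mass.
Proof. by apply: bmf_sum => j; apply: bmf_first_mul; exact: bmf_b. Qed.

Lemma mnat_rounded j : mnat (rounded j).
Proof.
have mP : measurable [set x | partial_mass x <= 1].
  have [mp _] := bmf_partial_mass.
  rewrite (_ : mkset _ = setT `&` partial_mass @^-1` [set` `]-oo, 1]]).
    by apply: mp.
  by rewrite setTI; apply/seteqP; split=> x /=; rewrite in_itv.
have mT : mnat (fun x => Num.truncn (m%:R * b j x)).
  move=> l; have [mbm _] := bmfM (bmf_cst X (m%:R : K)) (bmf_b j).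
  rewrite (_ : mkset _ = setT `&` (fun x => m%:R * b j x) @^-1` [set` `[l%:R, l.+1%:R[]).
    by apply: mbm.
  rewrite setTI; apply/seteqP; split=> x /=; rewrite in_itv/=.
    move=> <-; apply: truncn_itv; apply: mulr_ge0 => //.
    by have /andP[] := b01 j x.
  exact: truncn_def.
rewrite (_ : rounded j = fun x => (((x \in [set x | first_rep S g j x]) *
   (x \in [set x | (partial_mass x <= 1)%R])) *
   ((j < J)%N * Num.truncn (m%:R * b j x)))%N).
  apply: mnat2; last by apply: mnat2 => //; exact: mnat_cst.
  apply: mnat2; last exact: mnat_mem.
  exact/mnat_mem/(measurable_first_rep dS inv_in_mu_inv).
apply/funext => x; rewrite /rounded; case: asboolP => /=.
  by move=> [h1 h2]; rewrite !mem_set// !mul1n; case: (j < J)%N; rewrite ?mul1n ?mul0n.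
have [h1|h1] := pselect (first_rep S g j x); last by rewrite [_ \in [set x | first_rep S g j x]]memNset.
have [h2|h2] := pselect (partial_mass x <= 1); first by move=> /(_ (conj h1 h2)).
by move=> _; rewrite [_ \in [set x | partial_mass x <= 1]]memNset// muln0.
Qed.

Lemma rounded_first j x : ~ first_rep S g j x -> rounded j x = 0%N.
Proof. by move=> nf; rewrite /rounded asboolF// => -[]. Qed.

Lemma rounded_le j x :
  (rounded j x)%:R <= m%:R * ((`[< first_rep S g j x >])%:R * b j x).
Proof.
have /andP[b0 _] := b01 j x; rewrite /rounded; case: ifP => [/andP[/asboolP[fj _] _]|_].
  rewrite asboolT// mul1r truncn_le mulr_ge0//.
by rewrite !mulr_ge0.
Qed.

Lemma rounded_sum x : (\sum_(j < J) rounded j x <= m)%N.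
Proof.
have [p1|np] := pselect (partial_mass x <= 1); last first.
  by rewrite big1// => j _; rewrite /rounded asboolF// => -[].
rewrite -(ler_nat K) natr_sum; apply: (@le_trans _ _ (m%:R * partial_mass x)).
  by rewrite /partial_mass mulr_sumr; apply: ler_sum => j _; exact: rounded_le.
by rewrite -[leRHS]mulr1; apply: ler_wpM2l.
Qed.

Definition good x := [/\ forall y, R (x, y) -> exists j, y = g j x,
  (\esum_(c in CQ x) (nu x c)%:E = 1)%E &
  forall j, b j x = nu x (rel_class S (g j x))].

Lemma partial_mass_class_sum x : good x -> partial_mass x = class_sum S g J x (nu x).
Proof.
move=> [_ _ bE]; rewrite /partial_mass /class_sum [RHS]big_mkcond/=.
by apply: eq_bigr => j _; rewrite bE; case: asboolP => _; rewrite ?mul1r ?mul0r.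
Qed.

Lemma class_sum_le1 x J' : good x -> class_sum S g J' x (nu x) <= 1.
Proof.
move=> [cov e1 _]; rewrite -lee_fin -e1.
exact: (class_sum_le_esum dR dS SR gR cov (nu0 x)).
Qed.

Lemma good_mass_le1 x : good x -> partial_mass x <= 1.
Proof. by move=> gx; rewrite partial_mass_class_sum//; exact: class_sum_le1. Qed.

Lemma good_rounded j x : good x -> (j < J)%N -> first_rep S g j x ->
  rounded j x = Num.truncn (m%:R * nu x (rel_class S (g j x))).
Proof.
move=> gx jJ fj; rewrite /rounded jJ andbT asboolT; first by case: gx => _ _ ->.
by split=> //; exact: good_mass_le1.
Qed.

Lemma rounded_loss x : good x ->
  m%:R * partial_mass x - J%:R <= (\sum_(j < J) rounded j x)%N%:R.
Proof.
move=> gx; rewrite natr_sum /partial_mass mulr_sumr.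
have -> : J%:R = \sum_(j < J) 1 :> K by rewrite sumr_const card_ord.
rewrite -sumrB; apply: ler_sum => j _.
have [fj|nf] := pselect (first_rep S g j x); last first.
  by rewrite asboolF// mul0r mulr0 sub0r (le_trans (lerN10 K)).
have [_ _ bE] := gx.
rewrite good_rounded// asboolT// mul1r bE lerBlDr natr1 ltW//.
by have /andP[] := @truncn_itv _ (m%:R * nu x (rel_class S (g j x))) (mulr_ge0 (ler0n _ _) (nu0 _ _)).
Qed.

Let Sr x : S (x, x). Proof. by case: dS => -[]. Qed.
Let Ss x y : S (x, y) -> S (y, x). Proof. by case: dS => -[_ _ + _] _ _; exact. Qed.
Let St x y z : S (x, y) -> S (y, z) -> S (x, z).
Proof. by case: dS => -[_ _ _ +] _ _; exact. Qed.

Let kfirst j x (jJ : (j < J)%N) : ~ first_rep S g j x -> rounded j x = 0%N :=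
  @rounded_first j x.

Lemma class_weight_class y z z' : S (z, z') ->
  class_weight S J g rounded y z = class_weight S J g rounded y z'.
Proof.
move=> zz; apply: eq_bigr => i _; congr (_ * nat_of_bool _)%N.
by apply/idP/idP; rewrite !inE => h; [exact: St h zz|exact: St h (Ss zz)].
Qed.

Lemma class_weight_le_nu y z : good y ->
  (class_weight S J g rounded y z)%:R <= m%:R * nu y (rel_class S z).
Proof.
move=> gy.
have [[l [lJ fl Sl]]|nl] := pselect (exists l, [/\ (l < J)%N, first_rep S g l y & S (g l y, z)]).
  rewrite -(class_weight_class y Sl) (class_weight_first dS kfirst)// good_rounded//.
  rewrite (rel_class_eq dS Sl) truncn_le.
  by rewrite mulr_ge0.
rewrite [class_weight _ _ _ _ _ _]big1 ?mulr_ge0// => l _.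
have [fl|nfl] := pselect (first_rep S g l y); last by rewrite rounded_first.
by rewrite memNset ?muln0// => Sl; apply: nl; exists l.
Qed.

Lemma sum_first_rounded y J' : (J <= J')%N ->
  (\sum_(j < J) rounded j y <=
   \sum_(j < J' | `[< first_rep S g j y >]) class_weight S J g rounded y (g j y))%N.
Proof.
move=> JJ'.
rewrite -(big_mkord (fun j => `[< first_rep S g j y >])
  (fun j => class_weight S J g rounded y (g j y))).
rewrite (@big_cat_nat _ _ _ J 0%N J')//=; apply: leq_trans (leq_addr _ _).
rewrite big_mkord [leqRHS]big_mkcond/=; apply: leq_sum => j _.
case: asboolP => fj; last by rewrite rounded_first.
by rewrite (class_weight_first dS kfirst).
Qed.

(** Rounding down only decreases the masses, so the losses over all classes,
    which are those seen from [y], dominate the losses over the classes listed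
    from [x]. *)
Lemma rounding_defect x y : good x -> good y -> R (x, y) ->
  \sum_(j < J | `[< first_rep S g j x >])
    (m%:R * nu y (rel_class S (g j x)) - (class_weight S J g rounded y (g j x))%:R)
  <= m%:R - (\sum_(j < J) rounded j y)%N%:R.
Proof.
move=> gx gy Rxy.
have [covx _ _] := gx; have [covy ey _] := gy.
pose Nc (c : set X) := (\sum_(l < J) rounded l y * (g l y \in c))%N.
have NcE z : Nc (rel_class S z) = class_weight S J g rounded y z.
  apply: eq_bigr => l _; congr (_ * nat_of_bool _)%N.
  by apply/idP/idP; rewrite !inE; exact: Ss.
pose phi c := `|m%:R * nu y c - (Nc c)%:R|.
have phi0 c : 0 <= phi c by exact: normr_ge0.
have phiE z : phi (rel_class S z) =
    m%:R * nu y (rel_class S z) - (class_weight S J g rounded y z)%:R.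
  by rewrite /phi NcE ger0_norm// subr_ge0 class_weight_le_nu.
have -> : \sum_(j < J | `[< first_rep S g j x >])
    (m%:R * nu y (rel_class S (g j x)) - (class_weight S J g rounded y (g j x))%:R) =
    class_sum S g J x phi.
  by apply: eq_bigr => j _; rewrite phiE.
rewrite -lee_fin; apply: le_trans (class_sum_le_esum dR dS SR gR covx phi0 J) _.
rewrite (class_quotient_eq S dR Rxy).
apply: (esum_le_class_sum dR dS SR gR covy phi0) => J1.
pose J' := maxn J J1.
apply: le_trans (class_sum_mono S g y phi0 (leq_maxr J J1)) _.
rewrite /class_sum; under eq_bigr do rewrite phiE.
rewrite sumrB -mulr_sumr; apply: lerB.
  by rewrite -[leRHS]mulr1; apply: ler_wpM2l => //; exact: class_sum_le1.
by rewrite -natr_sum ler_nat; apply: sum_first_rounded; exact: leq_maxl.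
Qed.

(** The weights at [x] and at [g i x] differ by at most the difference of the
    masses and the two losses by rounding and by the restriction to finitely
    many classes. *)
Lemma rounded_diff i x (b' : nat -> K) : good x -> good (g i x) ->
  (forall j, b' j = nu (g i x) (rel_class S (g j x))) ->
  (\sum_(j < J) class_diff S J g rounded (g i) j x)%N%:R <=
  m%:R * \sum_(j < J) (`[< first_rep S g j x >])%:R * `|b j x - b' j| +
  (m%:R - (\sum_(j < J) rounded j x)%N%:R) +
  (m%:R - (\sum_(j < J) rounded j (g i x))%N%:R).
Proof.
move=> gx gy b'E; set y := g i x in gy b'E *.
have [covx _ bE] := gx.
have Rxx : R (x, x) by case: dR => -[].
have d1 := rounding_defect gx gx Rxx.
have d2 := rounding_defect gx gy (gR i x).
pose fr := fun j : 'I_J => `[< first_rep S g j x >].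
pose N z j := (class_weight S J g rounded z (g j x))%:R : K.
pose A z j := m%:R * nu z (rel_class S (g j x)).
have -> : (\sum_(j < J) class_diff S J g rounded (g i) j x)%N%:R =
    \sum_(j < J | fr j) `|N x j - N y j|.
  rewrite natr_sum [RHS]big_mkcond/=; apply: eq_bigr => j _.
  by rewrite /class_diff /fr; case: asboolP => // _; rewrite natr_truncated_dist.
have -> : m%:R * \sum_(j < J) (`[< first_rep S g j x >])%:R * `|b j x - b' j| =
    \sum_(j < J | fr j) `|A x j - A y j|.
  rewrite mulr_sumr [RHS]big_mkcond/=; apply: eq_bigr => j _.
  rewrite /fr; case: asboolP => // _; last by rewrite mul0r mulr0.
  by rewrite mul1r bE b'E /A -mulrBr normrM normr_nat.
apply: (@le_trans _ _ (\sum_(j < J | fr j) `|A x j - A y j| +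
   \sum_(j < J | fr j) (A x j - N x j) + \sum_(j < J | fr j) (A y j - N y j))).
  rewrite -!big_split/=; apply: ler_sum => j _.
  have h1 : N x j <= A x j by exact: class_weight_le_nu.
  have h2 : N y j <= A y j by exact: class_weight_le_nu.
  rewrite ler_norml.
  have := ler_norm (A x j - A y j); have := ler_norm (- (A x j - A y j)).
  by rewrite normrN => h3 h4; apply/andP; split; lra.
apply: lerD; last exact: d2.
by apply: lerD; last exact: d1.
Qed.
End rounding.
End folner.

(** * Integer weights from coamenability *)

Lemma cvge0_lt (K : realType) (u : nat -> \bar K) (e : K) : u @ \oo --> 0%E ->
  0 < e -> \forall n \near \oo, (u n < e%:E)%E.
Proof.
move=> u0 e0; apply: (u0 [set y | (y < e%:E)%E]).
by apply: open_ereal_lt'; rewrite lte_fin.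
Qed.

Section folner_exists.
Context (K : realType) (d : measure_display) (X : measurableType d).
Variable mu : probability X K.
Context (F : set (set X)) (C0 : nat -> nat -> set X).
Hypothesis sb : souslin_base F C0.
Variables (R S : set (X * X)) (g : nat -> X -> X).
Hypothesis dR : dmp_equivalence_rel mu R.
Hypothesis dS : dmp_equivalence_rel mu S.
Hypothesis SR : S `<=` R.
Hypothesis gI : forall j, inv_in R (g j).
Hypothesis gcov : {ae mu, forall x, forall y, R (x, y) -> exists j, y = g j x}.

Let gR j x : R (x, g j x). Proof. by case: (gI j). Qed.
Let mg j : measurable_fun setT (g j). Proof. by case: (gI j). Qed.
Let mR : measurable R. Proof. by case: dR => -[]. Qed.
Let pR : measure_preserving_rel mu R. Proof. by case: dR. Qed.
Let gmu j A : measurable A -> mu (g j @^-1` A) = mu A.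
Proof. by apply: (full_group_preimage sb mR pR); exact: inv_in_full_group. Qed.

Local Notation normc := ComplexField.Normc.normc.
Local Notation CQ := (class_quotient R S).
Local Notation fr j x := (`[< first_rep S g j x >]).

Lemma sqrte_le_sqr (a : \bar K) e : (0 <= a)%E -> 0 <= e -> (sqrte a <= e%:E)%E ->
  (a <= (e ^+ 2)%:E)%E.
Proof.
move=> a0 e0; case: a a0 => [a||]//=; rewrite ?lee_fin => a0 ae.
by rewrite -(sqr_sqrtr a0) ler_sqr ?nnegrE ?sqrtr_ge0.
Qed.

Section pointwise.
Variables (xi : X -> set X -> K[i]) (x y : X).
Hypothesis covx : forall z, R (x, z) -> exists j, z = g j x.
Hypothesis Rxy : R (x, y).
Hypothesis ex : (\esum_(c in CQ x) (sqmod xi x c)%:E = 1)%E.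
Hypothesis ey : (\esum_(c in CQ y) (sqmod xi y c)%:E = 1)%E.

Let phi c : K := `|sqmod xi x c - sqmod xi y c|.

Let sums_le1 J : class_sum S g J x (sqmod xi x) <= 1 /\ class_sum S g J x (sqmod xi y) <= 1.
Proof.
rewrite -!lee_fin; split.
  by rewrite -ex; exact: (class_sum_le_esum dR dS SR gR covx (sqmod_ge0 _ _)).
rewrite -ey -(class_quotient_eq S dR Rxy).
exact: (class_sum_le_esum dR dS SR gR covx (sqmod_ge0 _ _)).
Qed.

Lemma sqmod_diff_le2 J : class_sum S g J x phi <= 2.
Proof.
have [h1 h2] := sums_le1 J.
apply: (@le_trans _ _ (class_sum S g J x (sqmod xi x) + class_sum S g J x (sqmod xi y))); last by lra.
rewrite /class_sum -big_split/=; apply: ler_sum => j _.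
have := sqmod_ge0 xi x (rel_class S (g j x)); have := sqmod_ge0 xi y (rel_class S (g j x)).
by rewrite /phi ler_norml => a b; apply/andP; split; lra.
Qed.

Lemma sqmod_diff_le J (t e : K) : 0 < t -> 0 <= e ->
  (l2norm (CQ x) (fun c => (xi x c - xi y c)%R) <= e%:E)%E ->
  class_sum S g J x phi <= t * 2 + e ^+ 2 / (2 * t).
Proof.
move=> t0 e0 xe; have [h1 h2] := sums_le1 J.
pose psi c := normc (xi x c - xi y c) ^+ 2.
have psi0 c : 0 <= psi c by exact: sqr_ge0.
have h3 : class_sum S g J x psi <= e ^+ 2.
  rewrite -lee_fin; apply: le_trans (class_sum_le_esum dR dS SR gR covx psi0 J) _.
  by apply: sqrte_le_sqr => //; apply: esum_ge0 => c _; rewrite lee_fin.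
have t2 : 0 < 2 * t by rewrite mulr_gt0.
apply: (@le_trans _ _ (t * (class_sum S g J x (sqmod xi x) + class_sum S g J x (sqmod xi y)) +
   class_sum S g J x psi / (2 * t))).
  rewrite /class_sum -big_split/= mulr_sumr mulr_suml -big_split/=.
  by apply: ler_sum => j _; exact: normc_sqr_diff.
apply: lerD; last by rewrite ler_pM2r// invr_gt0.
by rewrite ler_pM2l//; lra.
Qed.

End pointwise.

Hypothesis coam : coamenable mu R S.

(** The mean over [x] of the total variation between the square moduli at [x]
    and at [g i x] tends to [0] by dominated convergence, which fixes the
    vectors; keeping [J] classes loses little mass, which fixes [J]; and
    rounding to multiples of [1 / m] loses at most [J / m], which is small for
    large [m]. By [rounded_diff] these three errors bound the change of the
    weights. *)
Lemma folner_exists (r : nat) (del : K) : 0 < del -> del <= 1 ->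
  exists J m0, forall m, (m0 <= m)%N -> exists k : nat -> X -> nat,
  [/\ forall j, mnat (k j), forall x, (\sum_(j < J) k j x <= m)%N,
      forall j x, (j < J)%N -> ~ first_rep S g j x -> k j x = 0%N,
      m%:R / 2 <= Ex mu (fun x => (\sum_(j < J) k j x)%:R) &
      forall i, (i < r)%N ->
       \sum_(j < J) Ex mu (fun x => (class_diff S J g k (g i) j x)%:R) <= del * m%:R].
Proof.
move=> del0 del1; have [xi [mxi xi1 xic]] := coam.
have /choice[b bP] : forall nj : nat * nat, exists b : X -> K,
  [/\ measurable_fun setT b, forall x, 0 <= b x <= 1 &
      {ae mu, forall x, b x = sqmod (xi nj.1) x (rel_class S (g nj.2 x))}].
  move=> nj; apply: (sqmod_version dR SR (mxi nj.1) (xi1 nj.1)).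
  exact: inv_in_full_group.
have /choice[b' bP'] : forall nij : nat * (nat * nat), exists b : X -> K,
  [/\ measurable_fun setT b, forall x, 0 <= b x <= 1 &
      {ae mu, forall x, b x = sqmod (xi nij.1) (g nij.2.1 x) (rel_class S (g nij.2.2 x))}].
  by move=> nij; exact: (sqmod_moved_version sb dR SR gI (mxi nij.1) (xi1 nij.1)).
pose nu n := sqmod (xi n).
have nu0 n y c : 0 <= nu n y c by exact: sqmod_ge0.
pose bb n j := b (n, j).
have mbb n j : measurable_fun setT (bb n j) by case: (bP (n, j)).
have bb01 n j x : 0 <= bb n j x <= 1 by case: (bP (n, j)) => _ + _; exact.
pose Good x := forall n, good R S g (nu n) (bb n) x.
have aeG : {ae mu, forall x, Good x}.
  apply: ae_forall_nat => n.
  have h : {ae mu, forall x, forall j, bb n j x = nu n x (rel_class S (g j x))}.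
    by apply: ae_forall_nat => j; case: (bP (n, j)).
  by apply: filterS (filterI (filterI gcov (esum_sqmod (xi1 n))) h) => x [[? ?] ?].
have aeGi i : {ae mu, forall x, Good (g i x)} by exact: ae_preimage (mg i) (@gmu i) aeG.
have aeb' i : {ae mu, forall x, forall n j,
    b' (n, (i, j)) x = nu n (g i x) (rel_class S (g j x))}.
  by apply: ae_forall_nat => n; apply: ae_forall_nat => j; case: (bP' (n, (i, j))).
have aec i : {ae mu, forall x, (fun n => l2norm (CQ x)
    (fun c => (xi n x c - xi n (g i x) c)%R)) @ \oo --> 0%E}.
  have [N [mN N0 bad]] := xic.
  apply: negligibleS (rel_measure_eq0_graph mN N0 (mg i)) => x /= nc.
  by apply: bad; split.
pose q i n x := (\sum_(j <oo) ((fr j x)%:R * `|bb n j x - b' (n, (i, j)) x|)%:E)%E.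
have bmq i n j : bmf (fun x => (fr j x)%:R * `|bb n j x - b' (n, (i, j)) x|).
  apply: (bmf_first_mul sb dR dS gI); apply: bmf_norm; apply: bmfB.
    exact: bmf_b (mbb n) (bb01 n) j.
  have [m' b'01 _] := bP' (n, (i, j)); split=> //.
  by exists 1 => x; have /andP[h1 h2] := b'01 x; rewrite ger0_norm.
have q0 i n x j : 0 <= (fr j x)%:R * `|bb n j x - b' (n, (i, j)) x| :> K by rewrite mulr_ge0.
have mq i n : measurable_fun setT (q i n).
  apply: (@ge0_emeasurable_sum _ _ _ setT (fun j x => ((fr j x)%:R * `|bb n j x - b' (n, (i, j)) x|)%:E) predT).
    by move=> j x _ _; rewrite lee_fin.
  by move=> j _; apply/measurable_EFinP; case: (bmq i n j).
have qE i n x : Good x -> Good (g i x) -> (forall n j,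
    b' (n, (i, j)) x = nu n (g i x) (rel_class S (g j x))) ->
    q i n x = (\esum_(c in CQ x) `|nu n x c - nu n (g i x) c|%:E)%E.
  move=> Gx Gy b'x; have [covx _ bx] := Gx n.
  rewrite (esum_class_quotient dR dS SR gR covx (phi := fun c => `|nu n x c - nu n (g i x) c| : K)); last by [].
  rewrite eseries_mkcond; apply: eq_eseriesr => j _.
  by case: asboolP => _; rewrite ?mul0r// mul1r bx b'x.
have qle2 i : {ae mu, forall x, forall n, (q i n x <= 2%:E)%E}.
  apply: filterS (filterI (filterI aeG (aeGi i)) (aeb' i)) => x [[Gx Gy] b'x] n.
  rewrite qE//; have [covx ex _] := Gx n; have [_ ey _] := Gy n.
  apply: (esum_le_class_sum dR dS SR gR covx (phi := fun c => `|nu n x c - nu n (g i x) c| : K)) => // J.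
  exact: sqmod_diff_le2 covx (gR i x) ex ey J.
have qto0 i : {ae mu, forall x, (fun n => q i n x) @ \oo --> 0%E}.
  apply: filterS (filterI (filterI aeG (aeGi i)) (filterI (aeb' i) (aec i))) => x [[Gx Gy] [b'x cx]].
  (* The parameter [t] is the one of [normc_sqr_diff]. *)
  have qb n t e : 0 < t -> 0 <= e ->
     (l2norm (CQ x) (fun c => (xi n x c - xi n (g i x) c)%R) <= e%:E)%E ->
     (q i n x <= (t * 2 + e ^+ 2 / (2 * t))%:E)%E.
    move=> t0 e0 xe; rewrite qE//; have [covx ex _] := Gx n; have [_ ey _] := Gy n.
    apply: (esum_le_class_sum dR dS SR gR covx (phi := fun c => `|nu n x c - nu n (g i x) c| : K)) => // J.
    exact: sqmod_diff_le covx (gR i x) ex ey J t e t0 e0 xe.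
  have qge0 n : (0 <= q i n x)%E by apply: nneseries_ge0 => j _ _; rewrite lee_fin.
  have small e : 0 < e -> \forall n \near \oo, (q i n x <= e%:E)%E.
    move=> e0; pose t := e / 4; have t0 : 0 < t by rewrite divr_gt0.
    have : \forall n \near \oo, (l2norm (CQ x) (fun c => (xi n x c - xi n (g i x) c)%R) < t%:E)%E.
      exact: cvge0_lt cx t0.
    apply: filterS => n /ltW xe; apply: le_trans (qb n t t t0 (ltW t0) xe) _.
    rewrite lee_fin; have -> : t ^+ 2 / (2 * t) = t / 2 by field; rewrite gt_eqF.
    rewrite /t; lra.
  apply/fine_cvgP; split.
    apply: filterS (small 1 ltr01) => n qn.
    by rewrite ge0_fin_numE// (le_lt_trans qn)// ltry.
  apply/cvgrPdist_le => e e0; apply: filterS (small e e0) => n qn /=.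
  rewrite sub0r normrN ger0_norm ?fine_ge0//.
  have qf : q i n x \is a fin_num by rewrite ge0_fin_numE// (le_lt_trans qn)// ltry.
  by rewrite -lee_fin fineK.
have intq i : (fun n => \int[mu]_x q i n x)%E @ \oo --> 0%E.
  apply: (bounded_convergence0 (M := 2)) (mq i) _ (qle2 i) (qto0 i).
  by move=> n x; apply: nneseries_ge0 => j _ _; rewrite lee_fin.
have [n nP] : exists n, forall i, (i < r)%N -> (\int[mu]_x q i n x <= (del / 4)%:E)%E.
  have h : \forall n \near \oo, forall i, (i < r)%N -> (\int[mu]_x q i n x < (del / 4)%:E)%E.
    apply: (@filter_forall_lt _ \oo (fun i n => \int[mu]_x q i n x < (del / 4)%:E)%E) => i.
    by apply: cvge0_lt (intq i) _; rewrite divr_gt0.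
  by have [n nP] := filter_ex h; exists n => i ir; exact: ltW (nP i ir).
pose pm J := partial_mass S g (bb n) J.
have bpm J : bmf (pm J) by exact: (bmf_partial_mass sb dR dS gI (mbb n) (bb01 n)).
have pm_cs J x : Good x -> pm J x = class_sum S g J x (nu n x).
  by move=> Gx; exact: partial_mass_class_sum (Gx n).
have pm_le1 J x : Good x -> pm J x <= 1.
  by move=> Gx; exact: (good_mass_le1 dR dS SR gI (nu0 n) J (Gx n)).
have pm_ge0 J x : 0 <= pm J x.
  by apply: sumr_ge0 => j _; rewrite mulr_ge0//; case/andP: (bb01 n j x).
have intpm : (fun J => \int[mu]_x `|1 - pm J x|%:E)%E @ \oo --> 0%E.
  apply: (bounded_convergence0 (M := 1)).
  - move=> J; apply/measurable_EFinP.
    by have [] := bmf_norm (bmfB (bmf_cst X 1) (bpm J)).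
  - by move=> J x; rewrite lee_fin.
  - apply: filterS aeG => x Gx J; rewrite lee_fin.
    by have := pm_le1 J x Gx; have := pm_ge0 J x; rewrite ler_norml => a c; apply/andP; split; lra.
  - apply: filterS aeG => x Gx; apply: cvg_EFin; first exact: nearW.
    apply/cvgrPdist_le => e e0 /=.
    have [covx ex _] := Gx n.
    have [J Je] : exists J, 1 - e <= class_sum S g J x (nu n x).
      apply: contrapT => nJ.
      have : (\esum_(c in CQ x) (nu n x c)%:E <= (1 - e)%:E)%E.
        apply: (esum_le_class_sum dR dS SR gR covx (nu0 n x)) => J.
        by rewrite leNgt; apply/negP => /ltW h; apply: nJ; exists J.
      by rewrite ex lee_fin; lra.
    exists J => // J' /= JJ'; rewrite sub0r normrN normr_id.
    have h := class_sum_mono S g x (nu0 n x) JJ'.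
    have := pm_le1 J' x Gx; rewrite pm_cs// => h2.
    by rewrite ger0_norm; lra.
have [J JP] : exists J, (\int[mu]_x `|1 - pm J x|%:E <= (del / 8)%:E)%E.
  have : \forall J \near \oo, (\int[mu]_x `|1 - pm J x|%:E < (del / 8)%:E)%E.
    by apply: cvge0_lt intpm _; rewrite divr_gt0.
  by move=> /filter_ex[J /ltW]; exists J.
have b1pm : bmf (fun x => `|1 - pm J x|) by apply: bmf_norm; apply: bmfB => //; exact: bmf_cst.
have Epm : 1 - del / 8 <= Ex mu (pm J).
  have h : Ex mu (fun x => `|1 - pm J x|) <= del / 8.
    by apply: (Ex_fin_le b1pm _ _ JP) => x; rewrite ?lexx.
  have : Ex mu (fun x => 1 - pm J x) <= Ex mu (fun x => `|1 - pm J x|).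
    apply: Ex_le => //; first by apply: bmfB => //; exact: bmf_cst.
    by move=> x; exact: ler_norm.
  rewrite ExB//; last exact: bmf_cst.
  by rewrite Ex_cst; lra.
exists J, (Num.truncn (4 * J%:R / del)).+1 => m m0m.
(* Rounding loses at most one unit for each of the [J] classes. *)
have mJ : J%:R <= del * m%:R / 4.
  have h : 4 * J%:R / del < m%:R.
    apply: lt_le_trans (_ : (Num.truncn (4 * J%:R / del)).+1%:R <= _); last by rewrite ler_nat.
    have h0 : 0 <= 4 * J%:R / del by apply: divr_ge0; [exact: mulr_ge0|exact: ltW].
    by have /andP[] := truncn_itv h0.
  rewrite ltr_pdivrMr// in h; lra.
pose k := rounded S g (bb n) J m.
have mk j : mnat (k j) by exact: (mnat_rounded sb dR dS gI (mbb n) (bb01 n)).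
have km x : (\sum_(j < J) k j x <= m)%N by exact: (rounded_sum S g (bb01 n)).
have kf j x : (j < J)%N -> ~ first_rep S g j x -> k j x = 0%N.
  by move=> _; exact: rounded_first.
have btau : bmf (fun x => (\sum_(j < J) k j x)%N%:R : K).
  by apply: mnat_bmf km; exact: mnat_sum.
have Etau : m%:R * (1 - del / 8) - J%:R <= Ex mu (fun x => (\sum_(j < J) k j x)%N%:R).
  apply: (@le_trans _ _ (Ex mu (fun x => m%:R * pm J x - J%:R))).
    rewrite ExB; [|by apply: bmfM => //; exact: bmf_cst|exact: bmf_cst].
    by rewrite ExZ// Ex_cst lerD2r ler_wpM2l.
  apply: Ex_ae_le => //.
    by apply: bmfB; [apply: bmfM => //|]; exact: bmf_cst.
  by apply: filterS aeG => x Gx; exact: (rounded_loss dR dS SR gI (nu0 n) J m (Gx n)).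
exists k; split => //.
- apply: le_trans Etau.
  have m_ge0 : 0 <= m%:R :> K by [].
  nra.
move=> i ir.
have bdiff j : bmf (fun x => (class_diff S J g k (g i) j x)%:R : K).
  apply: (@mnat_bmf _ _ _ _ m); last exact: (class_diff_le S g km).
  exact: (mnat_class_diff J dS (inv_in_mu_inv sb dR gI) mk _ (mg i)).
rewrite -Ex_sum//.
pose Q x : K := \sum_(j < J) ((fr j x)%:R * `|bb n j x - b' (n, (i, nat_of_ord j)) x|).
have bQ : bmf Q by exact: bmf_sum.
have EQ : Ex mu Q <= del / 4.
  apply: (Ex_fin_le bQ _ _ (nP i ir)) => x; first by apply: sumr_ge0.
  rewrite /Q -sumEFin -(big_mkord xpredT (fun j => ((fr j x)%:R * `|bb n j x - b' (n, (i, j)) x|)%:E)).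
  by apply: nneseries_lim_ge => j _ _; rewrite lee_fin.
pose tau x : K := (\sum_(j < J) k j x)%N%:R.
have Etaui : Ex mu (tau \o g i) = Ex mu tau by apply: Ex_comp => // A; exact: gmu.
have btaui := bmf_comp btau (mg i).
have bm : bmf (fun=> m%:R : K) := bmf_cst X m%:R.
apply: (@le_trans _ _ (Ex mu (fun x => m%:R * Q x + (m%:R - tau x) + (m%:R - (tau \o g i) x)))).
  apply: Ex_ae_le.
  - exact: bmf_sum.
  - by apply: bmfD; [apply: bmfD; [exact: bmfM|exact: bmfB]|exact: bmfB].
  apply: filterS (filterI (filterI aeG (aeGi i)) (aeb' i)) => x [[Gx Gy] b'x].
  rewrite -natr_sum.
  exact: (rounded_diff dR dS SR gI (nu0 n) J m (Gx n) (Gy n) (b'x n)).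
rewrite ExD; [|by apply: bmfD; [exact: bmfM|exact: bmfB]|exact: bmfB].
rewrite ExD; [|exact: bmfM|exact: bmfB].
rewrite ExZ// ExB// ExB// Etaui Ex_cst.
have m_ge0 : 0 <= m%:R :> K by [].
have := ler_wpM2l m_ge0 EQ; move: Etau; rewrite -/tau.
lra.
Qed.

End folner_exists.

(** * Strong ergodicity *)

Section strong_ergodicity.
Context (K : realType) (d : measure_display) (X : measurableType d).
Variable mu : probability X K.
Context (F : set (set X)) (C0 : nat -> nat -> set X).
Hypothesis sb : souslin_base F C0.

Variables (R S : set (X * X)) (g : nat -> X -> X).
Hypothesis dR : dmp_equivalence_rel mu R.
Hypothesis gI : forall j, inv_in R (g j).
Hypothesis gcov : {ae mu, forall x, forall y, R (x, y) -> exists j, y = g j x}.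

Let mR : measurable R. Proof. by case: dR => -[]. Qed.
Let pR : measure_preserving_rel mu R. Proof. by case: dR. Qed.
Let mg j : measurable_fun setT (g j). Proof. by case: (gI j). Qed.

(** Almost everywhere an element [h] of the full group agrees with some [g i],
    and up to a set of small measure finitely many [i] suffice. Where [h]
    agrees with [g i], the point [x] is in the symmetric difference of [C r]
    and its preimage by [h] only if it is in the corresponding one for [g i]. *)
Lemma almost_invariant_generators (C : nat -> set X) : (forall r, measurable (C r)) ->
  (forall i, (fun r => Pr mu (C r `+` g i @^-1` C r)) @ \oo --> (0 : K)) ->
  almost_invariant mu R C.
Proof.
move=> mC Ci; split=> // h hR; have [bh mh imh hx] := hR.
pose B i := [set x | h x = g i x].
have mB i : measurable (B i) by exact: (measurable_eq_fun sb).
have mD i r : measurable (C r `+` g i @^-1` C r).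
  by apply: measurableY => //; rewrite -[_ @^-1` _]setTI; exact: mg.
have mDh r : measurable (C r `+` h @^-1` C r).
  by apply: measurableY => //; rewrite -[_ @^-1` _]setTI; exact: mh.
have E r : Pr mu (h @` C r `+` C r) = Pr mu (C r `+` h @^-1` C r).
  rewrite /Pr -(full_group_preimage sb mR pR hR (measurableY (imh _ (mC r)) (mC r))).
  congr (fine (mu _)).
  have hC : h @^-1` (h @` C r) = C r.
    apply/seteqP; split=> [x [y Cy] /(bij_inj bh) <-//|x Cx]; first by exists x.
  by rewrite -[X in _ = X `+` _]hC.
under eq_fun do rewrite E.
apply/cvgrPdist_lt => e e0.
have [N NB] := Pr_bigcup_tail mu (divr_gt0 e0 (ltr0n K 2)) mB.
have : (fun r => \sum_(i < N) Pr mu (C r `+` g i @^-1` C r)) @ \oo --> (0 : K).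
  have := @cvg_sumr K \oo _ _ (index_enum 'I_N) xpredT _ (fun=> 0) (fun i => Ci (nat_of_ord i)).
  rewrite big1_eq; exact.
move=> /cvgrPdist_lt/(_ _ (divr_gt0 e0 (ltr0n K 2))); apply: filterS => r /=.
rewrite !sub0r !normrN => h2.
rewrite ger0_norm ?Pr_ge0//.
have mT : measurable (\bigcup_i B i `\` \big[setU/set0]_(i < N) B i).
  by apply: measurableD; [exact: bigcupT_measurable|exact: bigsetU_measurable].
have mU : measurable (\big[setU/set0]_(i < N) (C r `+` g i @^-1` C r)).
  exact: bigsetU_measurable.
have h1 : Pr mu (C r `+` h @^-1` C r) <=
  Pr mu (\big[setU/set0]_(i < N) (C r `+` g i @^-1` C r) `|`
         (\bigcup_i B i `\` \big[setU/set0]_(i < N) B i)).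
  apply: Pr_ae_le => //; first exact: measurableU.
  apply: negligibleS (filterI gcov hx) => x /= [Dx nx] [cx Rx]; apply: nx.
  have [j hj] := cx _ Rx.
  have [[i iN Bi]|nB] := pselect (exists2 i, (i < N)%N & B i x).
    left; rewrite -(bigcup_mkord N (fun i => C r `+` g i @^-1` C r)); exists i => //.
    by move: Dx; rewrite /setY /= Bi.
  right; split; first by exists j.
  by rewrite -(bigcup_mkord N B) => -[i /= iN Bi]; apply: nB; exists i.
have h3 := PrU_le mu mU mT.
have h4 := Pr_bigU_le mu N (fun i => mD i r).
have h5 := ler_norm (\sum_(i < N) Pr mu (C r `+` g i @^-1` C r)).
move: NB h1 h2 h3 h4 h5; lra.
Qed.

Hypothesis dS : dmp_equivalence_rel mu S.
Hypothesis SR : S `<=` R.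
Hypothesis eS : ergodic mu S.
Hypothesis coam : coamenable mu R S.
Hypothesis nS : ~ strongly_ergodic mu S.

Let mS : measurable S. Proof. by case: dS => -[]. Qed.
Let pS : measure_preserving_rel mu S. Proof. by case: dS. Qed.

(** With [m] the integral part of [1 / (4 * eps)], the quantity [s = eps * m]
    lies between [1 / 8] and [1 / 4]. By [nearly_invariant_union], [Pr mu C]
    is at most [s] up to the error, and [s / 2 - s * Pr mu C <= Pr mu C] up to
    the error; the error is at most [1 / 32], and
    [(1 / 16 - 1 / 32) / (1 + 1 / 4) = 1 / 40]. *)
Lemma exists_nearly_invariant (r : nat) : exists C : set X,
  [/\ measurable C, 1 / 40 <= Pr mu C <= 1 / 2 &
      forall i, (i < r)%N -> Pr mu (C `+` g i @^-1` C) <= r.+1%:R^-1].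
Proof.
pose del : K := r.+1%:R^-1.
have del0 : 0 < del by rewrite invr_gt0 ltr0n.
have del1 : del <= 1 by rewrite invf_le1 ?ltr0n// ler1n.
have [J [m0 FJ]] := folner_exists sb dR dS SR gI gcov coam r del0 del1.
(* This bound on the measure of the sets [Z n] makes [m] at least [m0], and
   [eps] at most [1 / 8]. *)
pose e0 : K := (4 * (m0 + 2)%:R)^-1.
have m2 : 2 <= (m0 + 2)%:R :> K by rewrite natrD lerDr.
have e00 : 0 < e0 by rewrite invr_gt0; lra.
have e08 : e0 <= 1 / 8.
  by rewrite div1r lef_pV2 ?posrE//; lra.
have [Z [iZ [eta [eta0 Zb]]]] := exists_small_almost_invariant sb mS pS eS e00 nS.
have [U [UU ooU]] := ultrafilter_oo.
pose eps := ulim U (fun n => Pr mu (Z n)).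
have Zeps : Pr mu (Z n) @[n --> U] --> eps.
  by apply: (ulimP UU (M := 1)) => n; rewrite ger0_norm ?Pr_ge0//; apply: Pr_le1; case: iZ.
have eps_ge : eta <= eps.
  by apply: (ultra_le UU (cvg_cst eta) Zeps) => n; case/andP: (Zb n).
have eps_le : eps <= e0.
  by apply: (ultra_le UU Zeps (cvg_cst e0)) => n; case/andP: (Zb n).
have eps0 : 0 < eps by exact: lt_le_trans eps_ge.
have mixZ B : measurable B -> Pr mu (Z n `&` B) @[n --> U] --> eps * Pr mu B.
  move=> mB; have c1 := cvg_oo_ultra ooU (mixing sb mS pS eS iZ mB).
  have c2 : Pr mu (Z n) * Pr mu B @[n --> U] --> eps * Pr mu B by exact: cvgMl.
  have : (fun n => Pr mu (Z n `&` B) - Pr mu (Z n) * Pr mu B + Pr mu (Z n) * Pr mu B) @ U -->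
    0 + eps * Pr mu B by exact: cvgD.
  by under eq_fun do rewrite subrK; rewrite add0r.
pose m := Num.truncn (4 * eps)^-1.
have h0 : 0 <= (4 * eps)^-1 by rewrite invr_ge0; lra.
have e4 : 0 < 4 * eps by lra.
have /andP[mle ltm] := truncn_itv h0; rewrite -/m in mle ltm.
have m0m : (m0 <= m)%N.
  rewrite -ltnS -(ltr_nat K); apply: le_lt_trans ltm.
  apply: (@le_trans _ _ (m0 + 2)%:R); first by rewrite ler_nat leq_addr.
  have -> : (m0 + 2)%:R = (4 * e0)^-1 :> K.
    by rewrite /e0; field; rewrite ?gt_eqF//; lra.
  by rewrite lef_pV2 ?posrE//; lra.
have s_le : eps * m%:R <= 1 / 4.
  by move: mle; rewrite -(ler_pM2l e4) divff ?gt_eqF//; lra.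
have s_ge : 1 / 8 <= eps * m%:R.
  move: ltm; rewrite -(ltr_pM2l e4) divff ?gt_eqF// -natr1; lra.
have [k [mk km kf Ek kr]] := FJ m m0m.
have g_inv := inv_in_mu_inv sb dR gI.
have hb i : (i < r)%N -> exists u c, [/\ u @ U --> c, c <= del / 2 &
   forall n, Ex mu (fun x => `|(marked Z J g k n x)%:R - (marked Z J g k n (g i x))%:R|) <= u n].
  move=> ir.
  have [u [c [uc cb ub]]] := marked_discrepancy sb dS g_inv mk km kf UU ooU iZ mixZ (g_inv i).
  exists u, c; split=> //; apply: (le_trans cb).
  have := ler_wpM2l (ltW eps0) (kr i ir); have := ler_wpM2l (ltW del0) s_le; lra.
have eta'0 : 0 < del / 32 by rewrite divr_gt0.
have mZ n : measurable (Z n) by case: iZ.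
have [C [mC C1 C2 C3]] := nearly_invariant_union UU mZ mixZ g_inv mk km hb eta'0.
exists C; split=> //; last by move=> i ir; have := C3 i ir; rewrite -/del; lra.
have := ler_wpM2l (ltW eps0) Ek.
set s := eps * m%:R in s_le s_ge C1 C2 *.
have PC := Pr_ge0 mu C.
have sP : s * Pr mu C <= 1 / 4 * Pr mu C by rewrite ler_wpM2r.
move=> h; have h' : s / 2 <= eps * Ex mu (fun x : X => (\sum_(j < J) k j x)%:R).
  by move: h; rewrite /s mulrA.
by apply/andP; split; lra.
Qed.

Lemma exists_almost_invariant : exists C, almost_invariant mu R C /\
  forall r, 1 / 40 <= Pr mu (C r) <= 1 / 2.
Proof.
have /choice[C CP] := exists_nearly_invariant.
exists C; split; last by move=> r; case: (CP r).
apply: almost_invariant_generators => [r|i]; first by case: (CP r).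
apply: (squeeze_cvgr _ (cvg_cst 0) (@cvg_harmonic K)).
exists i.+1 => // r /= ir; have [_ _ /(_ i ir) ->] := CP r.
by rewrite Pr_ge0.
Qed.

End strong_ergodicity.

Lemma full_groupS (K : realType) (d : measure_display) (X : measurableType d)
  (mu : probability X K) (R S : set (X * X)) :
  S `<=` R -> full_group mu S `<=` full_group mu R.
Proof.
by move=> SR g [bg mg img hg]; split=> //; apply: filterS hg => x; exact: SR.
Qed.

Theorem theorem1p1 (K : realType) (d : measure_display) (X : measurableType d)
    (mu : probability X K) (R S : set (X * X)) :
  standard_borel K X ->
  dmp_equivalence_rel mu R -> dmp_equivalence_rel mu S ->
  ergodic mu R -> ergodic mu S ->
  S `<=` R ->
  coamenable mu R S ->
  strongly_ergodic mu R <-> strongly_ergodic mu S.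
Proof.
move=> sX dR dS _ eS SR coam; split; last first.
  move=> seS A mA iA; apply: seS mA _ => g gS.
  by apply: iA; exact: full_groupS gS.
move=> seR; apply: contrapT => nS.
have [x0 _] : exists x : X, True.
  apply: contrapT => nX; have := @probability_setT _ _ _ mu.
  have -> : [set: X] = set0 by apply/seteqP; split=> // x _; apply: nX; exists x.
  by rewrite measure0 => /eqP; rewrite eq_sym onee_eq0.
have [F [C0 sb]] := standard_borel_souslin_base x0 sX.
have [g [gI gcov]] := feldman_moore sb dR.
have [C [iC Cb]] := exists_almost_invariant sb dR gI gcov dS SR eS coam nS.
move/strongly_ergodicP: seR => /(_ C iC)/cvgrPdist_lt/(_ (1 / 80)).
have h80 : 0 < 1 / 80 :> K by rewrite divr_gt0.
move=> /(_ h80)/filter_ex[r]; rewrite sub0r normrN.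
have /andP[c1 c2] := Cb r.
have : 1 / 80 <= Pr mu (C r) * (1 - Pr mu (C r)) by nra.
by move=> h; rewrite ger0_norm; lra.
Qed.
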